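(* Fix $N\in\mathbb{N}$ and $y\in\Omega_N^{\mathbb Z}$, and for $L>0$ let $\mathsf{Y}^{(L)}$ be the system of $N$ myopic non-intersecting (Poisson) random walks with foresight $L$, started at $y$. Then the limits $$\mathsf{Y}^{(0^+)}=\lim_{L\searrow 0}\mathsf{Y}^{(L)}\qquad\text{and}\qquad \mathsf{Y}^{(\infty)}=\lim_{L\nearrow\infty}\mathsf{Y}^{(L)}$$ exist in distribution with respect to the Skorohod topology on compact sets. Furthermore: (i) $\mathsf{Y}^{(0^+)}$ has the law of TASEP with $N$ particles (started at $y$); (ii) $\mathsf{Y}^{(\infty)}$ has the law of a system of $N$ Poisson random walks conditioned on never intersecting (started at $y$).
   Context: Weyl chamber: $\Omega_N=\{x\in\mathbb{R}^N: x_1<x_2<\dots<x_N\}$ and $\Omega_N^{\mathbb Z}=\Omega_N\cap\mathbb{Z}^N$. $e_i$ denotes the $i$-th canonical vector. Let $\mathsf{Y}=(\mathsf{Y}_1,\dots,\mathsf{Y}_N)$ be a system of $N$ independent rate $1$ Poisson processes (continuous-time random walks on $\mathbb Z$ jumping by $+1$ at rate $1$) started from $\mathsf Y(0)=y\in\mathbb Z^N$ under $\mathbb{P}_y$. For $L>0$ let $h_L(y)=\mathbb{P}_y(\mathsf{Y}(t)\in\Omega_N\ \forall t\in[0,L])$; thus $h_L>0$ on $\Omega_N^{\mathbb Z}$ and $h_L(y)=0$ for $y\notin\Omega_N^{\mathbb Z}$. Myopic non-intersecting random walks (mRW) with foresight $L>0$: the time-homogeneous Markov chain $\mathsf{Y}^{(L)}$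 on $\Omega_N^{\mathbb Z}$ with generator $$\mathcal{L}^{(L)}F(y)=\sum_{i=1}^N\big(F(y+e_i)-F(y)\big)\frac{h_L(y+e_i)}{h_L(y)}.$$ TASEP with $N$ particles: the continuous-time Markov chain on $\Omega_N^{\mathbb Z}$ in which each particle independently attempts to jump one unit to the right at rate $1$, the jump being allowed only if the target site is unoccupied. System of $N$ Poisson random walks conditioned on never intersecting: the Markov chain on $\Omega_N^{\mathbb Z}$ with generator $$\mathcal{L}^{(\infty)}F(y)=\sum_{i=1}^N\big(F(y+e_i)-F(y)\big)\frac{\Delta(y+e_i)}{\Delta(y)},\qquad \Delta(y)=\prod_{1\le i<j\le N}(y_j-y_i).$$ *)

(* Defs.v *)
From HB Require Import structures.
From mathcomp Require Import all_boot all_order all_algebra.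
From mathcomp Require Import all_classical all_reals all_analysis.

Set Implicit Arguments.
Unset Strict Implicit.
Unset Printing Implicit Defensive.

Import Order.TTheory GRing.Theory Num.Theory.
Import numFieldNormedType.Exports.

Local Open Scope classical_set_scope.
Local Open Scope ring_scope.

Section Skorokhod.
Context {R : realType} {E : pseudoMetricType R}.

(* Functions on [0, +oo[ are represented by functions on R; their values at
   negative times are never used. *)
Definition cadlag (f : R -> E) : Prop := forall t : R, 0 <= t ->
  (f x @[x --> t^'+] --> f t) /\
  (0 < t -> exists l : E, f x @[x --> t^'-] --> l).

Record skorokhod : Type :=
  Skorokhod { path_fun :> R -> E ; path_cadlag : cadlag path_fun }.

(* increasing bijections of [0, +oo[ *)
Definition time_change (l : R -> R) : Prop :=
  [/\ l 0 = 0,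
      forall s t : R, 0 <= s -> s < t -> l s < l t &
      forall u : R, 0 <= u -> exists2 t : R, 0 <= t & l t = u].

(* The sets J1_ball f m e form a basis of neighbourhoods of f for Skorokhod's J1
   topology on compact time sets: f_n tends to f iff there are time changes l_n
   such that sup_t |l_n t - t| tends to 0 and f_n \o l_n tends to f uniformly on
   every [0, m] (Jacod-Shiryaev, Limit Theorems for Stochastic Processes,
   Theorem VI.1.14). *)
Definition J1_ball (f : skorokhod) (m e : R) : set skorokhod :=
  [set g | exists2 l, time_change l &
     (forall t : R, 0 <= t -> `|l t - t| < e) /\
     (forall t : R, 0 <= t <= m -> ball (f t) e (g (l t)))].

Definition J1_nbhs (f : skorokhod) : set_system skorokhod :=
  [set A | exists m : R, exists2 e : R, 0 < e & J1_ball f m e `<=` A].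

HB.instance Definition _ := gen_eqMixin skorokhod.
HB.instance Definition _ := gen_choiceMixin skorokhod.
HB.instance Definition _ := hasNbhs.Build skorokhod J1_nbhs.

Lemma time_change_id : time_change id.
Proof. by split=> // u u0; exists u. Qed.

Lemma time_change_ge0 l t : time_change l -> 0 <= t -> 0 <= l t.
Proof.
move=> [l0 linc _]; rewrite le_eqVlt => /predU1P[<-|t0]; first by rewrite l0.
by rewrite -l0 ltW// linc.
Qed.

Lemma time_change_comp l1 l2 :
  time_change l1 -> time_change l2 -> time_change (l2 \o l1).
Proof.
move=> h1 h2; have [l10 inc1 sur1] := h1; have [l20 inc2 sur2] := h2.
split=> /=; first by rewrite l10.
  by move=> s t s0 st; apply: inc2; [exact: time_change_ge0|exact: inc1].
move=> u /sur2[v /sur1[t t0 <-] <-]; by exists t.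
Qed.

Lemma J1_ball_center f m e : 0 < e -> J1_ball f m e f.
Proof.
move=> e0; exists id; first exact: time_change_id.
split=> t _; first by rewrite subrr normr0.
exact: ballxx.
Qed.

Lemma J1_ball_le f m1 m2 e1 e2 : m1 <= m2 -> e2 <= e1 ->
  J1_ball f m2 e2 `<=` J1_ball f m1 e1.
Proof.
move=> m12 e21 g [l hl [le lb]]; exists l => //; split.
  by move=> t /le /lt_le_trans; apply.
move=> t /andP[t0 tm]; apply: (le_ball e21); apply: lb.
by rewrite t0 (le_trans tm).
Qed.

Lemma J1_ball_split f g h m e : 0 < e -> J1_ball f m (e / 2) g ->
  J1_ball g (m + e) (e / 2) h -> J1_ball f m e h.
Proof.
move=> e0 [l1 h1 [d1 b1]] [l2 h2 [d2 b2]].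
exists (l2 \o l1); first exact: time_change_comp.
split=> /= t.
  move=> t0; rewrite -(subrKA (l1 t)) (splitr e).
  apply: le_lt_trans (ler_normD _ _) _; apply: ltrD; last exact: d1.
  by apply: d2; exact: time_change_ge0.
move=> tm; have /andP[t0 tlem] := tm.
rewrite (splitr e); apply: (ball_triangle (b1 _ tm)).
apply: b2; rewrite (time_change_ge0 h1 t0)/=.
have := d1 _ t0; rewrite ltr_distl => /andP[_ /ltW lt].
rewrite (le_trans lt)// lerD//.
by rewrite [leRHS]splitr lerDl ltW// divr_gt0.
Qed.

Let J1_filter (f : skorokhod) : ProperFilter (nbhs f).
Proof.
split; last split.
- by move=> [m [e e0 /(_ f (J1_ball_center _ _ e0))]].
- by exists 0, 1.
- move=> A B [m1 [e1 e10 A1]] [m2 [e2 e20 B2]].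
  exists (Num.max m1 m2), (Num.min e1 e2); first by rewrite lt_min e10.
  move=> g gmn; split; [apply: A1|apply: B2]; apply: J1_ball_le gmn.
  + by rewrite le_max lexx.
  + by rewrite ge_min lexx.
  + by rewrite le_max lexx orbT.
  + by rewrite ge_min lexx orbT.
- by move=> A B AB [m [e e0 Ae]]; exists m, e => // g /Ae/AB.
Qed.

Let J1_singleton (f : skorokhod) (A : set skorokhod) : nbhs f A -> A f.
Proof. by move=> [m [e e0]]; apply; exact: J1_ball_center. Qed.

Let J1_nbhs_nbhs (f : skorokhod) (A : set skorokhod) : nbhs f A -> nbhs f (nbhs^~ A).
Proof.
move=> [m [e e0 Ae]]; exists m, (e / 2); first by rewrite divr_gt0.
move=> g fg; exists (m + e), (e / 2); first by rewrite divr_gt0.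
by move=> h gh; apply: Ae; exact: J1_ball_split fg gh.
Qed.

HB.instance Definition _ := Nbhs_isNbhsTopological.Build skorokhod
  J1_filter J1_singleton J1_nbhs_nbhs.

End Skorokhod.
Arguments skorokhod R E : clear implicits.

(* X L, possibly defined on a different probability space for each L, converges
   in distribution to Z along the filter F. *)
Definition cvg_in_law {R : realType} {E : pseudoMetricType R} (F : set_system R)
    {d : R -> measure_display} {T : forall L, measurableType (d L)}
    (P : forall L, probability (T L) R) (X : forall L, T L -> skorokhod R E)
    {d' : measure_display} {T' : measurableType d'}
    (Q : probability T' R) (Z : T' -> skorokhod R E) : Prop :=
  forall Phi : skorokhod R E -> R, continuous Phi ->
    (exists M : R, forall f, `|Phi f| <= M) ->
    ('E_(P L)[Phi \o X L] @[L --> F] --> 'E_Q[Phi \o Z])%E.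

Section Processes.
Context {R : realType}.

(* the sigma-algebra generated by the X u, u in I *)
Definition history {T : Type} {d'} {S : measurableType d'} (X : R -> T -> S)
    (I : set R) : set (set T) :=
  <<s [set A | exists2 u, I u & exists2 B, measurable B & A = X u @^-1` B] >>.

Context {d : measure_display} {T : measurableType d} (P : probability T R).

(* Rate 1 Poisson process started from 0: for s < t the increment X t - X s is
   Poisson(t - s) and independent of the history up to time s. *)
Definition poisson_process (X : R -> T -> nat) : Prop :=
  [/\ forall t : R, 0 <= t -> measurable_fun setT (X t),
      forall w, cadlag (fun t => X t w),
      forall w, X 0 w = 0%N &
      forall (s t : R) A k, 0 <= s < t -> history X [set u | 0 <= u <= s] A ->
        (P (A `&` [set w | X t w = (X s w + k)%N]) =
         P A * (poisson_pmf (t - s) k)%:E)%E].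

Definition independent_processes (I : finType) (X : I -> R -> T -> nat) : Prop :=
  forall A : I -> set T,
    (forall i, history (X i) [set u | 0 <= u] (A i)) ->
    fine (P (\bigcap_(i in [set: I]) A i)) = \prod_i fine (P (A i)).

Definition poisson_system (N : nat) (Y : 'I_N -> R -> T -> nat) : Prop :=
  (forall i, poisson_process (Y i)) /\ independent_processes Y.

Context {d' : measure_display} {S : measurableType d'}.

(* (p t) is a semigroup of probability kernels on S (every subset of which is
   measurable in the application below) with generator G. *)
Definition semigroup_of (G : (S -> R) -> S -> R)
    (p : R -> S -> probability S R) : Prop :=
  [/\ forall x A, measurable A -> p 0 x A = \d_x A,
      forall (s t : R) x A, 0 <= s -> 0 <= t -> measurable A ->
        (p (s + t)%R x A = \int[p s x]_z p t z A)%E &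
      forall F : S -> R, (exists M : R, forall z, `|F z| <= M) -> forall x,
        (\int[p h x]_z F z - F x) / h @[h --> 0^'+] --> G F x].

(* X is a time-homogeneous Markov chain with generator G started at y: for some
   semigroup p generated by G, P(X t \in B | X u, u <= s) = p (t - s) (X s) B. *)
Definition markov_process (G : (S -> R) -> S -> R) (y : S) (X : R -> T -> S) :
    Prop :=
  [/\ forall t : R, 0 <= t -> measurable_fun setT (X t),
      P (X 0 @^-1` [set y]) = 1%E &
      exists2 p : R -> S -> probability S R, semigroup_of G p &
      forall (s t : R) A B, 0 <= s <= t -> history X [set u | 0 <= u <= s] A ->
        measurable B ->
        (P (A `&` X t @^-1` B) = \int[P]_(w in A) p (t - s)%R (X s w) B)%E].

End Processes.

Section WeylChamber.
Context {N : nat}.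
Implicit Types x : 'rV[int]_N.

Definition in_weyl x : bool :=
  [forall i : 'I_N, forall j : 'I_N, (i < j)%N ==> (x 0 i < x 0 j)].

Definition weylZ : Type := {x : 'rV[int]_N | in_weyl x}.

Lemma in_weyl_iota : in_weyl (\row_(i < N) (i : nat)%:Z).
Proof.
by apply/forallP => i; apply/forallP => j; apply/implyP => ij; rewrite !mxE ltz_nat.
Qed.

HB.instance Definition _ := Countable.on weylZ.
HB.instance Definition _ := isPointed.Build weylZ
  (exist (fun x => in_weyl x) _ in_weyl_iota).
HB.instance Definition _ := @isMeasurable.Build default_measure_display weylZ
  discrete_measurable discrete_measurable0 discrete_measurableC
  discrete_measurableU.
(* The metric induced by R^N on the integer points is uniformly equivalent to the
   discrete one. *)
HB.instance Definition _ := hasNbhs.Build weylZ principal_filter.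
HB.instance Definition _ := Discrete_ofNbhs.Build weylZ erefl.
HB.instance Definition _ := DiscreteUniform_ofNbhs.Build weylZ.
HB.instance Definition _ {R : numDomainType} :=
  @DiscretePseudoMetric_ofUniform.Build R weylZ.

Definition evec (i : 'I_N) : 'rV[int]_N := delta_mx 0 i.

Context {R : realType}.

(* Extension by 0 of F outside the Weyl chamber; in the generators below, the
   rate of a jump leaving the chamber vanishes, so the value is irrelevant. *)
Definition extend (F : weylZ -> R) x : R := if insub x is Some z then F z else 0.

(* generator of the chain jumping from y to y + e_i at rate r y i *)
Definition jump_generator (r : 'rV[int]_N -> 'I_N -> R) (F : weylZ -> R)
    (y : weylZ) : R :=
  \sum_(i < N) (extend F (val y + evec i) - F y) * r (val y) i.

(* h_L(y), the Poisson system started from y being y + Y *)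
Definition stay_prob {d} {T : measurableType d} (P : probability T R)
    (Y : 'I_N -> R -> T -> nat) (L : R) x : R :=
  fine (P [set w | forall t : R, 0 <= t <= L ->
                     in_weyl (x + \row_i (Y i t w)%:Z)]).

Definition mRW_rate (h : 'rV[int]_N -> R) x (i : 'I_N) : R := h (x + evec i) / h x.

Definition TASEP_rate x (i : 'I_N) : R :=
  if [exists j, x 0 j == x 0 i + 1] then 0 else 1.

Definition Delta x : R :=
  \prod_(i < N) \prod_(j < N | (i < j)%N) (x 0 j - x 0 i)%:~R.

Definition nonint_rate x (i : 'I_N) : R := Delta (x + evec i) / Delta x.

End WeylChamber.
Arguments weylZ N : clear implicits.

Section Chains.
Context {N : nat} {R : realType} {d : measure_display} {T : measurableType d}.
Variables (P : probability T R) (y : weylZ N)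
          (X : T -> skorokhod R (weylZ N)).

Definition is_mRW (h : 'rV[int]_N -> R) : Prop :=
  markov_process P (jump_generator (mRW_rate h)) y (fun t w => X w t).

Definition is_TASEP : Prop :=
  markov_process P (jump_generator TASEP_rate) y (fun t w => X w t).

Definition is_nonintersecting : Prop :=
  markov_process P (jump_generator nonint_rate) y (fun t w => X w t).

End Chains.

(* Main.v *)
(* Write h_L for the probability that the Poisson system stays in the Weyl chamber
   up to time L.

   Since one step changes the coordinates by at most 1, a path leaving the chamber
   first meets a wall x_i = x_j, so reflection gives
   h_L(x) = E[sgn Delta(x + Y(L))] for x in the chamber.  Newton's formula expands
   the law of x_i + Poisson(L) in Charlier functions, which are of size L^(-m/2) in
   L^1.  By antisymmetry the leading term of h_L(x) is det [C(x_i, j)], a multiple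
   of Delta(x), times h_L(0, 1, .., N-1), and the latter is at least
   c L^(-N(N-1)/4) by comparing second and fourth moments.  Hence
   h_L(x + e_i) / h_L(x) tends to Delta(x + e_i) / Delta(x) as L tends to infinity.
   As L tends to 0 it tends to 1 if x + e_i is in the chamber and is 0 otherwise.
   Moreover \sum_i h_L(x + e_i) <= N h_L(x), so all the chains have total jump
   rate at most N.

   A chain with bounded rates has a unique semigroup, hence its law as a random
   path is determined; this passes from marginals to continuous functionals by
   sampling the path on a grid.  All the chains can therefore be realised on one
   probability space, by a Poisson clock of rate N and one uniform variable that
   codes the successive moves through nested intervals.  When the rates converge
   pointwise so do the intervals, and on every bounded time interval the coupled
   paths eventually coincide almost surely. *)

Require Import Defs.
From HB Require Import structures.
From mathcomp Require Import all_boot all_order all_algebra.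
From mathcomp Require Import all_classical all_reals all_analysis.
From mathcomp Require Import measurable_realfun fingroup perm ring lra zify.

Set Implicit Arguments.
Unset Strict Implicit.
Unset Printing Implicit Defensive.

Import Order.TTheory GRing.Theory Num.Theory.
Import numFieldNormedType.Exports.

Local Open Scope classical_set_scope.
Local Open Scope ring_scope.

(** * Probabilities and expectations as real numbers *)

(** Reflecting at the first hit of a wall would call for stopping times. Observing the system on
    dyadic grids needs only independence of increments at fixed times: one step of length [dt] errs
    by O([dt^2]), so [2^n] steps of length [L / 2^n] err by O([2^-n]). Semigroups are compared by
    the same count. There the obstacle is that the generator is a pointwise derivative at 0; the
    inequality [p_(s+t)(x,A) >= p_s(x,z) p_t(z,A)] upgrades it to an expansion with a uniform
    O([h^2]) error. The exponent [N(N-1)/4] is the true order: [h_L(0, .., N-1)] is [1/N!] times the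
    L^1 norm of a determinant of Charlier polynomials, whose L^2 norm orthogonality gives exactly.
    The remainder in the expansion of [h_L(x)] is smaller by a factor [L^(-1/2)]. The path space
    carries no sigma-algebra. A path sampled on a finite grid is coded by a natural number, whose
    law the Markov property determines; continuous functionals are limits of functions of such
    codes, which settles both their measurability and their law. *)

Section RealProbability.
Context {d} {T : measurableType d} {R : realType} (P : probability T R).
Implicit Types (A B : set T).

(** Real values keep the many estimates within reach of [ring] and [lra]. *)
Definition pr A : R := fine (P A).

Lemma prE A : measurable A -> P A = (pr A)%:E.
Proof. by move=> mA; rewrite /pr fineK// fin_num_measure. Qed.

Lemma pr_ge0 A : 0 <= pr A.
Proof. exact: fine_ge0. Qed.

Lemma pr_le A B : measurable A -> measurable B -> A `<=` B -> pr A <= pr B.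
Proof.
by move=> mA mB AB; rewrite -lee_fin -!prE//; apply: le_measure => //; exact: mem_set.
Qed.

Lemma prT : pr setT = 1.
Proof. by rewrite /pr probability_setT. Qed.

Lemma pr0 : pr set0 = 0.
Proof. by rewrite /pr measure0. Qed.

Lemma pr_le1 A : measurable A -> pr A <= 1.
Proof. by move=> mA; rewrite -prT pr_le. Qed.

Lemma prU A B : measurable A -> measurable B -> A `&` B = set0 ->
  pr (A `|` B) = pr A + pr B.
Proof.
move=> mA mB AB; apply: EFin_inj; rewrite EFinD -!prE//; last exact: measurableU.
by rewrite measureU.
Qed.

Lemma prID A B : measurable A -> measurable B -> pr A = pr (A `&` B) + pr (A `\` B).
Proof.
move=> mA mB; rewrite -prU; [|exact: measurableI|exact: measurableD|].
  by rewrite setUIDK.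
by apply/seteqP; split => // w [] [_ Bw] [].
Qed.

Lemma prC A : measurable A -> pr (~` A) = 1 - pr A.
Proof. by move=> mA; have := prID measurableT mA; rewrite setTI setTD prT; lra. Qed.

Lemma pr_sum_seq (I : eqType) (r : seq I) (A : set T) (F : I -> set T) :
  uniq r -> measurable A -> (forall i, measurable (F i)) ->
  (forall i j w, F i w -> F j w -> i = j) ->
  measurable [set w | exists2 i, i \in r & F i w] /\
  pr (A `&` [set w | exists2 i, i \in r & F i w]) = \sum_(i <- r) pr (A `&` F i).
Proof.
move=> + mA mF dF; elim: r => [_|i r IH /= /andP[ir ur]].
  have -> : [set w | exists2 i, i \in [::] & F i w] = set0.
    by apply/seteqP; split => // w [].
  by rewrite setI0 pr0 big_nil.
have [m1 IHr] := IH ur.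
have -> : [set w | exists2 j, j \in i :: r & F j w] = F i `|` [set w | exists2 j, j \in r & F j w].
  apply/seteqP; split => w /=.
    by move=> [j]; rewrite inE => /predU1P[->|jr] Fj; [left|right; exists j].
  by move=> [Fi|[j jr Fj]]; [exists i; rewrite ?inE ?eqxx|exists j; rewrite ?inE ?jr ?orbT].
split; first exact: measurableU.
rewrite setIUr prU ?big_cons ?IHr//; [exact: measurableI|exact: measurableI|].
apply/seteqP; split => // w /= [[_ Fi] [_ [j jr Fj]]].
by rewrite (dF _ _ _ Fi Fj) jr in ir.
Qed.

Lemma pr_sum (I : finType) (A : set T) (F : I -> set T) :
  measurable A -> (forall i, measurable (F i)) ->
  (forall i j w, F i w -> F j w -> i = j) -> (forall w, A w -> exists i, F i w) ->
  pr A = \sum_i pr (A `&` F i).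
Proof.
move=> mA mF dF cF; have [_] := pr_sum_seq (index_enum_uniq I) mA mF dF.
rewrite setIidl// => w /cF[i Fi]; exists i => //; exact: mem_index_enum.
Qed.

Lemma pr_cvg_up (F : nat -> set T) : (forall n, measurable (F n)) ->
  (forall n, F n `<=` F n.+1) -> pr (F n) @[n --> \oo] --> pr (\bigcup_n F n).
Proof.
move=> mF ndF; have mU : measurable (\bigcup_n F n) by exact: bigcupT_measurable.
have : (P \o F) n @[n --> \oo] --> (pr (\bigcup_n F n))%:E.
  rewrite -prE//; apply: nondecreasing_cvg_mu => //.
  by apply/nondecreasing_seqP => n; exact/subsetPset.
by move/fine_cvg.
Qed.

Lemma pr_cvg_down (F : nat -> set T) : (forall n, measurable (F n)) ->
  (forall n, F n.+1 `<=` F n) -> pr (F n) @[n --> \oo] --> pr (\bigcap_n F n).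
Proof.
move=> mF niF; have mU : measurable (\bigcap_n F n) by exact: bigcapT_measurable.
have : (P \o F) n @[n --> \oo] --> (pr (\bigcap_n F n))%:E.
  rewrite -prE//; apply: nonincreasing_cvg_mu => //.
    by rewrite (le_lt_trans (probability_le1 _ (mF _)))// ltry.
  by apply/nonincreasing_seqP => n; exact/subsetPset.
by move/fine_cvg.
Qed.

Lemma pr_series (A : set T) (F : nat -> set T) : measurable A ->
  (forall n, measurable (F n)) -> (forall i j w, F i w -> F j w -> i = j) ->
  \sum_(0 <= i < n) pr (A `&` F i) @[n --> \oo] --> pr (A `&` \bigcup_n F n).
Proof.
move=> mA mF dF; pose G n := [set w | exists2 i, i \in iota 0 n & F i w].
have GE n : measurable (G n) /\ pr (A `&` G n) = \sum_(0 <= i < n) pr (A `&` F i).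
  have := pr_sum_seq (iota_uniq 0 n) mA mF dF.
  by rewrite /index_iota subn0.
have -> : \bigcup_n F n = \bigcup_n G n.
  apply/seteqP; split => w [n _]; last by move=> [i _ Fi]; exists i.
  by move=> Fn; exists n.+1 => //; exists n => //; rewrite mem_iota/= add0n ltnS.
rewrite setI_bigcupr; under eq_fun do rewrite -(GE _).2.
apply: pr_cvg_up => n; first by apply: measurableI => //; exact: (GE n).1.
move=> w [Aw [i ir Fi]]; split => //; exists i => //.
by move: ir; rewrite !mem_iota/= !add0n => /ltnW.
Qed.

Lemma pr_null_sub A B : measurable A -> measurable B -> A `<=` B -> pr B = 0 -> pr A = 0.
Proof.
by move=> mA mB AB B0; apply/eqP; rewrite eq_le pr_ge0 andbT -B0 pr_le.
Qed.

End RealProbability.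

(** * Expectations of bounded functions *)

Section BoundedExpectation.
Context {d} {T : measurableType d} {R : realType} (P : probability T R).
Implicit Types (f g : T -> R) (A : set T).

Definition bmeas f : Prop := measurable_fun setT f /\ exists M : R, forall x, `|f x| <= M.

Definition ex f : R := \int[P]_x f x.

Lemma bmeas_integrable f : bmeas f -> P.-integrable setT (EFin \o f).
Proof.
move=> [mf [M hM]]; apply: measurable_bounded_integrable => //.
  by rewrite (le_lt_trans (probability_le1 _ _))// ltry.
by exists M; split; [exact: num_real|move=> x Mx y _ /=; rewrite (le_trans (hM y))// ltW].
Qed.

Lemma bmeas_cst (c : R) : bmeas (fun=> c).
Proof. by split; [exact: measurable_cst|exists `|c|]. Qed.

Lemma bmeasD f g : bmeas f -> bmeas g -> bmeas (fun x => f x + g x).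
Proof.
move=> [mf [M hM]] [mg [M' hM']]; split; first exact: measurable_funD.
by exists (M + M') => x; rewrite (le_trans (ler_normD _ _))// lerD.
Qed.

Lemma bmeasZ (c : R) f : bmeas f -> bmeas (fun x => c * f x).
Proof.
move=> [mf [M hM]]; split; first by apply: measurable_funM => //; exact: measurable_cst.
by exists (`|c| * M) => x; rewrite normrM ler_wpM2l.
Qed.

Lemma bmeasB f g : bmeas f -> bmeas g -> bmeas (fun x => f x - g x).
Proof.
move=> bf /(bmeasZ (-1)) /(bmeasD bf).
by under [X in bmeas X -> _]eq_fun do rewrite mulN1r.
Qed.

Lemma bmeas_sum (I : Type) (r : seq I) (F : I -> T -> R) : (forall i, bmeas (F i)) ->
  bmeas (fun x => \sum_(i <- r) F i x).
Proof.
move=> bF; elim: r => [|i r IH].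
  by under eq_fun do rewrite big_nil; exact: bmeas_cst.
by under eq_fun do rewrite big_cons; exact: bmeasD.
Qed.

Lemma bmeas_indic A : measurable A -> bmeas (\1_A : T -> R).
Proof.
move=> mA; split; first exact: measurable_indic.
by exists 1 => x; rewrite indicE ger0_norm// lern1 leq_b1.
Qed.

Lemma exD f g : bmeas f -> bmeas g -> ex (fun x => f x + g x) = ex f + ex g.
Proof. by move=> /bmeas_integrable bf /bmeas_integrable bg; exact: RintegralD. Qed.

Lemma exZ (c : R) f : bmeas f -> ex (fun x => c * f x) = c * ex f.
Proof. by move=> /bmeas_integrable bf; exact: RintegralZl. Qed.

Lemma exB f g : bmeas f -> bmeas g -> ex (fun x => f x - g x) = ex f - ex g.
Proof. by move=> /bmeas_integrable bf /bmeas_integrable bg; exact: RintegralB. Qed.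

Lemma ex_cst (c : R) : ex (fun=> c) = c.
Proof.
rewrite /ex Rintegral_cst//.
by rewrite -[fine _]/(pr P setT) prT mulr1.
Qed.

Lemma ex_indic A : measurable A -> ex (\1_A : T -> R) = pr P A.
Proof. by move=> mA; rewrite /ex /Rintegral integral_indic// setIT. Qed.

Lemma ex_sum (I : Type) (r : seq I) (F : I -> T -> R) : (forall i, bmeas (F i)) ->
  ex (fun x => \sum_(i <- r) F i x) = \sum_(i <- r) ex (F i).
Proof.
move=> bF; elim: r => [|i r IH].
  by under eq_fun do rewrite big_nil; rewrite ex_cst big_nil.
under eq_fun do rewrite big_cons.
by rewrite exD ?IH ?big_cons//; exact: bmeas_sum.
Qed.

Lemma ex_le f g : bmeas f -> bmeas g -> (forall x, f x <= g x) -> ex f <= ex g.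
Proof. by move=> /bmeas_integrable bf /bmeas_integrable bg fg; exact: le_Rintegral. Qed.

Lemma ex_norm_le f (M : R) : bmeas f -> (forall x, `|f x| <= M) -> `|ex f| <= M.
Proof.
move=> bf hM; rewrite ler_norml -{1}(ex_cst (- M)) -{2}(ex_cst M).
by apply/andP; split; apply: ex_le => //; try exact: bmeas_cst;
  move=> x; have := hM x; rewrite ler_norml => /andP[].
Qed.

Lemma expectationE f : bmeas f -> 'E_P[f]%E = (ex f)%:E.
Proof.
move=> /bmeas_integrable bf; rewrite unlock /ex /Rintegral fineK//.
exact: integrable_fin_num.
Qed.

Lemma integral_EFin f : bmeas f -> (\int[P]_x (f x)%:E)%E = (ex f)%:E.
Proof. by move=> bf; rewrite -expectationE// unlock. Qed.

(** Dominated convergence off a null event: the coupled paths converge only when the clock is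
    monotone and the uniform variable is no endpoint of an interval. *)
Lemma ex_cvg (f : nat -> T -> R) (g : T -> R) (M : R) (A : set T) :
  (forall n, measurable_fun setT (f n)) -> measurable_fun setT g ->
  (forall n x, `|f n x| <= M) -> (forall x, `|g x| <= M) ->
  measurable A -> pr P A = 1 ->
  (forall x, A x -> f n x @[n --> \oo] --> g x) ->
  ex (f n) @[n --> \oo] --> ex g.
Proof.
move=> mf mg hM hMg mA A1 fg.
have ae (Q : T -> Prop) : (forall x, A x -> Q x) -> \forall x \ae P, Q x.
  move=> AQ; exists (~` A); split; first exact: measurableC.
    by rewrite prE; [rewrite prC// A1 subrr|exact: measurableC].
  by move=> x /=; apply: contra_not => Ax; exact: AQ.
have [] := @dominated_convergence d T R P setT measurableT
  (fun n => EFin \o f n) (EFin \o g) (fun=> M%:E).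
- by move=> n; apply/measurable_EFinP; exact: mf.
- exact/measurable_EFinP.
- by apply: ae => x Ax _; apply: cvg_EFin; [exact: nearW|exact: fg].
- exact: (bmeas_integrable (bmeas_cst M)).
- by apply: ae => x _ n _; rewrite /= lee_fin.
move=> _ _ /=.
have -> : (fun n => \int[P]_x (f n x)%:E)%E = (fun n => (ex (f n))%:E).
  by apply/funext => n; apply: integral_EFin; split => //; exists M.
by rewrite integral_EFin; [move/fine_cvg|split => //; exists M].
Qed.

End BoundedExpectation.

(** * Poisson weights and Charlier functions *)

Section PoissonWeights.
Context {R : realType}.
Implicit Types (L : R).

(** At [L = 0] this is the point mass at 0, so that increments over an empty time interval obey the
    same formula. *)
Definition pweight L (z : nat) : R := L ^+ z / z`!%:R * expR (- L).

(** The Charlier polynomials with parameter [L], multiplied by [(-1)^m]. At [z = 0] the truncated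
    predecessor is harmless, its factor being 0. *)
Fixpoint charlier L (m z : nat) : R :=
  if m is m'.+1 then z%:R / L * charlier L m' z.-1 - charlier L m' z else 1.

(* wcharlier L m = (shift - 1)^m (pweight L) *)
Definition wcharlier L m z := pweight L z * charlier L m z.

Lemma pweight_ge0 L z : 0 <= L -> 0 <= pweight L z.
Proof. by move=> L0; rewrite !mulr_ge0 ?invr_ge0 ?exprn_ge0 ?expR_ge0. Qed.

Lemma pweight_pmf L z : 0 < L -> poisson_pmf L z = pweight L z.
Proof. by move=> L0; rewrite /poisson_pmf L0. Qed.

Lemma pweightS L z : L != 0 -> pweight L z.+1 * (z.+1%:R / L) = pweight L z.
Proof.
move=> L0; rewrite /pweight factS natrM exprS.
have zf0 : z`!%:R != 0 :> R by rewrite pnatr_eq0 -lt0n fact_gt0.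
by field; rewrite zf0 L0/= nat1r pnatr_eq0.
Qed.

Lemma wcharlier0 L m : wcharlier L m.+1 0 = - wcharlier L m 0.
Proof. by rewrite /wcharlier /= mul0r mul0r sub0r mulrN. Qed.

Lemma wcharlierS L m z : L != 0 ->
  wcharlier L m.+1 z.+1 = wcharlier L m z - wcharlier L m z.+1.
Proof.
by move=> L0; rewrite /wcharlier /= mulrBr mulrA pweightS.
Qed.

(* Newton's formula: shifting by x is (1 + (shift - 1))^x *)
Lemma pweight_shift L M x z : L != 0 -> (x < M)%N ->
  (if (x <= z)%N then pweight L (z - x) else 0) =
  \sum_(m < M) 'C(x, m)%:R * wcharlier L m z.
Proof.
move=> L0; elim: x M z => [|x IH] [|M] z // xM.
  rewrite subn0 big_ord_recl big1 ?addr0 => [|i _]; last by rewrite bin0n mul0r.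
  by rewrite bin0 mul1r /wcharlier/= mulr1.
have -> : \sum_(m < M.+1) 'C(x.+1, m)%:R * wcharlier L m z =
   \sum_(m < M.+1) 'C(x, m)%:R * wcharlier L m z +
   \sum_(m < M) 'C(x, m)%:R * wcharlier L m.+1 z.
  rewrite big_ord_recl [in RHS]big_ord_recl !bin0 -addrA; congr +%R.
  by rewrite -big_split/=; apply: eq_bigr => i _; rewrite binS natrD mulrDl.
have -> : \sum_(m < M.+1) 'C(x, m)%:R * wcharlier L m z =
          \sum_(m < M) 'C(x, m)%:R * wcharlier L m z.
  by rewrite big_ord_recr/= bin_small// mul0r addr0.
rewrite -big_split/=; case: z => [|z] /=.
  by rewrite big1// => i _; rewrite wcharlier0; ring.
rewrite subSS ltnS (IH M)//; apply: eq_bigr => i _.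
by rewrite wcharlierS//; ring.
Qed.

(** The lowering relation. The recursion in the definition raises the degree; both together with
    summation by parts give orthogonality. *)
Lemma charlier_diff L m z : L != 0 ->
  charlier L m.+1 z.+1 - charlier L m.+1 z = m.+1%:R / L * charlier L m z.
Proof.
move=> L0; elim: m z => [|m IH] z.
  by rewrite /= !mulr1 -addn1 natrD; field.
have H : forall z, charlier L m.+2 z = z%:R / L * charlier L m.+1 z.-1 - charlier L m.+1 z by [].
have H2 : forall z, charlier L m.+1 z = z%:R / L * charlier L m z.-1 - charlier L m z by [].
have -> : charlier L m.+2 z.+1 - charlier L m.+2 z =
    L^-1 * charlier L m.+1 z
    + z%:R / L * (charlier L m.+1 z - charlier L m.+1 z.-1)
    - (charlier L m.+1 z.+1 - charlier L m.+1 z).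
  by rewrite !H /= -addn1 natrD; field.
rewrite IH -[m.+2%:R]natr1; case: z => [|z].
  have -> : charlier L m.+1 0 = - charlier L m 0 by rewrite /= !mul0r sub0r.
  by field.
rewrite [z.+1.-1]/= IH (H2 z.+1) [z.+1.-1]/=.
by field.
Qed.

Lemma charlier_bound L m z : 0 < L -> `|charlier L m z| <= (1 + z%:R / L) ^+ m.
Proof.
move=> L0; elim: m z => [|m IH] z; first by rewrite /= normr1 expr0.
have z0 : 0 <= z%:R / L by rewrite divr_ge0// ltW.
rewrite /= (le_trans (ler_normB _ _))// exprS mulrDl mul1r addrC lerD//.
rewrite normrM (ger0_norm z0) ler_wpM2l// (le_trans (IH _))//.
have z'0 : 0 <= z.-1%:R / L by rewrite divr_ge0// ltW.
have z'z : z.-1%:R / L <= z%:R / L by rewrite ler_pM2r ?invr_gt0// ler_nat leq_pred.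
by apply: lerXn2r; rewrite ?nnegrE; lra.
Qed.

Lemma expR_series_le (x : R) K : 0 <= x -> \sum_(0 <= z < K) x ^+ z / z`!%:R <= expR x.
Proof.
move=> x0; apply: (@nondecreasing_cvgn_le _ (series (exp_coeff x))) => //.
  apply: nondecreasing_series => n _ _; exact: exp_coeff_ge0.
exact: is_cvg_series_exp_coeff.
Qed.

(** The full sum is [expR (L * (expR a - 1 - a))], the exponential moment of a centred Poisson
    variable, and [expR a - 1 - a <= 2 * a^2] for [|a| <= 1]. *)
Lemma pweight_expR_le L (a : R) K : 0 <= L -> `|a| <= 1 ->
  \sum_(0 <= z < K) pweight L z * expR (a * (z%:R - L)) <= expR (2 * (L * a ^+ 2)).
Proof.
move=> L0 a1.
have -> : \sum_(0 <= z < K) pweight L z * expR (a * (z%:R - L)) =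
   (\sum_(0 <= z < K) (L * expR a) ^+ z / z`!%:R) * expR (- L - a * L).
  rewrite mulr_suml; apply: eq_bigr => z _.
  rewrite /pweight mulrBr expRB exprMn mulrC expRM_natr expRB; field.
  by rewrite expR_eq0/= pnatr_eq0 -lt0n fact_gt0.
apply: (@le_trans _ _ (expR (L * expR a) * expR (- L - a * L))).
  by rewrite ler_wpM2r ?expR_ge0 ?expR_series_le ?mulr_ge0 ?expR_ge0.
rewrite -expRD ler_expR.
have -> : L * expR a + (- L - a * L) = L * (expR a - 1 - a) by ring.
rewrite mulrCA ler_wpM2l//.
have /andP[am1 a2] : (-1 <= a <= 1) by rewrite -ler_norml.
(* Squaring [1 - a / 2 <= expR (- (a / 2))] bounds [expR a] by a rational function; what remains is
   a polynomial inequality on [[-1, 1]]. *)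
have h1 : expR a * (1 - a / 2) ^+ 2 <= 1.
  have -> : expR a = expR (a / 2) ^+ 2 by rewrite -expRM_natr; congr expR; field.
  rewrite -exprMn -[leRHS](expr1n _ 2); apply: lerXn2r.
  - by rewrite nnegrE mulr_ge0 ?expR_ge0//; lra.
  - by rewrite nnegrE.
  - have := expR_ge1Dx (- (a / 2)); rewrite expRN => h.
    by rewrite mulrC -ler_pdivlMr ?expR_gt0// div1r; lra.
have h2 : 0 < (1 - a / 2) ^+ 2 by rewrite exprn_gt0//; lra.
rewrite !lerBlDr -(ler_pM2r h2) (le_trans h1)//.
have -> : (2 * a ^+ 2 + a + 1) * (1 - a / 2) ^+ 2 =
  1 + a ^+ 2 * ((1 - a) * (5 / 2 - a) / 2) by field.
by rewrite lerDl mulr_ge0 ?sqr_ge0// mulr_ge0 ?mulr_ge0//; lra.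
Qed.

Lemma wcharlier_boundary L a b : 0 < L ->
  wcharlier L a k * charlier L b k.+1 @[k --> \oo] --> (0 : R).
Proof.
(* Both polynomial factors are absorbed in [expR (t * k.+1%:R)], which leaves the general term of
   the series of [expR (L * expR t)]. *)
move=> L0; pose t : R := (a + b)%:R / L.
have t0 : 0 <= t by rewrite divr_ge0// ltW.
apply/norm_cvg0P.
have hl : expR (t - L) * exp_coeff (L * expR t) k @[k --> \oo] --> (0 : R).
  rewrite -[X in _ --> X](mulr0 (expR (t - L))).
  by apply: cvgM; [exact: cvg_cst|exact: cvg_exp_coeff].
apply: (squeeze_cvgr _ (cvg_cst 0) hl).
apply: nearW => k; rewrite normr_ge0/= /wcharlier -mulrA normrM.
rewrite [X in _ * X]normrM (ger0_norm (pweight_ge0 _ (ltW L0))).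
have kk : k%:R / L <= k.+1%:R / L by rewrite ler_pM2r ?invr_gt0// ler_nat.
have k0 : 0 <= k%:R / L by rewrite divr_ge0// ltW.
have e1 : 1 + k.+1%:R / L <= expR (k.+1%:R / L) by exact: expR_ge1Dx.
have h : `|charlier L a k| * `|charlier L b k.+1| <= expR (t * k.+1%:R).
  rewrite (_ : t * k.+1%:R = (a + b)%:R * (k.+1%:R / L)); last by rewrite /t; ring.
  rewrite expRM_natl exprD ler_pM//.
    by rewrite (le_trans (charlier_bound _ _ L0))// lerXn2r ?nnegrE ?expR_ge0//; lra.
  by rewrite (le_trans (charlier_bound _ _ L0))// lerXn2r ?nnegrE ?expR_ge0//; lra.
rewrite (le_trans (ler_wpM2l (pweight_ge0 _ (ltW L0)) h))//.
rewrite le_eqVlt; apply/orP; left; apply/eqP.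
have -> : expR (t * k.+1%:R) = expR t ^+ k * expR t.
  by rewrite -[k.+1%:R]natr1 mulrDr mulr1 expRD expRM_natr.
rewrite expRB /pweight /exp_coeff/= exprMn expRN.
by field; rewrite expR_eq0/= pnatr_eq0 -lt0n fact_gt0.
Qed.

Lemma wcharlier_parts L a b K : L != 0 ->
  \sum_(0 <= z < K.+1) wcharlier L a.+1 z * charlier L b z =
  \sum_(0 <= z < K.+1) wcharlier L a z * (charlier L b z.+1 - charlier L b z)
    - wcharlier L a K * charlier L b K.+1.
Proof.
move=> L0; elim: K => [|K IH].
  by rewrite !big_nat1 wcharlier0; ring.
by rewrite big_nat_recr//= IH [in RHS]big_nat_recr//= wcharlierS//; ring.
Qed.

(** Summation by parts trades one difference of the weight for a difference of the polynomial, so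
    both indices drop by one. The smaller index reaches 0 first, and there the difference
    vanishes. *)
Lemma charlier_orthogonal L a b : 0 < L ->
  \sum_(0 <= z < K) wcharlier L a z * charlier L b z @[K --> \oo] -->
  (if a == b then a`!%:R / L ^+ a else 0 : R).
Proof.
move=> L0; have Ln0 : L != 0 by rewrite gt_eqF.
wlog : a b / (a >= b)%N => [hw|].
  have [ba|/ltnW ab] := leqP b a; first exact: hw.
  have := hw _ _ ab; rewrite eq_sym; have [->|_] := eqVneq b a; first exact.
  apply: cvg_trans; apply: near_eq_cvg; apply: nearW => K.
  by apply: eq_bigr => z _; rewrite /wcharlier; ring.
elim: a b => [|a IH] [|b] // ba.
- rewrite eqxx fact0 expr0 divr1.
  have -> : (1 : R) = expR (- L) * expR L by rewrite -expRD addNr expR0.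
  have -> : (fun K => \sum_(0 <= z < K) wcharlier L 0 z * charlier L 0 z) =
            (fun K => expR (- L) * series (exp_coeff L) K).
    apply/funext => K; rewrite /series/= mulr_sumr; apply: eq_bigr => z _.
    by rewrite /wcharlier/= /pweight /exp_coeff/=; ring.
  by apply: cvgM; [exact: cvg_cst|exact: is_cvg_series_exp_coeff].
- rewrite /= -(cvg_shiftS (fun K => _)).
  have -> : (fun K => \sum_(0 <= z < K.+1) wcharlier L a.+1 z * charlier L 0 z) =
            (fun K => - (wcharlier L a K * charlier L 0 K.+1)).
    apply/funext => K; rewrite wcharlier_parts// big1 ?sub0r// => z _.
    by rewrite /= subrr mulr0.
  have := cvgN (@wcharlier_boundary L a 0 L0); rewrite oppr0. exact.
- rewrite -(cvg_shiftS (fun K => _)) eqSS.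
  have -> : (fun K => \sum_(0 <= z < K.+1) wcharlier L a.+1 z * charlier L b.+1 z) =
            (fun K => b.+1%:R / L * \sum_(0 <= z < K.+1) wcharlier L a z * charlier L b z
                 - (wcharlier L a K * charlier L b.+1 K.+1)).
    apply/funext => K; rewrite wcharlier_parts//; congr (_ - _).
    rewrite mulr_sumr; apply: eq_bigr => z _.
    by rewrite charlier_diff//; ring.
  have -> : (if a == b then a.+1`!%:R / L ^+ a.+1 else 0) =
            b.+1%:R / L * (if a == b then a`!%:R / L ^+ a else 0) - 0.
    rewrite subr0; case: eqP => [->|_]; last by rewrite mulr0.
    by rewrite factS natrM exprS; field; rewrite Ln0 expf_neq0.
  apply: cvgB; last exact: wcharlier_boundary.
  apply: cvgM; first exact: cvg_cst.
  by have := IH b ba; rewrite -(cvg_shiftS (fun K => \sum_(0 <= z < K) _)).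
Qed.

Lemma charlier_sqr_le L a K : 0 < L ->
  \sum_(0 <= z < K) pweight L z * charlier L a z ^+ 2 <= a`!%:R / L ^+ a.
Proof.
move=> L0; have := @charlier_orthogonal L a a L0; rewrite eqxx => h.
have -> : \sum_(0 <= z < K) pweight L z * charlier L a z ^+ 2 =
          \sum_(0 <= z < K) wcharlier L a z * charlier L a z.
  by apply: eq_bigr => z _; rewrite /wcharlier expr2 mulrA.
rewrite -(cvg_lim _ h)//.
apply: (@nondecreasing_cvgn_le _ (fun K => \sum_(0 <= z < K) wcharlier L a z * charlier L a z)); last first.
  by apply/cvg_ex; eexists; exact: h.
apply: nondecreasing_series => z _ _.
by rewrite /wcharlier -mulrA -expr2 mulr_ge0 ?pweight_ge0 ?sqr_ge0// ltW.
Qed.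

(** Cauchy-Schwarz against the Poisson weights, in the form [|c| <= c^2 / (2 l) + l / 2] with
    [l = L^(-a/2)], the order of the L^2 norm. *)
Lemma wcharlier_norm_le L a K : 0 < L ->
  \sum_(0 <= z < K) `|wcharlier L a z| <= a`!%:R * (Num.sqrt L)^-1 ^+ a.
Proof.
move=> L0; set l := (Num.sqrt L)^-1 ^+ a.
have l0 : 0 < l by rewrite exprn_gt0 ?invr_gt0 ?sqrtr_gt0.
have l2 : l ^+ 2 = (L ^+ a)^-1.
  by rewrite /l -exprM mulnC exprM exprVn sqr_sqrtr ?ltW// exprVn.
have w1 : \sum_(0 <= z < K) pweight L z <= 1.
  have := @charlier_sqr_le L 0 K L0; rewrite fact0 expr0 divr1.
  by under eq_bigr do rewrite /= expr1n mulr1.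
have h := @charlier_sqr_le L a K L0.
have -> : a`!%:R * l = l^-1 / 2 * (a`!%:R / L ^+ a) + a`!%:R * l / 2 * 1.
  by rewrite -l2; field; rewrite gt_eqF.
apply: (@le_trans _ _ (l^-1 / 2 * \sum_(0 <= z < K) pweight L z * charlier L a z ^+ 2 +
   l / 2 * \sum_(0 <= z < K) pweight L z)).
  rewrite !mulr_sumr -big_split/=; apply: ler_sum => z _.
  have w0 := pweight_ge0 z (ltW L0).
  rewrite /wcharlier; move: (pweight L z) w0 => w w0.
  rewrite normrM (ger0_norm w0); set c := charlier L a z.
  have : `|c| <= l^-1 / 2 * c ^+ 2 + l / 2.
    have -> : l^-1 / 2 * c ^+ 2 + l / 2 = (l^-1 / 2) * (`|c| ^+ 2 + l ^+ 2).
      by rewrite -normrX (ger0_norm (sqr_ge0 _)); field; rewrite gt_eqF.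
    rewrite -(@ler_pM2l _ (l * 2)) ?mulr_gt0//.
    have -> : l * 2 * (l^-1 / 2 * (`|c| ^+ 2 + l ^+ 2)) = `|c| ^+ 2 + l ^+ 2.
      by field; rewrite gt_eqF.
    by have := sqr_ge0 (`|c| - l); rewrite sqrrB; lra.
  have -> : l^-1 / 2 * (w * c ^+ 2) + l / 2 * w = w * (l^-1 / 2 * c ^+ 2 + l / 2) by ring.
  exact: ler_wpM2l.
rewrite lerD//; first by rewrite ler_wpM2l// divr_ge0// invr_ge0 ltW.
have w0 : 0 <= \sum_(0 <= z < K) pweight L z.
  by apply: sumr_ge0 => z _; apply: pweight_ge0; exact: ltW.
apply: ler_pM => //; first by rewrite divr_ge0 ?ltW.
by rewrite ler_pM2r ?invr_gt0// ler_peMl ?ler1n ?fact_gt0// ltW.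
Qed.

End PoissonWeights.

(** * Determinants of polynomial values *)

Section Determinants.
Context {R : realType} {N : nat}.

Definition vdm (a : 'rV[R]_N) : R :=
  \prod_(i < N) \prod_(j < N | (i < j)%N) (a 0 j - a 0 i).

Lemma vdmE a : vdm a = \det (Vandermonde N a).
Proof. by rewrite det_Vandermonde. Qed.

Lemma vdm_perm (f : 'I_N -> R) (s : 'S_N) :
  vdm (\row_i f (s i)) = (-1) ^+ s * vdm (\row_i f i).
Proof.
rewrite !vdmE.
have -> : Vandermonde N (\row_i f (s i)) = col_perm s (Vandermonde N (\row_i f i)).
  by apply/matrixP => i j; rewrite !mxE.
by rewrite col_permE det_mulmx det_perm odd_permV mulrC.
Qed.

(** The matrix of values is the transposed Vandermonde matrix times the triangular matrix of
    coefficients. *)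
Lemma det_poly (p : 'I_N -> {poly R}) (a : 'I_N -> R) :
  (forall j : 'I_N, (size (p j) <= j.+1)%N) ->
  \det (\matrix_(i, j) (p j).[a i]) = (\prod_j (p j)`_j) * vdm (\row_i a i).
Proof.
move=> sp; pose C : 'M[R]_N := \matrix_(k, j) (p j)`_k.
have -> : \matrix_(i, j) (p j).[a i] = (Vandermonde N (\row_i a i))^T *m C.
  apply/matrixP => i j; rewrite !mxE (@horner_coef_wide _ N) ?(leq_trans (sp j))//.
  by apply: eq_bigr => k _; rewrite !mxE mulrC.
rewrite det_mulmx det_tr -vdmE mulrC; congr (_ * _).
rewrite -det_tr det_trig; first by apply: eq_bigr => i _; rewrite !mxE.
apply/is_trig_mxP => i j ij; rewrite !mxE nth_default//.
by rewrite (leq_trans (sp _)).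
Qed.

Lemma charlier_poly (L : R) m : L != 0 -> exists p : {poly R},
  [/\ size p = m.+1, lead_coef p = L^-1 ^+ m &
      forall z : nat, p.[z%:R] = charlier L m z].
Proof.
move=> L0; elim: m => [|m [p [sp lp hp]]].
  by exists 1; split; rewrite ?size_poly1 ?lead_coef1 ?expr0// => z; rewrite hornerE.
(* The raising part of the recursion as a polynomial; its degree exceeds that of [p], so subtracting
   [p] keeps the leading coefficient. *)
pose r : {poly R} := L^-1 *: (p \Po ('X - 1%:P)) * 'X.
have X1 : size ('X - 1%:P : {poly R}) = 2%N by rewrite size_XsubC.
have sr' : size (L^-1 *: (p \Po ('X - 1%:P))) = m.+1.
  by rewrite size_scale ?invr_eq0// size_comp_poly2.
have sr : size r = m.+2.
  by rewrite size_mulX ?sr'// -size_poly_eq0 sr'.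
have srp : (size (- p) < size r)%N by rewrite sr size_polyN sp.
exists (r - p); split.
- by rewrite size_polyDl.
- rewrite lead_coefDl// lead_coefMX lead_coefZ lead_coef_comp ?X1//.
  by rewrite lead_coefXsubC expr1n mulr1 lp exprS.
- move=> z; rewrite !hornerE horner_comp !hornerE hp /=; congr (_ - _).
  case: z => [|z]; first by rewrite mulr0 !mul0r.
  by rewrite -natr1 addrK hp /=; ring.
Qed.

Lemma det_charlier (L : R) (z : 'I_N -> nat) : L != 0 ->
  \det (\matrix_(i, j) charlier L j (z i)) =
  (\prod_(j < N) L^-1 ^+ j) * vdm (\row_i (z i)%:R).
Proof.
move=> L0; pose p (j : 'I_N) := sval (cid (charlier_poly j L0)).
have hp (j : 'I_N) : [/\ size (p j) = j.+1, lead_coef (p j) = L^-1 ^+ j &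
      forall z : nat, (p j).[z%:R] = charlier L j z].
  by rewrite /p; case: cid.
have -> : \prod_(j < N) L^-1 ^+ j = \prod_(j < N) (p j)`_j.
  by apply: eq_bigr => j _; case: (hp j) => + <- _; rewrite lead_coefE => ->.
rewrite -det_poly; last by move=> j; case: (hp j) => ->.
by congr (\det _); apply/matrixP => i j; rewrite !mxE; case: (hp j).
Qed.

(** ['C(x, j)] is the value at [x] of a falling factorial, a monic polynomial of degree [j], over
    [j!]. This is how [Delta] enters the leading term. *)
Lemma det_binom (x : 'I_N -> nat) :
  \det (\matrix_(i, j) ('C(x i, j)%:R : R)) =
  (\prod_(j < N) (j`!%:R)^-1) * vdm (\row_i (x i)%:R).
Proof.
pose ff (m : nat) : {poly R} := \prod_(k <- iota 0 m) ('X - k%:R%:P).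
have sff m : size (ff m) = m.+1 by rewrite size_prod_XsubC size_iota.
have mff m : ff m \is monic by exact: monic_prod_XsubC.
have eff m (y : nat) : (ff m).[y%:R] = (y ^_ m)%:R.
  elim: m => [|m IH]; first by rewrite /ff big_nil hornerE.
  have -> : ff m.+1 = ff m * ('X - m%:R%:P).
    by rewrite /ff -addn1 iotaD big_cat/= big_seq1.
  rewrite hornerE IH !hornerE ffactnSr natrM.
  have [my|ym] := leqP m y; first by rewrite natrB.
  by rewrite ffact_small// !mul0r.
pose p (j : 'I_N) := (j`!%:R)^-1 *: ff j.
have -> : \prod_(j < N) (j`!%:R)^-1 = \prod_(j < N) (p j)`_j.
  apply: eq_bigr => j _; rewrite coefZ.
  by have /monicP := mff j; rewrite lead_coefE sff/= => ->; rewrite mulr1.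
rewrite -det_poly; last first.
  by move=> j; rewrite size_scale ?sff// invr_eq0 pnatr_eq0 -lt0n fact_gt0.
congr (\det _); apply/matrixP => i j; rewrite !mxE hornerE eff.
rewrite -bin_ffact natrM mulrC mulfK// pnatr_eq0 -lt0n fact_gt0//.
Qed.

End Determinants.

Section DistinctSum.

Lemma uniq_exists_ge (s : seq nat) n : uniq s -> (n < size s)%N ->
  exists2 x, x \in s & (n <= x)%N.
Proof.
move=> us ns; apply: contrapT => h.
have : (size s <= size (iota 0 n))%N.
  apply: uniq_leq_size => // x xs; rewrite mem_iota/= add0n ltnNge.
  by apply/negP => nx; apply: h; exists x.
by rewrite size_iota leqNgt ns.
Qed.

Lemma sum_uniq_ge (s : seq nat) : uniq s ->
  (\sum_(i < size s) i <= \sum_(x <- s) x)%N.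
Proof.
move: {2}(size s) (erefl (size s)) => n; elim: n s => [|n IH] s sn us.
  by rewrite sn big_ord0.
have [x xs nx] : exists2 x, x \in s & (n <= x)%N by apply: uniq_exists_ge => //; rewrite sn.
rewrite sn big_ord_recr/= (perm_big _ (perm_to_rem xs))/= big_cons addnC leq_add//.
have sr : size (rem x s) = n by rewrite size_rem// sn.
by have := IH _ sr (rem_uniq _ us); rewrite sr.
Qed.

(** Applied to an injective multi-index that is not a permutation of [0, .., N-1]: its total degree
    is strictly larger, so its term has a smaller order in [L]. *)
Lemma sum_uniq_gt (s : seq nat) x : uniq s -> x \in s -> (size s <= x)%N ->
  (\sum_(i < size s) i < \sum_(x <- s) x)%N.
Proof.
move=> us xs sx; rewrite (perm_big _ (perm_to_rem xs))/= big_cons.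
have sr : size s = (size (rem x s)).+1 by rewrite size_rem// prednK//; case: s xs {us sx}.
rewrite sr big_ord_recr/= addnC -addSn leq_add//; first by rewrite -sr.
by apply: sum_uniq_ge; exact: rem_uniq.
Qed.

End DistinctSum.

(** * Asymptotics of the signed sums *)

Section SignedSums.
Context {R : realType} {N : nat}.
Implicit Types (L : R) (K M : nat).

Definition sgv {K} (z : {ffun 'I_N -> 'I_K}) : R :=
  Num.sg (vdm (\row_i (z i : nat)%:R)).

(* Sums over {0, .., K-1}^N: Hsum is the truncation of E[sgn Delta(x + Z)] for
   independent Poisson(L) variables Z_i. *)
Definition Bsum L K (m : 'I_N -> nat) : R :=
  \sum_(z : {ffun 'I_N -> 'I_K}) sgv z * \prod_i wcharlier L (m i) (z i).

Definition Hsum L K (x : 'I_N -> nat) : R :=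
  \sum_(z : {ffun 'I_N -> 'I_K})
     sgv z * \prod_i (if (x i <= z i)%N then pweight L (z i - x i) else 0).

Lemma Hsum_expand L K M x : L != 0 -> (forall i, (x i < M)%N) ->
  Hsum L K x = \sum_(m : {ffun 'I_N -> 'I_M})
     (\prod_i 'C(x i, m i)%:R) * Bsum L K (fun i => m i).
Proof.
move=> L0 xM; rewrite /Hsum /Bsum.
under [RHS]eq_bigr do rewrite mulr_sumr.
rewrite exchange_big/=; apply: eq_bigr => z _.
under [RHS]eq_bigr do rewrite mulrCA.
rewrite -mulr_sumr; congr (_ * _).
transitivity (\prod_i \sum_(j < M) ('C(x i, j)%:R * wcharlier L j (z i))).
  by apply: eq_bigr => i _; exact: pweight_shift.
by rewrite bigA_distr_bigA/=; apply: eq_bigr => m _; rewrite big_split.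
Qed.

Lemma sgv_perm K (z : {ffun 'I_N -> 'I_K}) (s : 'S_N) :
  sgv [ffun i => z (s i)] = (-1) ^+ s * sgv z.
Proof.
rewrite /sgv; have -> : \row_i ([ffun i => z (s i)] i : nat)%:R =
   \row_i ((fun j => (z j : nat)%:R : R) (s i)).
  by apply/rowP => i; rewrite !mxE ffunE.
by rewrite (vdm_perm (fun j => (z j : nat)%:R)) sgrM; congr (_ * _); case: (odd_perm s);
  rewrite ?expr1 ?expr0 ?sgrN1 ?sgr1.
Qed.

Lemma signed_sum_perm K (f : 'I_N -> nat -> R) (s : 'S_N) :
  \sum_(z : {ffun 'I_N -> 'I_K}) sgv z * \prod_i f (s i) (z i) =
  (-1) ^+ s * \sum_(z : {ffun 'I_N -> 'I_K}) sgv z * \prod_i f i (z i).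
Proof.
rewrite (reindex (fun z : {ffun 'I_N -> 'I_K} => [ffun i => z (s i)])); last first.
  exists (fun z : {ffun 'I_N -> 'I_K} => [ffun i => z ((s^-1)%g i)]) => z _;
    by apply/ffunP => i; rewrite !ffunE ?permK ?permKV.
rewrite mulr_sumr; apply: eq_bigr => z _; rewrite sgv_perm -mulrA; congr (_ * (_ * _)).
rewrite [RHS](reindex_inj (@perm_inj _ s))/=.
by apply: eq_bigr => i _; rewrite ffunE.
Qed.

Lemma signed_sum_eq0 K (f : 'I_N -> nat -> R) (i j : 'I_N) : i != j -> f i = f j ->
  \sum_(z : {ffun 'I_N -> 'I_K}) sgv z * \prod_i f i (z i) = 0.
Proof.
move=> ij fij; have := signed_sum_perm K f (tperm i j); rewrite odd_tperm ij expr1.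
have -> : \sum_(z : {ffun 'I_N -> 'I_K}) sgv z * \prod_k f (tperm i j k) (z k) =
          \sum_(z : {ffun 'I_N -> 'I_K}) sgv z * \prod_k f k (z k).
  apply: eq_bigr => z _; congr (_ * _); apply: eq_bigr => k _.
  by case: tpermP => // ->; rewrite fij.
by lra.
Qed.

Lemma Bsum_perm L K m (s : 'S_N) :
  Bsum L K (fun i => m (s i)) = (-1) ^+ s * Bsum L K m.
Proof. exact: (signed_sum_perm K (fun i => wcharlier L (m i)) s). Qed.

Lemma Bsum_eq0 L K m (i j : 'I_N) : i != j -> m i = m j -> Bsum L K m = 0.
Proof.
by move=> ij mij; apply: (signed_sum_eq0 K (f := fun i => wcharlier L (m i)) ij); rewrite mij.
Qed.

Lemma Hsum_eq0 L K x (i j : 'I_N) : i != j -> x i = x j -> Hsum L K x = 0.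
Proof.
move=> ij xij; apply: (signed_sum_eq0 K (f := fun i k =>
  if (x i <= k)%N then pweight L (k - x i) else 0) ij).
by rewrite xij.
Qed.

Lemma sum_ffun_prod K (f : 'I_N -> nat -> R) :
  \sum_(z : {ffun 'I_N -> 'I_K}) \prod_i f i (z i) =
  \prod_i \sum_(0 <= k < K) f i k.
Proof.
under [RHS]eq_bigr do rewrite big_mkord.
by rewrite bigA_distr_bigA.
Qed.

Lemma sgv_le1 K (z : {ffun 'I_N -> 'I_K}) : `|sgv z| <= 1.
Proof. by rewrite /sgv; case: sgrP; rewrite ?normr0 ?normrN ?normr1. Qed.

Lemma Bsum_norm_le L K m : 0 < L -> `|Bsum L K m| <=
  (\prod_i (m i)`!%:R) * (Num.sqrt L)^-1 ^+ (\sum_i m i)%N.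
Proof.
move=> L0; apply: le_trans (ler_norm_sum _ _ _) _.
apply: (@le_trans _ _ (\sum_(z : {ffun 'I_N -> 'I_K}) \prod_i `|wcharlier L (m i) (z i)|)).
  apply: ler_sum => z _; rewrite normrM normr_prod ler_piMl ?sgv_le1//.
  exact: prodr_ge0.
rewrite (sum_ffun_prod K (fun i k => `|wcharlier L (m i) k|)) -prodrXr -big_split/=.
by apply: ler_prod => i _; rewrite sumr_ge0//= wcharlier_norm_le.
Qed.

(** The degree [N(N-1)/2] of [Delta]. *)
Definition ndelta : nat := (\sum_(i < N) i)%N.

Let idx : 'I_N -> nat := fun i => i.

Let emb M (NM : (N <= M)%N) (s : 'S_N) : {ffun 'I_N -> 'I_M} :=
  [ffun i => widen_ord NM (s i)].

Let emb_inj M (NM : (N <= M)%N) : injective (emb NM).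
Proof.
move=> s t /ffunP h; apply/permP => i; have := h i; rewrite !ffunE => /(congr1 val)/=.
exact: val_inj.
Qed.

(** [Bsum] is antisymmetric in the multi-index: repeated entries contribute 0, the permutations of
    [0, .., N-1] assemble into a determinant, and the other injective multi-indices form the
    remainder. *)
Lemma Hsum_split L K M (NM : (N <= M)%N) x : L != 0 -> (forall i, (x i < M)%N) ->
  Hsum L K x =
    \det (\matrix_(i, j) ('C(x i, j)%:R : R)) * Bsum L K (fun i => i) +
    \sum_(m : {ffun 'I_N -> 'I_M} | injectiveb m && [exists i, (N <= m i)%N])
      (\prod_i 'C(x i, m i)%:R) * Bsum L K (fun i => m i).
Proof.
move=> L0 xM; rewrite (Hsum_expand K L0 xM).
rewrite (bigID (fun m : {ffun 'I_N -> 'I_M} => injectiveb m))/= [X in _ + X]big1 ?addr0; last first.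
  move=> m /injectivePn[i [j ij mij]].
  by rewrite (@Bsum_eq0 _ _ _ i j) ?mulr0// mij.
rewrite (bigID (fun m : {ffun 'I_N -> 'I_M} => [exists i, (N <= m i)%N]))/= addrC.
congr (_ + _).
transitivity (\sum_(m in [set emb NM s | s in [set: 'S_N]]%SET)
   (\prod_i 'C(x i, m i)%:R) * Bsum L K (fun i => m i)).
  apply: eq_bigl => m; apply/andP/imsetP => [[/injectiveP mi]|[s _ ->]].
    rewrite negb_exists => /forallP h.
    have hN i : (m i < N)%N by rewrite ltnNge.
    have gi : injective (fun i => Ordinal (hN i)).
      by move=> i j /(congr1 val)/= /val_inj; exact: mi.
    exists (perm gi); first by rewrite inE.
    by apply/ffunP => i; apply/val_inj; rewrite ffunE permE.
  split; first by apply/injectiveP => i j; rewrite !ffunE => /(congr1 val)/= /val_inj /perm_inj.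
  by rewrite negb_exists; apply/forallP => i; rewrite ffunE/= -ltnNge.
rewrite big_imset/=; last by move=> s t _ _; exact: emb_inj.
rewrite /determinant mulr_suml; apply: eq_big => [s|s _]; first by rewrite inE.
have -> : (fun i => (emb NM s i : nat)) = (fun i => idx (s i)).
  by apply/funext => i; rewrite ffunE.
rewrite Bsum_perm mulrCA mulrA; congr (_ * _ * _).
by apply: eq_bigr => i _; rewrite !mxE ffunE.
Qed.

Lemma det_binom_id : \det (\matrix_(i < N, j < N) ('C(i, j)%:R : R)) = 1.
Proof.
rewrite det_trig; first by rewrite big1// => i _; rewrite mxE binn.
by apply/is_trig_mxP => i j ij; rewrite mxE bin_small.
Qed.

(** With starting points below [N] one may take [M = N], so there is no remainder, and the binomial
    matrix is unitriangular. Thus the leading coefficient [Bsum] is itself a value of [Hsum]. *)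
Lemma Hsum_id L K : L != 0 -> Hsum L K (fun i => i) = Bsum L K (fun i => i).
Proof.
move=> L0; rewrite (@Hsum_split L K N (leqnn N))//.
rewrite det_binom_id mul1r big1 ?addr0// => m /andP[_ /existsP[i]].
by rewrite leqNgt ltn_ord.
Qed.

(** The bound is uniform in the truncation [K] and so survives the limit. [1 <= L] makes higher
    powers of [L^(-1/2)] smaller. *)
Lemma Hsum_asympt (x : 'I_N -> nat) : exists C : R, forall L K, 1 <= L ->
  `|Hsum L K x - \det (\matrix_(i, j) ('C(x i, j)%:R : R)) * Hsum L K (fun i => i)|
   <= C * (Num.sqrt L)^-1 ^+ ndelta.+1.
Proof.
pose M := (N + \max_i (x i).+1)%N.
have NM : (N <= M)%N by exact: leq_addr.
have xM i : (x i < M)%N by rewrite (leq_trans _ (leq_addl _ _))//; exact: leq_bigmax.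
exists (\sum_(m : {ffun 'I_N -> 'I_M}) (\prod_i 'C(x i, m i)%:R) * \prod_i (m i)`!%:R).
move=> L K L1; have L0 : 0 < L by exact: lt_le_trans L1.
have Ln : L != 0 by rewrite gt_eqF.
rewrite (Hsum_split K NM Ln xM) (Hsum_id _ Ln) addrAC subrr add0r.
apply: le_trans (ler_norm_sum _ _ _) _.
set l := (Num.sqrt L)^-1.
have l1 : 0 <= l <= 1.
  by rewrite invr_ge0 sqrtr_ge0/= invf_le1 ?sqrtr_gt0// -[leLHS]sqrtr1 ler_sqrt// ltW.
rewrite mulr_suml [leRHS](bigID (fun m : {ffun 'I_N -> 'I_M} =>
   injectiveb m && [exists i, (N <= m i)%N]))/=.
have prod0 (m : {ffun 'I_N -> 'I_M}) : 0 <= \prod_i ('C(x i, m i)%:R : R) by exact: prodr_ge0.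
have prod0' (m : {ffun 'I_N -> 'I_M}) : 0 <= \prod_i ((m i)`!%:R : R) by exact: prodr_ge0.
rewrite -[leLHS]addr0 lerD//; last first.
  by apply: sumr_ge0 => m _; rewrite !mulr_ge0// exprn_ge0//; case/andP: l1.
apply: ler_sum => m /andP[/injectiveP mi /existsP[i Ni]].
rewrite normrM ger0_norm// -mulrA ler_wpM2l//.
apply: le_trans (Bsum_norm_le _ _ L0) _; rewrite ler_wpM2l//.
apply: ler_wiXn2l; [by case/andP: l1..|].
pose s := [seq (m j : nat) | j <- enum 'I_N].
have us : uniq s by rewrite map_inj_uniq ?enum_uniq// => j k /val_inj /mi.
have ss : size s = N by rewrite size_map size_enum_ord.
have := @sum_uniq_gt s (m i) us; rewrite ss /ndelta => h.
rewrite (leq_trans (h _ _))//; first by apply/mapP; exists i; rewrite ?mem_enum.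
by rewrite /s big_map big_enum.
Qed.

End SignedSums.

(** * Lower bound for the leading coefficient *)

Section LowerBound.
Context {R : realType} {N : nat}.
Implicit Types (L : R) (K : nat).

Definition detX L K (z : {ffun 'I_N -> 'I_K}) : R :=
  \det (\matrix_(i, j) charlier L j (z i)).

Definition weight L K (z : {ffun 'I_N -> 'I_K}) : R := \prod_i pweight L (z i).

Lemma weight_ge0 L K (z : {ffun 'I_N -> 'I_K}) : 0 < L -> 0 <= weight L z.
Proof. by move=> L0; apply: prodr_ge0 => i _; apply: pweight_ge0; exact: ltW. Qed.

(** Summing over the permutations of the indices turns the product of Charlier functions into a
    determinant. It is a positive multiple of the Vandermonde determinant, so [sgv] is its sign and
    the signed sum becomes an L^1 norm. *)
Lemma Bsum_detX L K : 0 < L -> N`!%:R * @Bsum R N L K (fun i => i) =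
  \sum_(z : {ffun 'I_N -> 'I_K}) weight L z * `|detX L z|.
Proof.
move=> L0; have Ln : L != 0 by rewrite gt_eqF.
rewrite -card_Sn -sumr_const mulr_suml.
under eq_bigr => s _.
  rewrite mul1r.
  have -> : @Bsum R N L K (fun i => i) = (-1) ^+ s * Bsum L K (fun i : 'I_N => s i).
    by rewrite (Bsum_perm _ _ (fun i : 'I_N => i : nat)) mulrA -expr2 sqrr_sign mul1r.
  rewrite mulr_sumr.
  over.
rewrite exchange_big/=; apply: eq_bigr => z _.
have -> : `|detX L z| = sgv z * detX L z.
  have cp : 0 < \prod_(j < N) L^-1 ^+ j by apply: prodr_gt0 => j _; rewrite exprn_gt0// invr_gt0.
  by rewrite /detX /sgv det_charlier// normrM (gtr0_norm cp) normrEsg; ring.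
rewrite [RHS]mulrCA /detX /determinant !mulr_sumr; apply: eq_bigr => s _.
have -> : \prod_(i < N) wcharlier L (s i) (z i) =
    weight L z * \prod_i (\matrix_(i0, j) charlier L j (z i0)) i (s i).
  by rewrite -big_split/=; apply: eq_bigr => i _; rewrite !mxE.
by move: (sgv z) (weight L z) ((-1) ^+ s) (\prod_i _) => a b c e; ring.
Qed.

(** After expanding both determinants the sum factorizes over coordinates; by orthogonality only
    equal pairs of permutations survive the limit. *)
Lemma detX_sqr_cvg L : 0 < L ->
  \sum_(z : {ffun 'I_N -> 'I_K}) weight L z * detX L z ^+ 2 @[K --> \oo] -->
  N`!%:R * \prod_(j < N) (j`!%:R / L ^+ j : R).
Proof.
move=> L0; pose T a b K : R := \sum_(0 <= z < K) wcharlier L a z * charlier L b z.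
have -> : (fun K => \sum_(z : {ffun 'I_N -> 'I_K}) weight L z * detX L z ^+ 2) =
  (fun K => \sum_(s : 'S_N) \sum_(t : 'S_N) (-1) ^+ s * (-1) ^+ t * \prod_i T (s i) (t i) K).
  apply/funext => K.
  under [RHS]eq_bigr => s _.
    under eq_bigr => t _.
      rewrite -(sum_ffun_prod K (fun i k => wcharlier L (s i) k * charlier L (t i) k)) mulr_sumr.
      over.
    rewrite exchange_big/=.
    over.
  rewrite exchange_big/=; apply: eq_bigr => z _.
  rewrite expr2 /detX /determinant mulr_suml mulr_sumr; apply: eq_bigr => s _.
  rewrite mulr_sumr mulr_sumr; apply: eq_bigr => t _.
  rewrite /wcharlier big_split/= big_split/= /weight.
  have h (u : 'S_N) : \prod_i (\matrix_(i0, j) charlier L j (z i0)) i (u i) =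
      \prod_i charlier L (u i) (z i).
    by apply: eq_bigr => i _; rewrite mxE.
  rewrite !h; move: ((-1) ^+ s) ((-1) ^+ t) (\prod_i pweight _ _) (\prod_i charlier L (s i) _)
        (\prod_i charlier L (t i) _) => a b c e f.
  by ring.
have -> : N`!%:R * \prod_(j < N) (j`!%:R / L ^+ j : R) =
  \sum_(s : 'S_N) \sum_(t : 'S_N) (-1) ^+ s * (-1) ^+ t *
     \prod_i (if s i == t i :> nat then (s i)`!%:R / L ^+ (s i) else 0).
  rewrite -card_Sn -sumr_const mulr_suml; apply: eq_bigr => s _.
  rewrite [RHS](bigD1 s)//= [X in _ + X]big1 ?addr0 => [|t ts].
    have -> : (-1) ^+ s * (-1) ^+ s = 1 :> R by rewrite -expr2 sqrr_sign.
    rewrite !mul1r [LHS](reindex_inj (@perm_inj _ s))/=.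
    by apply: eq_bigr => i _; rewrite eqxx.
  have [i si] : exists i, s i != t i.
    apply: contrapT => h; case/eqP: ts; apply/permP => i.
    by apply: contrapT => /eqP; rewrite eq_sym => st; apply: h; exists i.
  by rewrite (bigD1 i)//= ifN ?mul0r ?mulr0//; apply: contra si => /eqP/val_inj ->.
apply: cvg_big; first exact: add_continuous.
move=> s _; apply: cvg_big; first exact: add_continuous.
move=> t _; apply: cvgM; first exact: cvg_cst.
apply: cvg_big; first exact: mul_continuous.
by move=> i _; exact: charlier_orthogonal.
Qed.

Lemma prod_lt_const (l : R) : \prod_(i < N) \prod_(j < N | (i < j)%N) l = l ^+ @ndelta N.
Proof.
rewrite (exchange_big_dep xpredT)//= /ndelta -prodrXr; apply: eq_bigr => j _.
by rewrite -(big_ord_widen N (fun=> l) (ltnW (ltn_ord j))) big_const_ord iter_mulr_1.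
Qed.

(** From [|x_j - x_i| <= (1 + |x_i|) (1 + |x_j|)], extended to all ordered pairs so that the bound
    is a product over coordinates. *)
Lemma vdm_norm_le (x : 'I_N -> R) :
  `|vdm (\row_i x i)| <= \prod_i (1 + `|x i|) ^+ (2 * N).
Proof.
apply: (@le_trans _ _ (\prod_(i < N) \prod_(j < N) ((1 + `|x i|) * (1 + `|x j|)))).
  rewrite /vdm normr_prod; apply: ler_prod => i _; rewrite normr_ge0/=.
  rewrite normr_prod [leRHS](bigID (fun j : 'I_N => (i < j)%N))/= -[leLHS]mulr1.
  apply: ler_pM => //; first exact: prodr_ge0.
    apply: ler_prod => j _; rewrite normr_ge0/= !mxE.
    have := ler_normB (x j) (x i); have := mulr_ge0 (normr_ge0 (x i)) (normr_ge0 (x j)).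
    by nra.
  apply: (@le_trans _ _ (\prod_(j < N | ~~ (i < j)%N) 1)); first by rewrite big1.
  apply: ler_prod => j _; rewrite ler01/=.
  by have := normr_ge0 (x i); have := normr_ge0 (x j); nra.
rewrite le_eqVlt; apply/orP; left; apply/eqP.
transitivity (\prod_i ((1 + `|x i|) ^+ N * \prod_j (1 + `|x j|))).
  by apply: eq_bigr => i _; rewrite big_split/= prodr_const card_ord.
rewrite big_split/= prodr_const card_ord -prodrXl -big_split/=.
by apply: eq_bigr => i _; rewrite mul2n -addnn exprD.
Qed.

Lemma pweight_moment p : exists D : R, forall L K, 1 <= L ->
  \sum_(0 <= z < K) pweight L z * (1 + `|(z%:R - L) * (Num.sqrt L)^-1|) ^+ p <= D.
Proof.
(* [(1 + |x|)^p <= (p+1)! * expR (1 + |x|)] and [expR |x| <= expR x + expR (- x)]. Each exponential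
   has mean at most [expR 2], by the exponential moment at [a = l] and [a = - l], where
   [L * a^2 = 1]. *)
exists (p.+1`!%:R * expR 1 * (expR 2 + expR 2)) => L K L1.
have L0 : 0 < L by exact: lt_le_trans L1.
set l := (Num.sqrt L)^-1.
have l0 : 0 < l by rewrite invr_gt0 sqrtr_gt0.
have l1 : l <= 1.
  by rewrite invf_le1 ?sqrtr_gt0// -[leLHS]sqrtr1 ler_sqrt// ltW.
have Ll : L * l ^+ 2 = 1 by rewrite exprVn sqr_sqrtr ?ltW// mulfV// gt_eqF.
apply: (@le_trans _ _ (\sum_(0 <= z < K) p.+1`!%:R * expR 1 *
   (pweight L z * expR (l * (z%:R - L)) + pweight L z * expR (- l * (z%:R - L))))).
  apply: ler_sum => z _; rewrite -mulrDr mulrCA ler_wpM2l ?pweight_ge0 ?(ltW L0)//.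
  set x := (_ - _) * l; have -> : l * (z%:R - L) = x by rewrite mulrC.
  have -> : - l * (z%:R - L) = - x by rewrite mulNr mulrC.
  have x0 := normr_ge0 x.
  have f0 : 0 < (p.+1`!%:R : R) by rewrite ltr0n fact_gt0.
  apply: (@le_trans _ _ ((1 + `|x|) ^+ p.+1)); first by apply: ler_weXn2l => //; lra.
  have h1 : 0 <= 1 + `|x| by lra.
  have := expR_ge1Dxn p h1.
  rewrite expRD => h; rewrite -mulrA mulrC -ler_pdivrMr//.
  apply: (@le_trans _ _ (expR 1 * expR `|x|)); first by apply: le_trans h; rewrite lerDr.
  rewrite ler_wpM2l ?expR_ge0//.
  have e1 := expR_ge0 x; have e2 := expR_ge0 (- x).
  by case: (ger0P x) => _; lra.
rewrite -mulr_sumr ler_wpM2l ?mulr_ge0 ?expR_ge0// big_split/=.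
have h a : `|a| = l -> \sum_(0 <= z < K) pweight L z * expR (a * (z%:R - L)) <= expR 2.
  move=> al; apply: le_trans (pweight_expR_le _ (ltW L0) _) _; first by rewrite al.
  by rewrite -[a ^+ 2]ger0_norm ?sqr_ge0// normrX al Ll mulr1.
by apply: lerD; apply: h; rewrite ?normrN gtr0_norm.
Qed.

Lemma detX_fourth : exists D : R, forall L K, 1 <= L ->
  \sum_(z : {ffun 'I_N -> 'I_K}) weight L z * detX L z ^+ 4 <=
   D * (Num.sqrt L)^-1 ^+ (4 * @ndelta N).
Proof.
(* The exponent [2 * N] of [vdm_norm_le], raised to the power 4. *)
have [D hD] := pweight_moment (8 * N).
exists (D ^+ N) => L K L1.
have L0 : 0 < L by exact: lt_le_trans L1.
set l := (Num.sqrt L)^-1.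
have l0 : 0 < l by rewrite invr_gt0 sqrtr_gt0.
have lL : l ^+ 2 = L^-1 by rewrite exprVn sqr_sqrtr ?ltW.
apply: (@le_trans _ _ (\sum_(z : {ffun 'I_N -> 'I_K})
   (\prod_i (pweight L (z i) * (1 + `|((z i)%:R - L) * l|) ^+ (8 * N))) * l ^+ (4 * @ndelta N))).
  apply: ler_sum => z _; rewrite big_split/= -mulrA ler_wpM2l ?weight_ge0//.
  (* The determinant carries [l^(2 * ndelta)]; half of it rescales the factors of the Vandermonde
     product, which does not see the centring. *)
  have -> : detX L z = l ^+ @ndelta N * vdm (\row_i (((z i)%:R - L) * l)).
    rewrite /detX det_charlier ?gt_eqF//.
    have -> : \prod_(j < N) L^-1 ^+ j = l ^+ @ndelta N * l ^+ @ndelta N.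
      rewrite /ndelta -!prodrXr -big_split/=; apply: eq_bigr => j _.
      by rewrite -lL -exprM mulnC exprM expr2.
    rewrite -mulrA; congr (_ * _); rewrite -prod_lt_const /vdm -big_split/=.
    apply: eq_bigr => i _; rewrite -big_split/=; apply: eq_bigr => j _; rewrite !mxE.
    by rewrite -[RHS]mulrBl; ring.
  rewrite exprMn mulrC -exprM [(_ * 4)%N]mulnC ler_wpM2r ?exprn_ge0 ?(ltW l0)//.
  set v := vdm _; have -> : v ^+ 4 = `|v| ^+ 4.
    by rewrite -normrX ger0_norm// (exprM _ 2 2) sqr_ge0.
  apply: (@le_trans _ _ ((\prod_i (1 + `|((z i)%:R - L) * l|) ^+ (2 * N)) ^+ 4)).
    apply: lerXn2r; rewrite ?nnegrE//; last exact: vdm_norm_le.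
    by apply: prodr_ge0 => i _; rewrite exprn_ge0// addr_ge0.
  rewrite -prodrXl; apply: ler_prod => i _.
  by rewrite -exprM mulnAC [(2 * 4)%N]/= lexx andbT exprn_ge0// addr_ge0.
rewrite -mulr_suml ler_wpM2r ?exprn_ge0 ?(ltW l0)//.
rewrite (sum_ffun_prod K (fun (i : 'I_N) k => pweight L k * (1 + `|(k%:R - L) * l|) ^+ (8 * N))).
rewrite -[leRHS](_ : \prod_(i < N) D = _); last by rewrite prodr_const card_ord.
apply: ler_prod => i _; rewrite hD// andbT sumr_ge0// => k _.
by rewrite mulr_ge0 ?pweight_ge0 ?exprn_ge0 ?addr_ge0// ltW.
Qed.

Lemma Hsum_id_ge : exists2 c : R, 0 < c & forall L, 1 <= L ->
  \forall K \near \oo, c * (Num.sqrt L)^-1 ^+ @ndelta N <= @Hsum R N L K (fun i => i).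
Proof.
have [D hD] := detX_fourth.
pose A : R := N`!%:R * \prod_(j < N) j`!%:R.
have A0 : 0 < A by rewrite mulr_gt0 ?ltr0n ?fact_gt0//; apply: prodr_gt0 => j _; rewrite ltr0n fact_gt0.
pose D' := Num.max D 0.
have D'0 : 0 <= D' by rewrite le_max lexx orbT.
(* [k * e] is the cutoff in the comparison of moments below. This [k] makes the loss from the fourth
   moment at most half of the gain from the second. *)
pose k : R := 1 + 4 * D' / A.
have k1 : 1 <= k by rewrite lerDl; apply: divr_ge0; [exact: mulr_ge0|exact: ltW].
have k0 : 0 < k by rewrite (lt_le_trans _ k1).
have Nf : 0 < (N`!%:R : R) by rewrite ltr0n fact_gt0.
exists (A / 4 / k / N`!%:R); first by rewrite !divr_gt0.
move=> L L1; have L0 : 0 < L by exact: lt_le_trans L1.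
set l := (Num.sqrt L)^-1.
have l0 : 0 < l by rewrite invr_gt0 sqrtr_gt0.
have lL : l ^+ 2 = L^-1 by rewrite exprVn sqr_sqrtr ?ltW.
have := detX_sqr_cvg L0.
have -> : N`!%:R * \prod_(j < N) (j`!%:R / L ^+ j : R) = A * l ^+ @ndelta N ^+ 2.
  rewrite big_split/= mulrA -/A; congr (_ * _); rewrite /ndelta -exprM muln2 -mul2n exprM lL.
  by rewrite -prodrXr; apply: eq_bigr => i _; rewrite exprVn.
set e := l ^+ @ndelta N; have e0 : 0 < e by rewrite exprn_gt0.
move=> /cvgr_ge /(_ (A * e ^+ 2 / 2)) h.
have Ae : 0 < A * e ^+ 2 by rewrite mulr_gt0// exprn_gt0.
have {}h := h ltac:(lra).
near=> K.
have hK : A * e ^+ 2 / 2 <= \sum_(z : {ffun 'I_N -> 'I_K}) weight L z * detX L z ^+ 2.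
  by near: K.
rewrite Hsum_id ?gt_eqF// -(ler_pM2l Nf) Bsum_detX//.
have -> : N`!%:R * (A / 4 / k / N`!%:R * e) = A / 4 / k * e.
  by field; rewrite !gt_eqF.
have hD4 : \sum_(z : {ffun 'I_N -> 'I_K}) weight L z * detX L z ^+ 4 <= D' * e ^+ 4.
  apply: le_trans (hD L K L1) _; rewrite mulnC exprM -/l -/e ler_wpM2r ?exprn_ge0 ?(ltW l0)//.
  by rewrite le_max lexx.
(* |X| >= (X^2 - X^4 / (k e)^2) / (k e) turns bounds on the second and fourth
   moments into a lower bound on E|X|. *)
apply: (@le_trans _ _ (\sum_(z : {ffun 'I_N -> 'I_K})
  (weight L z * detX L z ^+ 2 * (k * e)^-1 - weight L z * detX L z ^+ 4 * (k * e)^-1 ^+ 3))).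
  rewrite sumrB -!mulr_suml.
  have ke : 0 < (k * e)^-1 by rewrite invr_gt0 mulr_gt0.
  have ke3 : 0 <= (k * e)^-1 ^+ 3 by rewrite exprn_ge0// ltW.
  have := ler_wpM2r (ltW ke) hK; have := ler_wpM2r ke3 hD4.
  have -> : D' * e ^+ 4 * (k * e)^-1 ^+ 3 = (D' / k / k) * (e / k).
    by field; rewrite !gt_eqF.
  have -> : A * e ^+ 2 / 2 * (k * e)^-1 = A / 2 * (e / k).
    by field; rewrite !gt_eqF.
  have -> : A / 4 / k * e = A / 4 * (e / k) by ring.
  have : D' / k / k <= A / 4.
    apply: (@le_trans _ _ (D' / k)).
      by rewrite ler_pdivrMr// ler_peMr// divr_ge0// ltW.
    rewrite ler_pdivrMr// /k mulrDr mulr1.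
    have -> : A / 4 * (4 * D' / A) = D' by field; rewrite gt_eqF.
    by rewrite lerDr divr_ge0// ltW.
  have : 0 < e / k by rewrite divr_gt0.
  by nra.
apply: ler_sum => z _; have w0 := weight_ge0 z L0.
have t0 : 0 < k * e by rewrite mulr_gt0.
move: (weight L z) w0 (detX L z) (k * e) t0 => w w0 X t t0.
rewrite (_ : _ - _ = w * (X ^+ 2 / t - X ^+ 4 / t ^+ 3)); last by field; rewrite gt_eqF.
rewrite ler_wpM2l//.
have -> : X ^+ 2 / t - X ^+ 4 / t ^+ 3 = (`|X| ^+ 2 * t ^+ 2 - `|X| ^+ 4) / t ^+ 3.
  have -> : `|X| ^+ 2 = X ^+ 2 by rewrite -normrX ger0_norm ?sqr_ge0.
  have -> : `|X| ^+ 4 = X ^+ 4 by rewrite -normrX ger0_norm// (exprM _ 2 2) sqr_ge0.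
  by field; rewrite gt_eqF.
rewrite ler_pdivrMr ?exprn_gt0//.
move: (normr_ge0 X); move: `|X| => Y Y0.
suff : 0 <= Y * (t ^+ 3 - Y * t ^+ 2 + Y ^+ 3) by lra.
rewrite mulr_ge0//; have [tY|Yt] := leP t Y.
  have : 0 <= Y * (Y ^+ 2 - t ^+ 2) by rewrite mulr_ge0// subr_ge0 lerXn2r ?nnegrE// ltW.
  have : 0 <= t ^+ 3 by rewrite exprn_ge0// ltW.
  by lra.
have : 0 <= (t - Y) * t ^+ 2 by rewrite mulr_ge0 ?exprn_ge0 ?subr_ge0// ltW.
have : 0 <= Y ^+ 3 by rewrite exprn_ge0.
by lra.
Unshelve. all: by end_near. Qed.

End LowerBound.

Lemma pweight_sum {R : realType} (L : R) : \sum_(0 <= k < n) pweight L k @[n --> \oo] --> (1 : R).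
Proof.
have -> : (1 : R) = expR L * expR (- L) by rewrite -expRD subrr expR0.
have -> : (fun n => \sum_(0 <= k < n) pweight L k) =
    (fun n => series (exp_coeff L) n * expR (- L)).
  by apply/funext => n; rewrite /series/= mulr_suml.
by apply: cvgM; [exact: is_cvg_series_exp_coeff|exact: cvg_cst].
Qed.

(** * Poisson processes *)

Section History.
Context {R : realType} {d} {T : measurableType d} {d'} {S : measurableType d'}.
Implicit Types (X : R -> T -> S) (I : set R) (A B : set T).

Lemma history_setI X I A B : history X I A -> history X I B -> history X I (A `&` B).
Proof. by move=> hA hB; exact: (@measurableI _ (g_sigma_algebraType _) A B). Qed.

Lemma history_bigcup X I (F : nat -> set T) :
  (forall n, history X I (F n)) -> history X I (\bigcup_n F n).
Proof. by move=> hF; exact: (@bigcupT_measurable _ (g_sigma_algebraType _)). Qed.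

Lemma history_setC X I A : history X I A -> history X I (~` A).
Proof. by move=> hF; exact: (@measurableC _ (g_sigma_algebraType _)). Qed.

Lemma history_setT X I : history X I setT.
Proof. exact: (@measurableT _ (g_sigma_algebraType _)). Qed.

Lemma history_pre X I u (B : set S) : I u -> measurable B -> history X I (X u @^-1` B).
Proof. by move=> Iu mB; apply: sub_sigma_algebra; exists u => //; exists B. Qed.

Lemma history_sub X I J : I `<=` J -> history X I `<=` history X J.
Proof.
move=> IJ; apply: sub_sigma_algebra2 => A [u Iu [B mB ->]].
by exists u; [exact: IJ|exists B].
Qed.

Lemma history_measurable X I : (forall u, I u -> measurable_fun setT (X u)) ->
  history X I `<=` (@measurable _ T).
Proof.
move=> mX; apply: smallest_sub; first exact: sigma_algebra_measurable.
by move=> A [u Iu [B mB ->]]; rewrite -[_ @^-1` _]setTI; exact: mX.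
Qed.

End History.

Lemma history_incr {R : realType} {d} {T : measurableType d} (X : R -> T -> nat) I s t k :
  I s -> I t -> history X I [set w | X t w = (X s w + k)%N].
Proof.
move=> Is It.
have -> : [set w | X t w = (X s w + k)%N] =
   \bigcup_n (X s @^-1` [set n] `&` X t @^-1` [set (n + k)%N]).
  apply/seteqP; split => w /=; first by move=> h; exists (X s w).
  by move=> [n _ [/= -> ->]].
by apply: history_bigcup => n; apply: history_setI; exact: history_pre.
Qed.

Section PoissonProcess.
Context {R : realType} {d} {T : measurableType d} (P : probability T R).
Variables (X : R -> T -> nat) (HX : poisson_process P X).

Lemma poisson_process_measurable u : 0 <= u -> measurable_fun setT (X u).
Proof. by case: HX => + _ _ _; exact. Qed.

Lemma poisson_history_measurable (I : set R) A : (forall u, I u -> 0 <= u) ->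
  history X I A -> measurable A.
Proof.
by move=> hI; apply: history_measurable => u /hI; exact: poisson_process_measurable.
Qed.

Lemma poisson_measurable_pre u (B : set nat) : 0 <= u -> measurable (X u @^-1` B).
Proof.
by move=> u0; apply: (@poisson_history_measurable [set u]) => [v ->//|]; exact: history_pre.
Qed.

Lemma poisson_incr s t A k : 0 <= s -> s < t -> history X [set u | 0 <= u <= s] A ->
  pr P (A `&` [set w | X t w = (X s w + k)%N]) = pr P A * pweight (t - s) k.
Proof.
move=> s0 st hA; case: HX => _ _ _ /(_ s t A k); rewrite s0 st => /(_ isT hA) h.
rewrite /pr h fineM//=; first by rewrite pweight_pmf// subr_gt0.
by rewrite fin_num_measure//; apply: poisson_history_measurable hA => u /andP[].
Qed.

(** [poisson_process] prescribes the probabilities of the increments [k : nat]; they add up to 1, so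
    a decrease has probability 0. *)
Lemma poisson_nondecreasing s t : 0 <= s -> s < t -> pr P [set w | (X t w < X s w)%N] = 0.
Proof.
move=> s0 st; have t0 : 0 <= t by rewrite (le_trans s0)// ltW.
pose F k := [set w | X t w = (X s w + k)%N].
have mF k : measurable (F k).
  by apply: (@poisson_history_measurable [set u | 0 <= u]) => //; exact: history_incr.
have dF i j w : F i w -> F j w -> i = j by rewrite /F/= => -> /addnI.
have -> : [set w | (X t w < X s w)%N] = ~` (setT `&` \bigcup_k F k).
  apply/seteqP; split => w /=.
    by move=> + [_ [k _]]; rewrite /F/= => /[swap] ->; rewrite ltnNge leq_addr.
  rewrite ltnNge => h; apply/negP => sw; apply: h; split => //.
  by exists (X t w - X s w)%N => //; rewrite /F/= subnKC.
have mU : measurable (setT `&` \bigcup_k F k).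
  by apply: measurableI => //; exact: bigcupT_measurable.
rewrite prC//; apply/eqP; rewrite subr_eq0; apply/eqP.
have := pr_series (P := P) measurableT mF dF.
have -> : (fun n => \sum_(0 <= i < n) pr P (setT `&` F i)) =
          (fun n => \sum_(0 <= i < n) pweight (t - s) i).
  apply/funext => n; apply: eq_bigr => i _.
  by rewrite poisson_incr ?prT ?mul1r//; exact: history_setT.
move=> h; exact: (cvg_unique _ (@pweight_sum R (t - s)) h).
Qed.

End PoissonProcess.

Section PoissonSystem.
Context {R : realType} {N : nat} {d} {T : measurableType d} (P : probability T R).
Variables (Y : 'I_N -> R -> T -> nat) (HY : poisson_system P Y).

(** Independence is given as a product formula for such rectangles. They suffice throughout, in
    place of a joint filtration of the system. *)
Definition pevent (s : R) (A : set T) : Prop :=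
  exists2 F : 'I_N -> set T, (forall i, history (Y i) [set u | 0 <= u <= s] (F i)) &
    A = \bigcap_(i in [set: 'I_N]) F i.

Let HYi i : poisson_process P (Y i) := HY.1 i.

Lemma pevent_measurable s A : pevent s A -> measurable A.
Proof.
move=> [F hF ->]; apply: fin_bigcap_measurable; first exact: finite_finset.
by move=> i _; apply: (poisson_history_measurable (HYi i)) (hF i) => u /andP[].
Qed.

Lemma pevent_setT s : pevent s setT.
Proof.
exists (fun=> setT); first by move=> i; exact: history_setT.
by rewrite bigcapT.
Qed.

Lemma pevent_setI s A B : pevent s A -> pevent s B -> pevent s (A `&` B).
Proof.
move=> [F hF ->] [G hG ->]; exists (fun i => F i `&` G i).
  by move=> i; exact: history_setI.
by rewrite bigcapI.
Qed.

Lemma pevent_sub s t A : s <= t -> pevent s A -> pevent t A.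
Proof.
move=> st [F hF ->]; exists F => // i; apply: history_sub (hF i) => u /= /andP[-> us].
exact: le_trans st.
Qed.

Definition Yeq (t : R) (k : 'I_N -> nat) : set T := [set w | forall i, Y i t w = k i].

Lemma pevent_Yeq s t k : 0 <= t -> t <= s -> pevent s (Yeq t k).
Proof.
move=> t0 ts; exists (fun i => Y i t @^-1` [set k i]).
  by move=> i; apply: history_pre => //=; rewrite t0.
by apply/seteqP; split => [w h i _|w h i]; [exact: h|exact: (h i Logic.I)].
Qed.

Lemma pr_product (F : 'I_N -> set T) : (forall i, history (Y i) [set u | 0 <= u] (F i)) ->
  pr P (\bigcap_(i in [set: 'I_N]) F i) = \prod_i pr P (F i).
Proof. exact: HY.2. Qed.

Lemma pevent_incr s t A (k : 'I_N -> nat) : 0 <= s -> s < t -> pevent s A ->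
  pr P (A `&` [set w | forall i, Y i t w = (Y i s w + k i)%N]) =
  pr P A * \prod_i pweight (t - s) (k i).
Proof.
move=> s0 st [F hF ->]; have t0 : 0 <= t by rewrite (le_trans s0)// ltW.
have -> : [set w | forall i, Y i t w = (Y i s w + k i)%N] =
  \bigcap_(i in [set: 'I_N]) [set w | Y i t w = (Y i s w + k i)%N].
  by apply/seteqP; split => [w h i _|w h i]; [exact: h|exact: (h i Logic.I)].
have hF' i : history (Y i) [set u | 0 <= u] (F i).
  by apply: history_sub (hF i) => u /andP[].
rewrite -bigcapI !pr_product//.
  by rewrite -big_split/=; apply: eq_bigr => i _; exact: poisson_incr.
by move=> i; apply: history_setI => //; exact: history_incr.
Qed.

Lemma Y_nondecreasing i s t : 0 <= s -> s < t -> pr P [set w | (Y i t w < Y i s w)%N] = 0.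
Proof. exact: poisson_nondecreasing. Qed.

Lemma Y_measurable i t (B : set nat) : 0 <= t -> measurable [set w | B (Y i t w)].
Proof. by move=> t0; exact: (poisson_measurable_pre (HYi i)). Qed.

Lemma measurable_Yle i s t : 0 <= s -> 0 <= t -> measurable [set w | (Y i t w < Y i s w)%N].
Proof.
move=> s0 t0; have -> : [set w | (Y i t w < Y i s w)%N] =
   \bigcup_n ([set w | Y i s w = n] `&` [set w | (Y i t w < n)%N]).
  apply/seteqP; split => w /=; first by move=> h; exists (Y i s w).
  by move=> [n _ [/= ->]].
apply: bigcupT_measurable => n; apply: measurableI.
  exact: (Y_measurable i (fun m => m = n)).
exact: (Y_measurable i (fun m => m < n)%N).
Qed.

Lemma pevent_Yeq_later s t A (k z : 'I_N -> nat) : 0 <= s -> s < t -> pevent s A ->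
  A `<=` Yeq s k ->
  pr P (A `&` Yeq t z) =
  pr P A * \prod_i (if (k i <= z i)%N then pweight (t - s) (z i - k i) else 0).
Proof.
move=> s0 st hA Ak; have t0 : 0 <= t by rewrite (le_trans s0)// ltW.
have mA := pevent_measurable hA.
have mz : measurable (Yeq t z) by apply: (@pevent_measurable t); exact: pevent_Yeq.
have [kz|] := boolP [forall i, (k i <= z i)%N]; last first.
  (* A target below the current position would need a decreasing coordinate, which is a null
     event. *)
  rewrite negb_forall => /existsP[i kz]; rewrite (bigD1 i)//= (negbTE kz) mul0r mulr0.
  apply: (@pr_null_sub _ _ _ P _ [set w | (Y i t w < Y i s w)%N]).
  - exact: measurableI.
  - exact: measurable_Yle.
  - by move=> w [/Ak hk hz] /=; rewrite (hk i) (hz i) ltnNge.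
  - exact: Y_nondecreasing.
have {}kz i : (k i <= z i)%N by exact: (forallP kz).
have -> : A `&` Yeq t z =
   A `&` [set w | forall i, Y i t w = (Y i s w + (z i - k i))%N].
  apply/seteqP; split => w [Aw h]; split => // i.
    by rewrite (h i) (Ak _ Aw i) subnKC.
  by rewrite (h i) (Ak _ Aw i) subnKC.
rewrite pevent_incr//; congr (_ * _); apply: eq_bigr => i _.
by rewrite kz.
Qed.

(** An event on the positions at time [t] is exhausted by the cubes [{0, .., K-1}^N]. The starting
    point [n] is kept inside the cube so that the sums have the shape of [Hsum]. *)
Lemma law_cvg s t A (k n : 'I_N -> nat) (G : ('I_N -> nat) -> bool) :
  0 <= s -> s < t -> pevent s A -> A `<=` Yeq s k ->
  pr P A * (\sum_(z : {ffun 'I_N -> 'I_K}) (G (fun i => z i))%:R *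
     \prod_i (if (n i + k i <= z i)%N then pweight (t - s) (z i - (n i + k i)) else 0))
    @[K --> \oo] --> pr P (A `&` [set w | G (fun i => n i + Y i t w)%N]).
Proof.
move=> s0 st hA Ak; have t0 : 0 <= t by rewrite (le_trans s0)// ltW.
have mA := pevent_measurable hA.
pose F K (z : {ffun 'I_N -> 'I_K}) : set T := [set w | forall i, (n i + Y i t w)%N = z i].
have mF K (z : {ffun 'I_N -> 'I_K}) : measurable (F K z).
  have -> : F K z = \bigcap_(i in [set: 'I_N]) [set w | (n i + Y i t w)%N = z i].
    by apply/seteqP; split => [w h i _|w h i]; [exact: h|exact: (h i Logic.I)].
  apply: fin_bigcap_measurable; first exact: finite_finset.
  by move=> i _; exact: (Y_measurable i (fun m => n i + m = z i)%N).
have dF K (z z' : {ffun 'I_N -> 'I_K}) w : F K z w -> F K z' w -> z = z'.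
  by move=> h h'; apply/ffunP => i; apply/val_inj; rewrite /= -(h i) -(h' i).
pose C K : set T := [set w | exists z : {ffun 'I_N -> 'I_K}, F K z w /\ G (fun i => z i)].
pose gz K (z : {ffun 'I_N -> 'I_K}) : set T := if G (fun i => z i) then F K z else set0.
have mgz K z : measurable (gz K z) by rewrite /gz; case: ifP.
have CE K : measurable (C K) /\ pr P (A `&` C K) = \sum_(z : {ffun 'I_N -> 'I_K}) pr P (A `&` gz K z).
  have [|] := @pr_sum_seq _ _ _ P _ (index_enum {ffun 'I_N -> 'I_K}) A (gz K) (index_enum_uniq _) mA (mgz K).
    by move=> z z' w; rewrite /gz; case: ifP => // _; case: ifP => // _; exact: dF.
  have -> : C K = [set w | exists2 z, z \in index_enum {ffun 'I_N -> 'I_K} & gz K z w].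
    apply/seteqP; split => w [z].
      by move=> [Fz Gz]; exists z; rewrite ?mem_index_enum// /gz Gz.
    by move=> _; rewrite /gz; case: ifP => // Gz Fz; exists z.
  by [].
have -> : (fun K => pr P A * (\sum_(z : {ffun 'I_N -> 'I_K}) (G (fun i => z i))%:R *
     \prod_i (if (n i + k i <= z i)%N then pweight (t - s) (z i - (n i + k i)) else 0))) =
   (fun K => pr P (A `&` C K)).
  apply/funext => K; rewrite (CE K).2 mulr_sumr; apply: eq_bigr => z _.
  rewrite /gz; case: ifP => Gz; last by rewrite setI0 pr0 mul0r mulr0.
  rewrite mul1r; have [nz|] := boolP [forall i, (n i <= z i)%N].
    have {}nz i : (n i <= z i)%N by exact: (forallP nz).
    have -> : F K z = Yeq t (fun i => z i - n i)%N.
      apply/seteqP; split => w h i; first by rewrite -(h i) addKn.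
      by rewrite (h i) subnKC.
    rewrite (pevent_Yeq_later _ s0 st hA Ak); congr (_ * _); apply: eq_bigr => i _.
    by rewrite leq_subRL// subnDA.
  rewrite negb_forall => /existsP[i]; rewrite -ltnNge => zn.
  rewrite (bigD1 i)//= ifN ?mul0r ?mulr0; last by rewrite -ltnNge (leq_trans zn)// leq_addr.
  have -> : F K z = set0; last by rewrite setI0 pr0.
  by apply/seteqP; split => // w /(_ i) h; move: zn; rewrite -h ltnNge leq_addr.
have -> : A `&` [set w | G (fun i => n i + Y i t w)%N] = \bigcup_K (A `&` C K).
  apply/seteqP; split => w.
    move=> [Aw Gw]; pose M := (\max_i (n i + Y i t w).+1)%N.
    have hM i : (n i + Y i t w < M)%N by rewrite /M (leq_trans _ (leq_bigmax i)).
    exists M => //; split => //; exists [ffun i => Ordinal (hM i)]; split.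
      by move=> i; rewrite ffunE.
    by move: Gw => /=; congr (is_true (G _)); apply/funext => i; rewrite ffunE.
  move=> [K _ [Aw [z [Fz Gz]]]]; split => //=.
  by move: Gz; congr (is_true (G _)); apply/funext => i; rewrite (Fz i).
apply: pr_cvg_up; first by move=> K; apply: measurableI => //; exact: (CE K).1.
move=> K w [Aw [z [Fz Gz]]]; split => //.
exists [ffun i => widen_ord (leqnSn K) (z i)]; split.
  by move=> i; rewrite ffunE/= (Fz i).
by move: Gz; congr (is_true (G _)); apply/funext => i; rewrite ffunE.
Qed.

End PoissonSystem.

(** * Survival in the Weyl chamber *)

Section WeylGeometry.
Context {R : realType} {N : nat}.
Implicit Types (x : 'rV[int]_N).

Lemma Delta_vdm x (m : 'I_N -> nat) (c : int) : (forall i, x 0 i + c = (m i)%:Z) ->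
  Delta x = vdm (\row_i (m i)%:R) :> R.
Proof.
move=> xm; apply: eq_bigr => i _; apply: eq_bigr => j _; rewrite !mxE.
have -> : x 0 j - x 0 i = (m j)%:Z - (m i)%:Z by rewrite -!xm; ring.
by rewrite rmorphB.
Qed.

(** [Hsum] takes natural starting points; [Delta] is invariant under a common translation of the
    coordinates. *)
Lemma weyl_shift_nat x : exists n : 'I_N -> nat, exists c : int,
  forall i, x 0 i + c = (n i)%:Z.
Proof.
exists (fun i => `|(x 0 i + \sum_j `|x 0 j|)%R|%N), (\sum_j `|x 0 j|) => i.
rewrite gez0_abs// (bigD1 i)//= addrA addr_ge0//; last exact: sumr_ge0.
by have := lerNnormlW (lexx `|x 0 i|); lia.
Qed.

Lemma Delta_gt0 x : in_weyl x -> 0 < Delta x :> R.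
Proof.
move=> /forallP h; apply: prodr_gt0 => i _; apply: prodr_gt0 => j ij.
by rewrite ltr0z subr_gt0; have /forallP/(_ j)/implyP := h i; exact.
Qed.

Lemma Delta_eq0 x (i j : 'I_N) : i != j -> x 0 i = x 0 j -> Delta x = 0 :> R.
Proof.
wlog ij : i j / (i < j)%N => [hw ij xij|_ xij].
  have [lij|lji|eij] := ltngtP i j; first exact: (hw i j).
    by apply: (hw j i); rewrite // eq_sym.
  by move/val_inj/eqP : eij; rewrite (negbTE ij).
by rewrite /Delta (bigD1 i)//= (bigD1 j)//= xij subrr !mul0r.
Qed.

Lemma weyl_wall x i : in_weyl x -> ~~ in_weyl (x + evec i) ->
  exists2 j, i != j & x 0 j = x 0 i + 1.
Proof.
move=> /forallP h; rewrite negb_forall => /existsP[a].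
rewrite negb_forall => /existsP[b]; rewrite negb_imply => /andP[ab].
have /forallP/(_ b)/implyP/(_ ab) xab := h a.
rewrite !mxE /= -leNgt.
have [ia|ia] := eqVneq a i; have [ib|ib] := eqVneq b i.
- by move: ab; rewrite ia ib ltnn.
- rewrite ia in xab ab * => hh; exists b; first by rewrite eq_sym.
  by move: hh xab => /=; lia.
- by move=> /=; lia.
- by move=> /=; lia.
Qed.

Lemma weyl_wall_eq x i : in_weyl x -> ~~ in_weyl (x + evec i) ->
  exists2 j, i != j & (x + evec i) 0 i = (x + evec i) 0 j.
Proof.
move=> xW /(weyl_wall xW)[j ij xj]; exists j => //.
by rewrite !mxE/= eqxx eq_sym (negbTE ij) xj addr0.
Qed.

End WeylGeometry.

(** * Signed probabilities and their Markov property *)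

Section ReflectionPrinciple.
Context {R : realType} {N : nat} {d} {T : measurableType d} (P : probability T R).
Variables (Y : 'I_N -> R -> T -> nat) (HY : poisson_system P Y).
Implicit Types (x : 'rV[int]_N) (s t : R) (A : set T).

Definition pos t w : 'rV[int]_N := \row_i (Y i t w)%:Z.

Lemma measurable_pos t (G : 'rV[int]_N -> Prop) : 0 <= t -> measurable [set w | G (pos t w)].
Proof.
move=> t0; pose F (z : {ffun 'I_N -> nat}) : set T :=
  if `[< G (\row_i (z i)%:Z) >] then Yeq Y t z else set0.
have -> : [set w | G (pos t w)] = \bigcup_z F z.
  apply/seteqP; split => w /=.
    move=> Gw; exists [ffun i => Y i t w] => //; rewrite /F asboolT; last first.
      by move: Gw; congr G; apply/rowP => i; rewrite !mxE ffunE.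
    by move=> i; rewrite ffunE.
  move=> [z _]; rewrite /F; case: asboolP => // Gz h.
  by move: Gz; congr G; apply/rowP => i; rewrite !mxE (h i).
apply: countable_bigcupT_measurable; first exact: countableP.
move=> z; rewrite /F; case: asboolP => // _.
by apply: (pevent_measurable HY (s := t)); exact: pevent_Yeq.
Qed.

(* E[sgn Delta(x + Y(t)); A] *)
Definition signed_prob A x t : R :=
  pr P (A `&` [set w | (0 : R) < Delta (x + pos t w)]) -
  pr P (A `&` [set w | Delta (x + pos t w) < (0 : R)]).

Lemma signed_prob_cvg s t A x (k n : 'I_N -> nat) (c : int) :
  0 <= s -> s < t -> pevent Y s A -> A `<=` Yeq Y s k ->
  (forall i, x 0 i + c = (n i)%:Z) ->
  pr P A * Hsum (t - s) K (fun i => n i + k i)%N @[K --> \oo] --> signed_prob A x t.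
Proof.
move=> s0 st hA Ak xn.
have E w : Delta (x + pos t w) = vdm (\row_i ((n i + Y i t w)%N%:R : R)).
  by apply: (@Delta_vdm _ _ _ _ c) => i; rewrite !mxE PoszD -xn; ring.
pose G1 (z : 'I_N -> nat) := (0 : R) < vdm (\row_i (z i)%:R).
pose G2 (z : 'I_N -> nat) := vdm (\row_i (z i)%:R) < (0 : R).
have h1 := law_cvg HY (n := n) (G := G1) s0 st hA Ak.
have h2 := law_cvg HY (n := n) (G := G2) s0 st hA Ak.
have E1 : [set w | G1 (fun i => n i + Y i t w)%N] = [set w | (0 : R) < Delta (x + pos t w)].
  by apply/seteqP; split => w /=; rewrite E.
have E2 : [set w | G2 (fun i => n i + Y i t w)%N] = [set w | Delta (x + pos t w) < (0 : R)].
  by apply/seteqP; split => w /=; rewrite E.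
rewrite /signed_prob -E1 -E2.
rewrite [X in X @ _ --> _](_ : _ = (fun K =>
   pr P A * (\sum_(z : {ffun 'I_N -> 'I_K}) (G1 (fun i => z i))%:R *
     \prod_i (if (n i + k i <= z i)%N then pweight (t - s) (z i - (n i + k i)) else 0)) -
   pr P A * (\sum_(z : {ffun 'I_N -> 'I_K}) (G2 (fun i => z i))%:R *
     \prod_i (if (n i + k i <= z i)%N then pweight (t - s) (z i - (n i + k i)) else 0)))).
  exact: cvgB h1 h2.
apply/funext => K; rewrite -mulrBr; congr (_ * _); rewrite -sumrB; apply: eq_bigr => z _.
rewrite -mulrBl; congr (_ * _); rewrite /G1 /G2 /sgv.
by case: sgrP => //=; rewrite ?subr0 ?sub0r.
Qed.

(** Reflection will identify this with [h_t(x)] in the chamber. It involves the law at the single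
    time [t] instead of the whole path. *)
Definition hfun t x := signed_prob setT x t.

Lemma hfun_cvg t x (n : 'I_N -> nat) (c : int) : 0 < t -> (forall i, x 0 i + c = (n i)%:Z) ->
  Hsum t K n @[K --> \oo] --> hfun t x.
Proof.
move=> t0 xn; have Y0 : setT `<=` Yeq Y 0 (fun=> 0%N).
  by move=> w _ i; case: (HY.1 i) => _ _ -> _.
have := signed_prob_cvg (lexx 0) t0 (pevent_setT Y 0) Y0 xn.
rewrite prT subr0; under eq_fun do rewrite mul1r.
by have -> : (fun i => n i + 0)%N = n by apply/funext => i; rewrite addn0.
Qed.

(** Both sides are limits of the same truncated sums, started at the position reached at time
    [s]. *)
Lemma signed_prob_markov s t A x (k : 'I_N -> nat) :
  0 <= s -> s < t -> pevent Y s A -> A `<=` Yeq Y s k ->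
  signed_prob A x t = pr P A * hfun (t - s) (x + \row_i (k i)%:Z).
Proof.
move=> s0 st hA Ak; have [n [c xn]] := weyl_shift_nat x.
apply: (cvg_unique _ (signed_prob_cvg s0 st hA Ak xn)) => //.
apply: cvgM; first exact: cvg_cst.
apply: (@hfun_cvg _ _ _ c); first by rewrite subr_gt0.
by move=> i; rewrite !mxE PoszD -xn; ring.
Qed.

Lemma hfun_wall t x (i j : 'I_N) : 0 < t -> i != j -> x 0 i = x 0 j -> hfun t x = 0.
Proof.
move=> t0 ij xij; have [n [c xn]] := weyl_shift_nat x.
apply: (cvg_unique _ (hfun_cvg t0 xn)) => //.
have -> : (fun K => Hsum t K n) = (fun=> 0 : R); last exact: cvg_cst.
apply/funext => K; apply: (@Hsum_eq0 _ _ _ _ _ i j) => //.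
by apply/eqP; rewrite -eqz_nat -!xn xij.
Qed.

Lemma measurable_Dpos x t : 0 <= t -> measurable [set w | (0 : R) < Delta (x + pos t w)].
Proof. exact: (@measurable_pos t (fun z => (0 : R) < Delta (x + z))). Qed.

Lemma measurable_Dneg x t : 0 <= t -> measurable [set w | Delta (x + pos t w) < (0 : R)].
Proof. exact: (@measurable_pos t (fun z => Delta (x + z) < (0 : R))). Qed.

(** Increments with at most one jump: [None] for no jump, [Some i] for a single jump of coordinate
    [i]. *)
Definition kap (o : option 'I_N) (i : 'I_N) : nat := (o == Some i).

Lemma row_kap o : \row_i (kap o i)%:Z = (if o is Some i then evec i else 0) :> 'rV[int]_N.
Proof.
apply/rowP => j; rewrite /kap; case: o => [i|]; rewrite !mxE//=.
have -> : (Some i == Some j) = (j == i) by rewrite eq_sym.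
by case: eqP.
Qed.

Lemma prod_kap (dt : R) o : \prod_i pweight dt (kap o i) =
  (if o is Some i then dt else 1) * expR (- (N%:R * dt)).
Proof.
have -> : expR (- (N%:R * dt)) = \prod_(i < N) expR (- dt).
  by rewrite prodr_const card_ord -mulrN expRM_natl.
case: o => [i|].
  rewrite (bigD1 i)//= [in RHS](bigD1 i)//= mulrA; congr (_ * _).
    by rewrite /kap eqxx (_ : nat_of_bool _ = 1%N)// /pweight (factS 0) fact0 expr1 divr1.
  apply: eq_bigr => j ji; have -> : kap (Some i) j = 0%N.
    have e : (Some i == Some j) = (j == i) by rewrite eq_sym.
    by rewrite /kap e (negbTE ji).
  by rewrite /pweight expr0 fact0 divr1 mul1r.
by rewrite mul1r; apply: eq_bigr => j _; rewrite /kap/= /pweight expr0 fact0 divr1 mul1r.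
Qed.

End ReflectionPrinciple.

Section Cadlag.
Context {R : realType} {E : pseudoMetricType R}.
Hypothesis discE : forall x : E, nbhs x [set x].

Lemma cadlag_right (f : R -> E) t : cadlag f -> 0 <= t ->
  exists2 e : R, 0 < e & forall u, t <= u < t + e -> f u = f t.
Proof.
move=> cf t0; have [+ _] := cf t t0; move=> /(_ _ (discE (f t))) [e /= e0 he].
exists e => // u /andP[]; rewrite le_eqVlt => /predU1P[->//|tu] ue.
by apply: he => //=; rewrite ltr0_norm ?subr_lt0//; lra.
Qed.

Lemma cadlag_left (f : R -> E) t : cadlag f -> 0 < t ->
  exists2 e : R, 0 < e & exists l : E, forall u, t - e < u < t -> f u = l.
Proof.
move=> cf t0; have [_ /(_ t0)[l]] := cf t (ltW t0); move=> /(_ _ (discE l)) [e /= e0 he].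
exists e => //; exists l => u /andP[tu ut].
by apply: he => //=; rewrite gtr0_norm ?subr_gt0//; lra.
Qed.

End Cadlag.

Lemma nbhs_nat1 (n : nat) : nbhs n [set n].
Proof. by rewrite nbhs_principalE; exact/principal_filterP. Qed.

Lemma sum_option {V : nmodType} (I : finType) (F : option I -> V) :
  \sum_o F o = F None + \sum_i F (Some i).
Proof.
rewrite (bigD1 None)//=; congr +%R; rewrite (reindex_omap Some id)/=; last by case.
by apply: eq_bigl => i; rewrite eqxx.
Qed.

(** * Reflection in discrete time *)

Section GridApproximation.
Context {R : realType} {N : nat} {d} {T : measurableType d} (P : probability T R).
Variables (Y : 'I_N -> R -> T -> nat) (HY : poisson_system P Y).
Implicit Types (x : 'rV[int]_N) (s t : R) (A : set T).

Local Notation pos := (pos Y).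
Local Notation hfun := (hfun P Y).
Local Notation signed_prob := (signed_prob P Y).

Definition step s (k : 'I_N -> nat) A o := A `&` Yeq Y s (fun i => k i + kap o i)%N.

Lemma kap_inj (k : 'I_N -> nat) o o' : (forall i, k i + kap o i = k i + kap o' i)%N -> o = o'.
Proof.
move=> h; have {}h i : kap o i = kap o' i by exact: addnI (h i).
case: o o' h => [i|] [j|] h //.
- by have := h i; rewrite /kap eqxx; case: eqP.
- by have := h i; rewrite /kap eqxx.
- by have := h j; rewrite /kap eqxx.
Qed.

Lemma step_pevent s dt k A o : 0 <= s -> 0 < dt -> pevent Y s A ->
  pevent Y (s + dt) (step (s + dt) k A o).
Proof.
move=> s0 dt0 hA; apply: pevent_setI; last by apply: pevent_Yeq => //; rewrite addr_ge0// ltW.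
by apply: pevent_sub hA; rewrite lerDl ltW.
Qed.

Lemma pr_step s dt k A o : 0 <= s -> 0 < dt -> pevent Y s A -> A `<=` Yeq Y s k ->
  pr P (step (s + dt) k A o) =
  pr P A * ((if o is Some i then dt else 1) * expR (- (N%:R * dt))).
Proof.
move=> s0 dt0 hA Ak; rewrite /step (pevent_Yeq_later HY _ s0 _ hA Ak) ?ltrDl//.
rewrite -prod_kap; congr (_ * _); apply: eq_bigr => i _.
by rewrite leq_addr addKn addrAC subrr add0r.
Qed.

(** The remainder counts two or more jumps in a time [dt]. With [u = N * dt], the probability of at
    most one jump is [(1 + u) * expR (- u) >= 1 - u^2]. *)
Lemma step_split s dt k A B : 0 <= s -> 0 < dt -> pevent Y s A -> A `<=` Yeq Y s k ->
  measurable B -> exists2 r, 0 <= r <= pr P A * (N%:R * dt) ^+ 2 &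
    pr P (A `&` B) = \sum_o pr P (step (s + dt) k A o `&` B) + r.
Proof.
move=> s0 dt0 hA Ak mB; have mA := pevent_measurable HY hA.
have sdt0 : 0 <= s + dt by rewrite addr_ge0// ltW.
pose F o := Yeq Y (s + dt) (fun i => k i + kap o i)%N.
have mF o : measurable (F o) by apply: (pevent_measurable HY (s := s + dt)); exact: pevent_Yeq.
have dF o o' w : F o w -> F o' w -> o = o'.
  by move=> h h'; apply: (@kap_inj k) => i; rewrite -h -h'.
pose U := [set w | exists2 o, o \in index_enum (option 'I_N) & F o w].
have [mU _] := pr_sum_seq P (index_enum_uniq (option 'I_N)) measurableT mF dF.
have sumU C : measurable C -> pr P (C `&` U) = \sum_o pr P (C `&` F o).
  by move=> mC; exact: (pr_sum_seq P (index_enum_uniq (option 'I_N)) mC mF dF).2.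
have mAB : measurable (A `&` B) by exact: measurableI.
exists (pr P (A `&` B `\` U)); last first.
  rewrite (prID P mAB mU) sumU//; congr +%R; apply: eq_bigr => o _.
  by rewrite /step setIAC.
rewrite pr_ge0/=; apply: (@le_trans _ _ (pr P (A `\` U))).
  by apply: pr_le; [exact: measurableD|exact: measurableD|move=> w [[]]].
have := prID P mA mU; rewrite sumU//.
under eq_bigr do rewrite -/(step _ _ _ _) (pr_step _ s0 dt0 hA Ak).
rewrite sum_option sumr_const card_ord mul1r -mulrnAr.
set u := N%:R * dt; have -> : dt * expR (- u) *+ N = u * expR (- u).
  by rewrite -mulr_natl mulrA.
have p0 := pr_ge0 P A; have e := expR_ge1Dx (- u).
have u0 : 0 <= u by rewrite mulr_ge0// ltW.
move: (expR (- u)) e => E e h.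
have : (1 - u) * (1 + u) <= E * (1 + u) by rewrite ler_wpM2r; lra.
move=> /(ler_wpM2l p0); lra.
Qed.

(** Time [s] is left out: the position there is fixed by the event one conditions on. *)
Definition stays x s dt m : set T :=
  [set w | forall j, (1 <= j <= m)%N -> in_weyl (x + pos (s + j%:R * dt) w)].

Lemma measurable_stays x s dt m : 0 <= s -> 0 <= dt -> measurable (stays x s dt m).
Proof.
move=> s0 dt0.
have -> : stays x s dt m = \bigcap_j [set w | (1 <= j <= m)%N -> in_weyl (x + pos (s + j%:R * dt) w)].
  by apply/seteqP; split => [w h j _|w h j]; [exact: h|exact: (h j Logic.I)].
apply: bigcapT_measurable => j.
apply: (measurable_pos HY (fun z => (1 <= j <= m)%N -> in_weyl (x + z))).
by rewrite addr_ge0// mulr_ge0.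
Qed.

Lemma signed_prob_wall s t A x (k : 'I_N -> nat) (i j : 'I_N) :
  0 <= s -> s <= t -> pevent Y s A -> A `<=` Yeq Y s k -> i != j ->
  (x + \row_i (k i)%:Z) 0 i = (x + \row_i (k i)%:Z) 0 j -> signed_prob A x t = 0.
Proof.
move=> s0; rewrite le_eqVlt => /predU1P[<-|st] hA Ak ij xij; last first.
  by rewrite (signed_prob_markov HY _ s0 st hA Ak) (hfun_wall HY _ ij xij) ?mulr0// subr_gt0.
have D0 w : A w -> Delta (x + pos s w) = 0 :> R.
  move=> /Ak h; apply: (Delta_eq0 ij); move: xij.
  by rewrite !mxE (h i) (h j).
have e1 : A `&` [set w | (0 : R) < Delta (x + pos s w)] = set0.
  by apply/seteqP; split => // w /= [/D0 ->]; rewrite ltxx.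
have e2 : A `&` [set w | Delta (x + pos s w) < (0 : R)] = set0.
  by apply/seteqP; split => // w /= [/D0 ->]; rewrite ltxx.
by rewrite /signed_prob e1 e2 subrr.
Qed.

Lemma row_add x (k : 'I_N -> nat) o :
  x + \row_i (k i + kap o i)%N%:Z =
  x + \row_i (k i)%:Z + (if o is Some i then evec i else 0).
Proof. by rewrite -row_kap; apply/rowP => i; rewrite !mxE PoszD addrA. Qed.

Lemma stays_step s dt x (k : 'I_N -> nat) A o m :
  in_weyl (x + \row_i (k i + kap o i)%N%:Z) ->
  step (s + dt) k A o `&` stays x s dt m.+1 =
  step (s + dt) k A o `&` stays x (s + dt) dt m.
Proof.
have E j : s + j.+1%:R * dt = s + dt + j%:R * dt by rewrite -natr1; ring.
move=> xW; apply/seteqP; split => w [[Aw hw] h]; split => // j /andP[j1 jm].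
  by rewrite -E; apply: h; exact: jm.
case: j j1 jm => [//|[_ _|j _ jm]]; last by rewrite E; apply: h.
rewrite mul1r; move: xW; congr (is_true (in_weyl _)); congr (_ + _).
by apply/rowP => i; rewrite !mxE (hw i).
Qed.

(* Reflection in discrete time: a grid step makes at most one jump up to an event of
   probability O(dt^2), and one jump leads either inside the chamber or to a wall,
   where the signed probability of any later time vanishes. *)
Lemma stays_approx x dt m : 0 < dt -> forall s A k, 0 <= s -> pevent Y s A -> A `<=` Yeq Y s k ->
  in_weyl (x + \row_i (k i)%:Z) ->
  `|pr P (A `&` stays x s dt m) - signed_prob A x (s + m%:R * dt)|
  <= pr P A * (m%:R * (2 * (N%:R * dt) ^+ 2)).
Proof.
move=> dt0; elim: m => [|m IH] s A k s0 hA Ak xW; have mA := pevent_measurable HY hA.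
  have D0 w : A w -> (0 : R) < Delta (x + pos s w).
    move=> /Ak h; apply: Delta_gt0; move: xW; congr (is_true (in_weyl _)); congr (_ + _).
    by apply/rowP => i; rewrite !mxE (h i).
  have -> : stays x s dt 0 = setT by apply/seteqP; split => // w _ [].
  have e1 : A `&` [set w | (0 : R) < Delta (x + pos s w)] = A by apply: setIidl.
  have e2 : A `&` [set w | Delta (x + pos s w) < (0 : R)] = set0.
    by apply/seteqP; split => // w /= [/D0 /ltW]; rewrite leNgt => /negP.
  by rewrite mul0r addr0 mul0r mulr0 setIT /signed_prob e1 e2 pr0 subr0 subrr normr0.
set t := s + m.+1%:R * dt.
have tE : t = s + dt + m%:R * dt by rewrite /t -natr1; ring.
have sdt0 : 0 <= s + dt by rewrite addr_ge0// ltW.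
have sdtt : s + dt <= t by rewrite tE lerDl mulr_ge0// ltW.
have t0 : 0 <= t by rewrite (le_trans _ sdtt).
(* Each of the three remainders lies between 0 and [pr P A * (N * dt)^2]; hence [|r1 - (r2 - r3)|]
   is at most twice that, which is the cost of one step. *)
have [r1 hr1 E1] := step_split s0 dt0 hA Ak (measurable_stays x m.+1 s0 (ltW dt0)).
have [r2 hr2 E2] := step_split s0 dt0 hA Ak (measurable_Dpos HY x t0).
have [r3 hr3 E3] := step_split s0 dt0 hA Ak (measurable_Dneg HY x t0).
rewrite {1}/signed_prob E1 E2 E3.
set S1 := \sum_o _; set S2 := \sum_o _; set S3 := \sum_o _.
have Hs : `|S1 - (S2 - S3)| <= pr P A * (m%:R * (2 * (N%:R * dt) ^+ 2)).
  have -> : S1 - (S2 - S3) = \sum_o (pr P (step (s + dt) k A o `&` stays x s dt m.+1)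
     - signed_prob (step (s + dt) k A o) x t) by rewrite /S1 /S2 /S3 /signed_prob -!sumrB.
  apply: le_trans (ler_norm_sum _ _ _) _.
  have C0 : 0 <= m%:R * (2 * (N%:R * dt) ^+ 2) by rewrite mulr_ge0// mulr_ge0// sqr_ge0.
  apply: (@le_trans _ _ (\sum_o pr P (step (s + dt) k A o) * (m%:R * (2 * (N%:R * dt) ^+ 2)))).
    apply: ler_sum => o _; have hS := step_pevent k o s0 dt0 hA.
    have Sk : step (s + dt) k A o `<=` Yeq Y (s + dt) (fun i => k i + kap o i)%N by move=> w [].
    have [xW'|xW'] := boolP (in_weyl (x + \row_i (k i + kap o i)%N%:Z)).
      by rewrite stays_step// tE; exact: (IH _ _ _ sdt0 hS Sk xW').
    have -> : step (s + dt) k A o `&` stays x s dt m.+1 = set0.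
      apply/seteqP; split => // w [[_ hw] /(_ 1%N isT)]; rewrite mul1r => h.
      case/negP: xW'; move: h; congr (is_true (in_weyl _)); congr (_ + _).
      by apply/rowP => i; rewrite !mxE (hw i).
    move: xW' (xW'); rewrite {1}row_add; case: o Sk hS => [i|] Sk hS; last by rewrite addr0 xW.
    move=> /(weyl_wall_eq xW) [j ij xij] _.
    rewrite (signed_prob_wall sdt0 sdtt hS Sk ij) ?row_add//.
    by rewrite pr0 subrr normr0 mulr_ge0// pr_ge0.
  rewrite -mulr_suml ler_wpM2r//.
  have [r4 hr4 E4] := step_split s0 dt0 hA Ak measurableT.
  move: E4; under eq_bigr do rewrite setIT.
  by rewrite setIT => ->; case/andP: hr4; lra.
have p0 := pr_ge0 P A; rewrite -natr1 mulrDl mul1r mulrDr.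
by move: Hs hr1 hr2 hr3; rewrite !ler_norml => /andP[? ?] /andP[? ?] /andP[? ?] /andP[? ?]; lra.
Qed.

(** Keeps only the event of no jump at all. It yields [h_L >= expR (- (N * L))], hence positivity of
    [h_L] and its limit 1 as [L] tends to 0. *)
Lemma stays_ge x dt m : 0 < dt -> forall s A k, 0 <= s -> pevent Y s A -> A `<=` Yeq Y s k ->
  in_weyl (x + \row_i (k i)%:Z) ->
  pr P A * expR (- (N%:R * dt)) ^+ m <= pr P (A `&` stays x s dt m).
Proof.
move=> dt0; elim: m => [|m IH] s A k s0 hA Ak xW; have mA := pevent_measurable HY hA.
  have -> : stays x s dt 0 = setT by apply/seteqP; split => // w _ [].
  by rewrite setIT expr0 mulr1.
have sdt0 : 0 <= s + dt by rewrite addr_ge0// ltW.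
have hS := step_pevent k None s0 dt0 hA.
have Sk : step (s + dt) k A None `<=` Yeq Y (s + dt) (fun i => k i + kap None i)%N by move=> w [].
have xW' : in_weyl (x + \row_i (k i + kap None i)%N%:Z) by rewrite row_add addr0.
have := IH _ _ _ sdt0 hS Sk xW'; rewrite -stays_step// pr_step// mul1r -mulrA -exprS => h.
apply: (le_trans h); apply: pr_le.
- by apply: measurableI; [exact: (pevent_measurable HY hS)|apply: measurable_stays => //; exact: ltW].
- by apply: measurableI => //; apply: measurable_stays => //; exact: ltW.
- by move=> w [[Aw _] ?]; split.
Qed.

End GridApproximation.

(** * The survival probability and its ratios *)

Section StayProb.
Context {R : realType} {N : nat} {d} {T : measurableType d} (P : probability T R).
Variables (Y : 'I_N -> R -> T -> nat) (HY : poisson_system P Y).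
Implicit Types (x : 'rV[int]_N) (s t : R) (A : set T).

Local Notation pos := (pos Y).
Local Notation hfun := (hfun P Y).
Local Notation signed_prob := (signed_prob P Y).
Local Notation stays := (stays Y).

Definition stay_set L x : set T := [set w | forall t, 0 <= t <= L -> in_weyl (x + pos t w)].

Let dyad L n : R := L / 2 ^+ n.

Let dyad_gt0 L n : 0 < L -> 0 < dyad L n.
Proof. by move=> L0; rewrite divr_gt0// exprn_gt0. Qed.

Let dyad_full L n : (2 ^ n)%:R * dyad L n = L.
Proof. by rewrite /dyad natrX; field; rewrite expf_neq0. Qed.

Lemma Y0 i w : Y i 0 w = 0%N.
Proof. by case: (HY.1 i) => _ _ ->. Qed.

Lemma pos0 w : pos 0 w = 0.
Proof. by apply/rowP => i; rewrite !mxE Y0. Qed.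

Lemma pos_right_cst t w : 0 <= t ->
  exists2 e : R, 0 < e & forall u, t <= u < t + e -> pos u w = pos t w.
Proof.
move=> t0.
have : \forall u \near t^'+, forall i, Y i u w = Y i t w.
  apply: filter_forall => i; have [_ cY _ _] := HY.1 i.
  have [e e0 he] := cadlag_right nbhs_nat1 (cY w) t0.
  exists e => //= u; rewrite /ball_ /= ltr_distl => /andP[ue _] tu; apply: he.
  by rewrite (ltW tu)/=; lra.
move=> [e /= e0 he]; exists e => // u /andP[].
rewrite le_eqVlt => /predU1P[->//|tu] ue; apply/rowP => i; rewrite !mxE he//=.
by rewrite ltr0_norm ?subr_lt0//; lra.
Qed.

(** By right continuity an exit persists for a while, so the dyadic times see it. An exit at time
    [L] is seen because [L] belongs to every grid. *)
Lemma stay_setE L x : 0 < L -> in_weyl x ->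
  stay_set L x = \bigcap_n stays x 0 (dyad L n) (2 ^ n).
Proof.
move=> L0 xW; apply/seteqP; split => w.
  move=> h n _ j /andP[_ jn]; apply: h; rewrite add0r mulr_ge0 ?(ltW (dyad_gt0 _ L0))//=.
  by rewrite -[leRHS](dyad_full L n) ler_pM2r ?dyad_gt0// ler_nat.
move=> h t /andP[]; rewrite le_eqVlt => /predU1P[<- _|t0]; first by rewrite pos0 addr0.
rewrite le_eqVlt => /predU1P[->|tL].
  by have := h 0%N Logic.I 1%N isT; rewrite add0r mul1r /dyad expr0 divr1.
have [e e0 he] := pos_right_cst w (ltW t0).
have m0 : 0 < Num.min e (L - t) by rewrite lt_min e0 subr_gt0.
have [n hn] : exists n, dyad L n < Num.min e (L - t).
  have : geometric L (2^-1) k @[k --> \oo] --> (0 : R).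
    by apply: cvg_geometric; rewrite ger0_norm//; lra.
  move=> /cvgr_lt /(_ _ m0)[n _ hn]; exists n.
  by have := hn n (leqnn n); rewrite /= /dyad exprVn.
move: hn; rewrite lt_min => /andP[ne nL].
set dt := dyad L n in ne nL; have dt0 : 0 < dt by exact: dyad_gt0.
have td0 : 0 <= t / dt by rewrite divr_ge0 ?ltW.
(* The grid point [j.+1 * dt] lies strictly after [t] and within [dt < e] of it, and not beyond
   [L]. *)
have /andP[jt tj] := truncn_itv td0; set j := Num.trunc _ in jt tj.
have jt' : j%:R * dt <= t by rewrite -ler_pdivlMr.
have tj' : t < j.+1%:R * dt by rewrite -ltr_pdivrMr.
have jS : j.+1%:R * dt = j%:R * dt + dt by rewrite -natr1; ring.
have jn : (j.+1 <= 2 ^ n)%N.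
  by rewrite -(ler_nat R) -(ler_pM2r dt0) dyad_full; lra.
have := h n Logic.I j.+1 jn; rewrite add0r he//.
by rewrite -/dt; lra.
Qed.

Lemma stays_cvg L x : 0 < L -> in_weyl x ->
  pr P (stays x 0 (dyad L n) (2 ^ n)) @[n --> \oo] --> pr P (stay_set L x).
Proof.
move=> L0 xW; rewrite stay_setE//; apply: pr_cvg_down => n.
  by apply: (measurable_stays HY) => //; exact/ltW/dyad_gt0.
move=> w h j /andP[j1 jn]; rewrite add0r.
have := h (2 * j)%N; rewrite add0r.
have -> : (2 * j)%:R * dyad L n.+1 = j%:R * dyad L n.
  by rewrite /dyad exprS natrM; field; rewrite expf_neq0.
by apply; rewrite expnS leq_pmul2l// jn andbT muln_gt0.
Qed.

Let setT0 : setT `<=` Yeq Y 0 (fun=> 0%N).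
Proof. by move=> w _ i; rewrite Y0. Qed.

Let xW0 x : in_weyl x -> in_weyl (x + \row_(i < N) 0%:Z).
Proof.
by move=> xW; rewrite (_ : \row__ _ = 0) ?addr0//; apply/rowP => i; rewrite !mxE.
Qed.

(** [2^n] steps of length [L / 2^n] leave a total error of [2 * (N * L)^2 / 2^n]. *)
Lemma stay_prob_hfun L x : 0 < L -> in_weyl x -> stay_prob P Y L x = hfun L x.
Proof.
move=> L0 xW; apply: (cvg_unique _ (stays_cvg L0 xW)) => //.
apply/cvgrPdist_le => e e0 /=.
have : geometric (2 * (N%:R * L) ^+ 2) (2^-1) k @[k --> \oo] --> (0 : R).
  by apply: cvg_geometric; rewrite ger0_norm//; lra.
move=> /cvgr_le /(_ _ e0); apply: filterS => n; apply: le_trans.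
have := stays_approx HY (2 ^ n) (dyad_gt0 n L0) (lexx 0) (pevent_setT Y 0) setT0 (xW0 xW).
rewrite setTI prT add0r dyad_full mul1r distrC => /le_trans; apply.
rewrite /geometric/= natrX exprVn /dyad.
by rewrite le_eqVlt; apply/orP; left; apply/eqP; field; rewrite expf_neq0.
Qed.


Lemma stay_prob_out L x : 0 <= L -> ~~ in_weyl x -> stay_prob P Y L x = 0.
Proof.
move=> L0 xW; rewrite /stay_prob (_ : [set _ | _] = set0) ?measure0//.
apply/seteqP; split => // w /(_ 0); rewrite lexx L0 => /(_ isT).
by move: xW => /[swap]; have := pos0 w; rewrite /pos => ->; rewrite addr0 => ->.
Qed.

(** If the jump leaves the chamber it lands on a wall, where both functions vanish. So the ratios of
    interest can be computed with [hfun]. *)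
Lemma stay_prob_step L x i : 0 < L -> in_weyl x ->
  stay_prob P Y L (x + evec i) = hfun L (x + evec i).
Proof.
move=> L0 xW; have [xW'|xW'] := boolP (in_weyl (x + evec i)); first exact: stay_prob_hfun.
have [j ij xij] := weyl_wall_eq xW xW'.
by rewrite (hfun_wall HY L0 ij xij) stay_prob_out// ltW.
Qed.

Lemma measurable_stay_set L x : 0 < L -> in_weyl x -> measurable (stay_set L x).
Proof.
move=> L0 xW; rewrite stay_setE//; apply: bigcapT_measurable => n.
by apply: (measurable_stays HY) => //; exact/ltW/dyad_gt0.
Qed.

Lemma stay_prob_ge0 L x : 0 <= stay_prob P Y L x.
Proof. exact: fine_ge0. Qed.

Lemma stay_prob_le1 L x : 0 < L -> in_weyl x -> stay_prob P Y L x <= 1.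
Proof. by move=> L0 xW; apply: pr_le1; exact: measurable_stay_set. Qed.

Lemma stay_prob_le L L' x : 0 < L -> L <= L' -> in_weyl x ->
  stay_prob P Y L' x <= stay_prob P Y L x.
Proof.
move=> L0 LL xW; have L0' : 0 < L' by exact: lt_le_trans LL.
apply: pr_le; [exact: measurable_stay_set|exact: measurable_stay_set|].
by move=> w h t /andP[t0 tL]; apply: h; rewrite t0 (le_trans tL).
Qed.

Lemma stay_prob_ge L x : 0 < L -> in_weyl x -> expR (- (N%:R * L)) <= stay_prob P Y L x.
Proof.
move=> L0 xW; rewrite leNgt; apply/negP => /(cvgr_lt _ (stays_cvg L0 xW))[n _ /(_ n (leqnn n))]/=.
rewrite ltNge => /negP; apply.
have := stays_ge HY (2 ^ n) (dyad_gt0 n L0) (lexx 0) (pevent_setT Y 0) setT0 (xW0 xW).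
rewrite setTI prT mul1r -expRM_natl; apply: le_trans.
by rewrite mulrN mulrCA dyad_full.
Qed.

Lemma stay_prob_gt0 L x : 0 < L -> in_weyl x -> 0 < stay_prob P Y L x.
Proof. by move=> L0 xW; apply: lt_le_trans (stay_prob_ge L0 xW); exact: expR_gt0. Qed.

(* h_(L+dt)(x) <= h_L(x), and h_(L+dt)(x) expands to first order in dt by looking at
   the first jump. *)
Lemma stay_prob_sum_le L x : 0 < L -> in_weyl x ->
  \sum_i stay_prob P Y L (x + evec i) <= N%:R * stay_prob P Y L x.
Proof.
move=> L0 xW; set S := \sum_i _.
have S0 : 0 <= S by apply: sumr_ge0 => i _; exact: stay_prob_ge0.
set H := stay_prob P Y L x; have H0 : 0 <= H by exact: stay_prob_ge0.
have key (dt : R) : 0 < dt -> S <= N%:R * H + dt * (N%:R ^+ 2 + N%:R * S).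
  move=> dt0; have Ld0 : 0 < L + dt by rewrite addr_gt0.
  have hT := pevent_setT Y 0.
  have [r2 hr2 E2] := step_split HY (lexx 0) dt0 hT setT0 (measurable_Dpos HY x (ltW Ld0)).
  have [r3 hr3 E3] := step_split HY (lexx 0) dt0 hT setT0 (measurable_Dneg HY x (ltW Ld0)).
  have LE : hfun (L + dt) x <= H.
    by rewrite -stay_prob_hfun// stay_prob_le// lerDl ltW.
  have E : hfun (L + dt) x = expR (- (N%:R * dt)) * (H + dt * S) + (r2 - r3).
    rewrite /hfun {1}/signed_prob E2 E3.
    rewrite [LHS](_ : _ = \sum_o signed_prob (step Y (0 + dt) (fun=> 0%N) setT o) x (L + dt) + (r2 - r3)); last first.
      by rewrite /signed_prob sumrB; ring.
    congr (_ + _).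
    have h o : signed_prob (step Y (0 + dt) (fun=> 0%N) setT o) x (L + dt) =
      ((if o is Some i then dt else 1) * expR (- (N%:R * dt))) *
      hfun L (x + (if o is Some i then evec i else 0)).
      have hS := step_pevent (fun=> 0%N) o (lexx 0) dt0 hT.
      have Sk : step Y (0 + dt) (fun=> 0%N) setT o `<=` Yeq Y (0 + dt) (fun i => 0 + kap o i)%N by move=> w [].
      rewrite (signed_prob_markov HY x _ _ hS Sk) ?add0r ?(ltW dt0)//; last by lra.
      rewrite -{1}[dt in step Y dt]add0r (pr_step HY o (lexx 0) dt0 hT setT0) prT mul1r.
      by rewrite addrK row_add (_ : \row_i 0%N%:Z = 0) ?addr0//; apply/rowP => i; rewrite !mxE.
    rewrite (eq_bigr _ (fun o _ => h o)) sum_option addr0 mul1r [in RHS]mulrDr; congr (_ + _).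
      by rewrite /H stay_prob_hfun.
    by rewrite !mulr_sumr; apply: eq_bigr => i _; rewrite stay_prob_step//; ring.
  rewrite prT !mul1r in hr2 hr3.
  have e1 := expR_ge1Dx (- (N%:R * dt)).
  move: E LE e1 hr2 hr3; set u := N%:R * dt; move: (expR (- u)) => q E LE e1 hr2 hr3.
  have : (1 - u) * (H + dt * S) <= q * (H + dt * S).
    by apply: ler_wpM2r; [rewrite addr_ge0 ?mulr_ge0 ?(ltW dt0)|lra].
  move=> h; rewrite -(ler_pM2l dt0).
  have : dt * (N%:R * H + dt * (N%:R ^+ 2 + N%:R * S)) = u * H + u ^+ 2 + u * (dt * S).
    by rewrite /u; ring.
  by move=> ->; move: hr2 hr3 => /andP[? ?] /andP[? ?]; lra.
rewrite leNgt; apply/negP => hlt.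
pose D := N%:R ^+ 2 + N%:R * S; have D0 : 0 <= D by rewrite addr_ge0 ?sqr_ge0 ?mulr_ge0.
pose g := S - N%:R * H; have g0 : 0 < g by rewrite subr_gt0.
(* For this [dt] the error term in [key] is smaller than the supposed gap [g]. *)
have dt0 : 0 < g / (2 * (D + 1)) by rewrite divr_gt0// mulr_gt0//; lra.
have := key _ dt0; rewrite -/D.
have : g / (2 * (D + 1)) * D < g.
  rewrite mulrAC ltr_pdivrMr; last by rewrite mulr_gt0//; lra.
  by rewrite ltr_pM2l//; lra.
by rewrite /g; lra.
Qed.

Lemma stay_prob_cvg0 x : in_weyl x -> stay_prob P Y L x @[L --> 0^'+] --> (1 : R).
Proof.
move=> xW.
have h : 1 - N%:R * L @[L --> (0 : R)^'+] --> (1 : R).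
  have e : (1 : R) = 1 - N%:R * 0 by rewrite mulr0 subr0.
  rewrite [X in _ --> X]e; apply: cvgB; first exact: cvg_cst.
  by apply: cvgM; [exact: cvg_cst|exact: cvg_at_right_filter cvg_id].
apply: (squeeze_cvgr _ h (cvg_cst (1 : R))).
near=> L; have L0 : 0 < L by near: L; exact: nbhs_right_gt.
rewrite stay_prob_le1// andbT (le_trans _ (stay_prob_ge L0 xW))//.
exact: expR_ge1Dx.
Unshelve. all: by end_near. Qed.

Let rho : 'rV[int]_N := \row_i (i : nat)%:Z.

(** The numerator differs from the leading term by O([l^(ndelta + 1)]) while the denominator is at
    least [c0 * l^ndelta], where [l = L^(-1/2)]; the quotient errs by O([l]). *)
Lemma hfun_asympt x : hfun L x / hfun L rho @[L --> +oo] -->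
  (\prod_(j < N) (j`!%:R)^-1) * (Delta x : R).
Proof.
have [n [c xn]] := weyl_shift_nat x.
have [C hC] := @Hsum_asympt R N n.
have [c0 c00 hc] := @Hsum_id_ge R N.
rewrite (Delta_vdm xn) -det_binom; set D := \det _ in hC *.
have rhoE (i : 'I_N) : rho 0 i + 0 = (i : nat)%:Z by rewrite mxE addr0.
pose C' := Num.max C 0; have C'0 : 0 <= C' by rewrite le_max lexx orbT.
apply/cvgrPdist_le => e e0; near=> L.
have L1 : 1 <= L by near: L; exact: nbhs_pinfty_ge.
have L0 : 0 < L by exact: lt_le_trans L1.
have eL : (C' / (c0 * e)) ^+ 2 <= L by near: L; apply: nbhs_pinfty_ge; exact: num_real.
set l := (Num.sqrt L)^-1; have l0 : 0 < l by rewrite invr_gt0 sqrtr_gt0.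
have h1 := hfun_cvg HY L0 xn; have h2 := hfun_cvg HY L0 rhoE.
have rho_ge : c0 * l ^+ @ndelta N <= hfun L rho.
  exact: (cvgr_to_ge h2 (hc L L1)).
have diff : `|hfun L x - D * hfun L rho| <= C * l ^+ (@ndelta N).+1.
  have h3 := cvg_norm (cvgB h1 (cvgM (cvg_cst D) h2)).
  exact: (cvgr_to_le (h3 _ _ _ _) (nearW _ (fun K => hC L K L1))).
have e' : 0 < c0 * l ^+ @ndelta N by rewrite mulr_gt0// exprn_gt0.
have r0 : 0 < hfun L rho by exact: lt_le_trans rho_ge.
rewrite distrC; have -> : hfun L x / hfun L rho - D = (hfun L x - D * hfun L rho) / hfun L rho.
  by field; rewrite gt_eqF.
rewrite normrM normfV (gtr0_norm r0) ler_pdivrMr// (le_trans diff)//.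
apply: (@le_trans _ _ (e * (c0 * l ^+ @ndelta N))); last by rewrite ler_wpM2l// ltW.
rewrite exprS !mulrA ler_wpM2r ?exprn_ge0 ?(ltW l0)// ler_pdivrMr ?sqrtr_gt0//.
apply: (@le_trans _ _ C'); first by rewrite le_max lexx.
have ce : 0 < c0 * e by rewrite mulr_gt0.
have : C' / (c0 * e) <= Num.sqrt L.
  rewrite -(@ger0_norm _ (C' / (c0 * e))) ?divr_ge0 ?(ltW ce)//.
  by rewrite -sqrtr_sqr ler_wsqrtr.
by rewrite ler_pdivrMr//; lra.
Unshelve. all: by end_near. Qed.

Lemma stay_ratio_cvg_pinfty x i : in_weyl x ->
  stay_prob P Y L (x + evec i) / stay_prob P Y L x @[L --> +oo] -->
  (Delta (x + evec i) / Delta x : R).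
Proof.
move=> xW; have h1 := @hfun_asympt (x + evec i); have h2 := @hfun_asympt x.
set k := \prod_(j < N) _ in h1 h2.
have k0 : 0 < k by apply: prodr_gt0 => j _; rewrite invr_gt0 ltr0n fact_gt0.
have D0 : 0 < Delta x :> R by exact: Delta_gt0.
have -> : Delta (x + evec i) / Delta x = (k * Delta (x + evec i)) / (k * Delta x) :> R.
  by field; rewrite !gt_eqF.
have h3 : (hfun L (x + evec i) / hfun L rho) / (hfun L x / hfun L rho) @[L --> +oo] -->
    (k * Delta (x + evec i)) / (k * Delta x).
  by apply: cvgM => //; apply: cvgV => //; rewrite gt_eqF// mulr_gt0.
apply: cvg_trans h3; apply: near_eq_cvg; near=> L.
have L0 : 0 < L by near: L; exact: nbhs_pinfty_gt.
rewrite /= stay_prob_step// stay_prob_hfun//.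
have hx : hfun L x != 0 by rewrite gt_eqF// -stay_prob_hfun// stay_prob_gt0.
have rW : in_weyl rho.
  by apply/forallP => a; apply/forallP => b; apply/implyP => ab; rewrite !mxE ltz_nat.
have hr : hfun L rho != 0 by rewrite gt_eqF// -stay_prob_hfun// stay_prob_gt0.
by field; rewrite hx hr.
Unshelve. all: by end_near. Qed.

Lemma stay_ratio_cvg0 x i : in_weyl x -> in_weyl (x + evec i) ->
  stay_prob P Y L (x + evec i) / stay_prob P Y L x @[L --> 0^'+] --> (1 : R).
Proof.
move=> xW xW'; rewrite -[X in _ --> X]divr1.
apply: cvgM; first exact: stay_prob_cvg0.
by apply: cvgV; [exact: oner_neq0|exact: stay_prob_cvg0].
Qed.

End StayProb.

(** * Uniqueness of the semigroup of a bounded jump generator *)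

Lemma one_sub_exprn_le {R : realDomainType} (b : R) n : 0 <= b <= 1 ->
  1 - b ^+ n <= n%:R * (1 - b).
Proof.
move=> /andP[b0 b1]; elim: n => [|n IH]; first by rewrite expr0 subrr mul0r.
rewrite exprS -natr1; have : 0 <= b ^+ n by rewrite exprn_ge0.
have : b ^+ n <= 1 by rewrite exprn_ile1.
by nra.
Qed.

(** Lets bounds for [n + 1] steps of length [t / (n + 1)] be passed to the limit, given only the
    derivative at 0. *)
Lemma cvg_quotient {R : realType} (u : R -> R) (l t : R) : 0 < t ->
  u h / h @[h --> 0^'+] --> l -> n.+1%:R * u (t / n.+1%:R) @[n --> \oo] --> t * l.
Proof.
move=> t0 /cvg_at_rightP/(_ (fun n => t / n.+1%:R)) H.
have h : u (t / n.+1%:R) / (t / n.+1%:R) @[n --> \oo] --> l.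
  apply: H; split => [n|]; first by rewrite divr_gt0.
  rewrite -[X in _ --> X](mulr0 t).
  by apply: cvgM; [exact: cvg_cst|exact: cvg_harmonic].
have -> : (fun n => n.+1%:R * u (t / n.+1%:R)) =
          (fun n => t * (u (t / n.+1%:R) / (t / n.+1%:R))).
  apply/funext => n; have : n.+1%:R != 0 :> R by rewrite pnatr_eq0.
  by move: (n.+1%:R : R) => m m0; field; rewrite m0 gt_eqF.
by apply: cvgM; [exact: cvg_cst|exact: h].
Qed.

Lemma indic_in {R : realType} {T : Type} (A : set T) x : A x -> \1_A x = 1 :> R.
Proof. by move=> Ax; rewrite indicE mem_set. Qed.

Lemma indic_out {R : realType} {T : Type} (A : set T) x : ~ A x -> \1_A x = 0 :> R.
Proof. by move=> Ax; rewrite indicE memNset. Qed.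

Section JumpSemigroup.
Context {R : realType} {dS} {S : measurableType dS}.
Hypothesis mS : forall A : set S, measurable A.
Context {M : nat} (nx : S -> 'I_M -> S) (k : S -> 'I_M -> R) (lam : R).
Hypotheses (k0 : forall x i, 0 <= k x i) (klam : forall x, \sum_i k x i <= lam)
  (nx_neq : forall x i, k x i != 0 -> nx x i <> x)
  (nx_inj : forall x i j, k x i != 0 -> nx x i = nx x j -> i = j).

Definition jgen (F : S -> R) (x : S) : R := \sum_(i < M) (F (nx x i) - F x) * k x i.

Lemma mSf (f : S -> R) : measurable_fun setT f.
Proof. by move=> _ B _; exact: mS. Qed.

Lemma bmS (f : S -> R) (C : R) : (forall x, `|f x| <= C) -> bmeas f.
Proof. by move=> h; split; [exact: mSf|exists C]. Qed.

(** From below, finitely many atoms of a kernel suffice. [Q] will select the jumps of nonzero rate,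
    whose targets are distinct. *)
Lemma ex_ge_points (mu : probability S R) (I : finType) (Q : pred I) (z : I -> S) (f : S -> R) (C : R) :
  (forall x, 0 <= f x <= C) -> (forall i j, Q i -> Q j -> z i = z j -> i = j) ->
  \sum_(i | Q i) f (z i) * pr mu [set z i] <= ex mu f.
Proof.
move=> f0 zI; pose g i : S -> R := fun x => (if Q i then f (z i) else 0) * \1_[set z i] x.
have bg i : bmeas (g i) by apply: bmeasZ; exact: bmeas_indic.
have -> : \sum_(i | Q i) f (z i) * pr mu [set z i] = ex mu (fun x => \sum_i g i x).
  rewrite ex_sum// big_mkcond; apply: eq_bigr => i _.
  rewrite exZ ?ex_indic//; last exact: bmeas_indic.
  by case: ifP => _; rewrite ?mul0r.
apply: ex_le; first exact: bmeas_sum.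
  by apply: (@bmS _ C) => x; have /andP[h1 h2] := f0 x; rewrite ger0_norm.
move=> x; have f0x i : 0 <= f i by case/andP: (f0 i).
have [[i [Qi zi]]|h] := pselect (exists i, Q i /\ z i = x).
  rewrite (bigD1 i)//= big1 ?addr0 => [|j ji].
    by rewrite /g Qi zi indic_in// mulr1.
  rewrite /g; case: ifP => [Qj|_]; last by rewrite mul0r.
  rewrite indic_out ?mulr0//= => xj; case/eqP: ji; apply/esym/zI => //.
  by rewrite zi.
rewrite big1// => i _; rewrite /g; case: ifP => [Qi|_]; last by rewrite mul0r.
by rewrite indic_out ?mulr0//= => xi; apply: h; exists i.
Qed.

Section Short.
Variable p : R -> S -> probability S R.
Hypothesis Hp : semigroup_of jgen p.

Let pp t x A : R := pr (p t x) A.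

Lemma pp01 t x A : 0 <= pp t x A <= 1.
Proof. by rewrite pr_ge0 pr_le1. Qed.

Lemma pp0 x A : pp 0 x A = \1_A x.
Proof. by case: Hp => H _ _; rewrite /pp /pr H. Qed.

Lemma ppD s t x A : 0 <= s -> 0 <= t -> pp (s + t) x A = ex (p s x) (fun z => pp t z A).
Proof.
move=> s0 t0; case: Hp => _ H _; rewrite /pp {1}/pr H//.
by congr fine; apply: eq_integral => z _; rewrite prE.
Qed.

Lemma ppD_ge s t x z A : 0 <= s -> 0 <= t -> pp s x [set z] * pp t z A <= pp (s + t) x A.
Proof.
move=> s0 t0; rewrite ppD//.
have := @ex_ge_points (p s x) 'I_1 xpredT (fun=> z) (fun z => pp t z A) 1.
rewrite big_ord1 mulrC; apply; first by move=> y; exact: pp01.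
by move=> i j _ _ _; rewrite !ord1.
Qed.

Lemma ppD_ge2 s t x z z' A : 0 <= s -> 0 <= t -> z <> z' ->
  pp s x [set z] * pp t z A + pp s x [set z'] * pp t z' A <= pp (s + t) x A.
Proof.
move=> s0 t0 zz; rewrite ppD//.
have := @ex_ge_points (p s x) bool xpredT (fun b => if b then z else z') (fun z => pp t z A) 1.
rewrite big_bool mulrC [pp s x [set z'] * _]mulrC; apply; first by move=> y; exact: pp01.
by move=> [] [] _ _ // /esym.
Qed.

Let rate x := \sum_i k x i.

Lemma pp_gen A x : (pp h x A - \1_A x) / h @[h --> 0^'+] --> jgen (\1_A) x.
Proof.
case: Hp => _ _ /(_ (\1_A : S -> R)) H.
have -> : (fun h => (pp h x A - \1_A x) / h) =
   (fun h => (\int[p h x]_z \1_A z - \1_A x) / h).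
  by apply/funext => h; rewrite -[\int[_]_z _]/(ex (p h x) \1_A) ex_indic.
apply: H; exists 1 => z.
by rewrite indicE ger0_norm// lern1 leq_b1.
Qed.

Lemma jgen_self x : jgen (\1_[set x]) x = - rate x.
Proof.
rewrite /jgen /rate -sumrN; apply: eq_bigr => i _.
have [->|ki] := eqVneq (k x i) 0; first by rewrite mulr0 oppr0.
rewrite (@indic_in _ _ [set x] x)// indic_out ?sub0r ?mulN1r//.
exact: nx_neq.
Qed.

Lemma jgen_jump x i : k x i != 0 -> jgen (\1_[set nx x i]) x = k x i.
Proof.
move=> ki; rewrite /jgen (bigD1 i)//= big1 => [|j ji].
  rewrite addr0 indic_in// indic_out ?subr0 ?mul1r// => /esym.
  exact: nx_neq.
rewrite indic_out => [|h]; last first.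
  by case/eqP: ji; apply/esym; apply: (nx_inj ki).
rewrite indic_out ?subrr ?mul0r// => /esym.
exact: nx_neq.
Qed.

(* p_t(x,x) >= p_(t/n)(x,x)^n *)
Lemma pp_stay x t : 0 <= t -> 1 - t * rate x <= pp t x [set x].
Proof.
rewrite le_eqVlt => /predU1P[<-|t0].
  by rewrite pp0 indic_in//; lra.
have pw (h : R) n : 0 <= h -> pp h x [set x] ^+ n <= pp (n%:R * h) x [set x].
  move=> h0; elim: n => [|n IH]; first by rewrite mul0r pp0 indic_in.
  rewrite exprSr -natr1 mulrDl mul1r.
  have nh0 : 0 <= n%:R * h by rewrite mulr_ge0.
  have := @ppD_ge (n%:R * h) h x x [set x] nh0 h0; apply: le_trans.
  by apply: ler_wpM2r => //; case/andP: (pp01 h x [set x]).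
have := cvg_quotient t0 (@pp_gen [set x] x); rewrite jgen_self indic_in// mulrN => h.
have : - (t * rate x) <= pp t x [set x] - 1; last by lra.
apply: (cvgr_to_le h); apply: nearW => n.
have n0 : n.+1%:R != 0 :> R by rewrite pnatr_eq0.
have := pw (t / n.+1%:R) n.+1 (divr_ge0 (ltW t0) (ler0n _ _)).
have -> : n.+1%:R * (t / n.+1%:R) = t by rewrite mulrC divfK.
move=> h1; have := one_sub_exprn_le n.+1 (pp01 (t / n.+1%:R) x [set x]).
by lra.
Qed.

(** Among [n] short steps the chain stays at [x], jumps to [z] in one of them, then stays at [z].
    The factor [1 - lam * t] pays for both stays. *)
Lemma pp_jump x i t : 0 <= t -> k x i != 0 -> t * k x i * (1 - lam * t) <= pp t x [set nx x i].
Proof.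
rewrite le_eqVlt => /predU1P[<- _|t0 ki].
  by rewrite !mul0r; case/andP: (pp01 0 x [set nx x i]).
set z := nx x i; have xz : x <> z by move=> /esym; exact: nx_neq.
have lam0 : 0 <= lam by apply: le_trans (klam x); apply: sumr_ge0 => j _.
have stay y s : 0 <= s -> 1 - lam * s <= pp s y [set y].
  move=> s0; apply: le_trans (pp_stay y s0).
  by have := ler_wpM2l s0 (klam y); rewrite -/(rate y); lra.
have pw (h : R) n : 0 <= h -> n%:R * pp h x [set z] * (1 - lam * (n%:R * h)) <=
    pp (n%:R * h) x [set z].
  move=> h0; elim: n => [|n IH].
    by rewrite !mul0r; case/andP: (pp01 0 x [set z]).
  have /andP[b0 b1] := pp01 h x [set z].
  have /andP[c0 _] := pp01 (n.+1%:R * h) x [set z].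
  have n0 : 0 <= n%:R :> R by [].
  (* Multiplying the lower bounds requires nonnegative factors; otherwise the claim is trivial. *)
  have [neg|pos] := leP (1 - lam * (n.+1%:R * h)) 0.
    by apply: le_trans c0; rewrite mulr_ge0_le0// mulr_ge0.
  have nh0 : 0 <= n%:R * h by rewrite mulr_ge0.
  have := @ppD_ge2 (n%:R * h) h x x z [set z] nh0 h0 xz.
  have -> : n%:R * h + h = n.+1%:R * h by rewrite -natr1; ring.
  apply: le_trans.
  have s1 := stay x _ nh0; have s2 := stay z _ h0.
  have /andP[p0 _] := pp01 (n%:R * h) x [set z].
  move: pos IH s1; rewrite -natr1.
  move: (pp h x [set z]) (pp (n%:R * h) x [set z]) (pp (n%:R * h) x [set x])
    (pp h z [set z]) b0 b1 p0 s2 => b B a a' b0 b1 p0 s2.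
  move: (n%:R : R) n0 nh0 => m m0 mh0 pos IH s1.
  have lh : 0 <= lam * h by rewrite mulr_ge0.
  have lmh : 0 <= lam * (m * h) by rewrite mulr_ge0.
  have mb : 0 <= m * b by rewrite mulr_ge0.
  have e1 : (1 - lam * (m * h)) * b <= a * b by rewrite ler_wpM2r.
  have posm : 0 <= 1 - lam * (m * h) by lra.
  have posh : 0 <= 1 - lam * h by lra.
  have e2 : m * b * (1 - lam * (m * h)) * (1 - lam * h) <= B * a'.
    by apply: ler_pM => //; rewrite mulr_ge0.
  apply: le_trans (lerD e1 e2).
  have : 0 <= lam * h * b + (m * b) * ((lam * (m * h)) * (lam * h)).
    by rewrite addr_ge0 ?mulr_ge0.
  by lra.
have := cvg_quotient t0 (@pp_gen [set z] x).
rewrite (jgen_jump ki) indic_out; last by move=> /= h; exact: xz.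
move=> h.
have h' : n.+1%:R * (pp (t / n.+1%:R) x [set z] - 0) * (1 - lam * t) @[n --> \oo] -->
    t * k x i * (1 - lam * t) by apply: cvgM => //; exact: cvg_cst.
apply: (cvgr_to_le h'); apply: nearW => n /=.
have n0 : n.+1%:R != 0 :> R by rewrite pnatr_eq0.
have := pw (t / n.+1%:R) n.+1 (divr_ge0 (ltW t0) (ler0n _ _)).
have -> : n.+1%:R * (t / n.+1%:R) = t by rewrite mulrC divfK.
by rewrite subr0.
Qed.

Lemma pp_short_ge (f : S -> R) x t : (forall z, 0 <= f z <= 1) -> 0 <= t -> lam * t <= 1 ->
  f x + t * jgen f x - (lam * t) ^+ 2 <= ex (p t x) f.
Proof.
move=> f01 t0 lt1; have lam0 : 0 <= lam by apply: le_trans (klam x); apply: sumr_ge0 => j _.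
pose z (o : option 'I_M) := if o is Some i then nx x i else x.
pose Q (o : option 'I_M) := if o is Some i then k x i != 0 else true.
have := @ex_ge_points (p t x) (option 'I_M) Q z f 1 f01.
have zI o o' : Q o -> Q o' -> z o = z o' -> o = o'.
  case: o o' => [i|] [j|] //= Qi Qj.
  - by move=> /(nx_inj Qi) ->.
  - by move/(nx_neq Qi).
  - by move/esym/(nx_neq Qj).
move=> /(_ zI); apply: le_trans.
rewrite big_mkcond (bigD1 None)//= (reindex_omap Some id)/=; last by case.
rewrite (eq_bigl xpredT); last by move=> i /=; rewrite eqxx.
have fx0 : 0 <= f x by case/andP: (f01 x).
have e1 : f x * (1 - t * rate x) <= f x * pr (p t x) [set x] by rewrite ler_wpM2l ?pp_stay.
have e2 : \sum_i (t * (f (nx x i) * k x i) * (1 - lam * t)) <=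
    \sum_(i < M) (if k x i != 0 then f (nx x i) * pr (p t x) [set nx x i] else 0).
  apply: ler_sum => i _; case: ifP => [ki|/negbFE/eqP ->]; last by rewrite !mulr0 mul0r.
  have -> : t * (f (nx x i) * k x i) * (1 - lam * t) = f (nx x i) * (t * k x i * (1 - lam * t)) by ring.
  by rewrite ler_wpM2l ?pp_jump//; case/andP: (f01 (nx x i)).
apply: le_trans (lerD e1 e2).
have -> : \sum_i (t * (f (nx x i) * k x i) * (1 - lam * t)) =
   t * (1 - lam * t) * \sum_i f (nx x i) * k x i.
  by rewrite mulr_sumr; apply: eq_bigr => i _; ring.
have -> : jgen f x = \sum_i f (nx x i) * k x i - f x * rate x.
  by rewrite /rate mulr_sumr -sumrB; apply: eq_bigr => i _; ring.
have s1 : \sum_i f (nx x i) * k x i <= lam.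
  apply: le_trans (klam x); apply: ler_sum => i _.
  by rewrite ler_piMl//; case/andP: (f01 (nx x i)).
move: (\sum_i f (nx x i) * k x i) s1 => s s1.
have : t * (lam * t) * s <= t * (lam * t) * lam by rewrite ler_wpM2l ?mulr_ge0.
by move=> h; lra.
Qed.

(** The upper bound is the lower bound for [1 - f]. The error is uniform in [f] and [x], unlike the
    pointwise derivative in [semigroup_of], and this is what allows iteration. *)
Lemma pp_short (f : S -> R) x t : (forall z, 0 <= f z <= 1) -> 0 <= t -> lam * t <= 1 ->
  `|ex (p t x) f - (f x + t * jgen f x)| <= (lam * t) ^+ 2.
Proof.
move=> f01 t0 lt1; have h1 := pp_short_ge x f01 t0 lt1.
have g01 z : 0 <= 1 - f z <= 1 by have /andP[? ?] := f01 z; apply/andP; lra.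
have := pp_short_ge x g01 t0 lt1.
rewrite exB; [|exact: bmeas_cst|]; last first.
  by apply: (@bmS _ 1) => z; have /andP[? ?] := f01 z; rewrite ger0_norm.
rewrite ex_cst; have -> : jgen (fun z => 1 - f z) x = - jgen f x.
  by rewrite /jgen -sumrN; apply: eq_bigr => i _; ring.
by rewrite ler_norml => h2; apply/andP; lra.
Qed.

End Short.

(** Replacing [p] by [q] in one step of length [h] costs at most [2 * (lam * h)^2], and errors
    propagate without growth through a probability kernel. With [n] steps of length [t / n] the
    total is O([1 / n]). *)
Lemma semigroup_unique (p q : R -> S -> probability S R) :
  semigroup_of jgen p -> semigroup_of jgen q ->
  forall t x A, 0 <= t -> pr (p t x) A = pr (q t x) A.
Proof.
move=> Hp Hq t x A t0.
have lam0 : 0 <= lam by apply: le_trans (klam x); apply: sumr_ge0 => j _.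
have step (h : R) n y : 0 <= h -> lam * h <= 1 ->
    `|pr (p (n%:R * h) y) A - pr (q (n%:R * h) y) A| <= n%:R * (2 * (lam * h) ^+ 2).
  move=> h0 lh1; elim: n y => [|n IH] y.
    by rewrite !mul0r (pp0 Hp) (pp0 Hq) subrr normr0.
  have -> : n.+1%:R * h = h + n%:R * h by rewrite -natr1; ring.
  have nh0 : 0 <= n%:R * h by rewrite mulr_ge0.
  rewrite (ppD Hp) ?(ppD Hq)//.
  set f := fun z => pr (p (n%:R * h) z) A; set g := fun z => pr (q (n%:R * h) z) A.
  have f01 z : 0 <= f z <= 1 by exact: pp01.
  have g01 z : 0 <= g z <= 1 by exact: pp01.
  have bf : bmeas f by apply: (@bmS _ 1) => z; have /andP[? ?] := f01 z; rewrite ger0_norm.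
  have bg : bmeas g by apply: (@bmS _ 1) => z; have /andP[? ?] := g01 z; rewrite ger0_norm.
  have e1 : `|ex (p h y) f - ex (p h y) g| <= n%:R * (2 * (lam * h) ^+ 2).
    by rewrite -exB//; apply: ex_norm_le; [exact: bmeasB|move=> z; exact: IH].
  have e2 := pp_short Hp y g01 h0 lh1; have e3 := pp_short Hq y g01 h0 lh1.
  move: e1 e2 e3; rewrite !ler_norml -natr1 => /andP[? ?] /andP[? ?] /andP[? ?].
  by apply/andP; lra.
apply/eqP; rewrite -subr_eq0 -normr_le0.
have : (2 * (lam * t) ^+ 2) * n.+1%:R^-1 @[n --> \oo] --> (2 * (lam * t) ^+ 2) * (0 : R).
  by apply: cvgM; [exact: cvg_cst|exact: cvg_harmonic].
rewrite mulr0 => h; apply: (cvgr_to_ge h).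
have [n0 hn0] : exists n0 : nat, lam * t <= n0%:R.
  by exists (Num.trunc (lam * t)).+1; rewrite ltW//; have /andP[] := truncn_itv (mulr_ge0 lam0 t0).
exists n0 => // n /= n0n.
have nn : n.+1%:R != 0 :> R by rewrite pnatr_eq0.
have np : 0 < n.+1%:R :> R by rewrite ltr0n.
have h0 : 0 <= t / n.+1%:R by rewrite divr_ge0.
have lh : lam * (t / n.+1%:R) <= 1.
  rewrite mulrA ler_pdivrMr// mul1r (le_trans hn0)// ler_nat.
  exact: leq_trans n0n _.
have := step _ n.+1 x h0 lh; rewrite [n.+1%:R * _]mulrC divfK// => /le_trans; apply.
rewrite le_eqVlt; apply/orP; left; apply/eqP.
by move: (n.+1%:R : R) nn => m m0; field.
Qed.

End JumpSemigroup.

(** * Sampling cadlag paths *)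

Section Grid.
Context {R : realType}.
Implicit Types (t u : R) (n : nat).

(* mesh 1/(n+1), frozen at time n+1 *)
Definition grid n t : R := (minn (Num.trunc (n.+1%:R * t)) (n.+1 * n.+1))%:R / n.+1%:R.

Let n1 n : 0 < n.+1%:R :> R. Proof. by rewrite ltr0n. Qed.

Lemma grid_ge0 n t : 0 <= grid n t.
Proof. by rewrite divr_ge0. Qed.

Lemma grid_le n t : 0 <= t -> grid n t <= t.
Proof.
move=> t0; rewrite ler_pdivrMr// [t * _]mulrC.
have /andP[h _] := truncn_itv (mulr_ge0 (ltW (n1 n)) t0).
by apply: le_trans h; rewrite ler_nat geq_minl.
Qed.

Lemma grid_gt n t : 0 <= t -> t <= n.+1%:R -> t - n.+1%:R^-1 < grid n t.
Proof.
move=> t0 tn; have m0 := n1 n.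
rewrite /grid ltr_pdivlMr// mulrBl mulVf ?gt_eqF// ltrBlDr [t * _]mulrC.
have /andP[_ h] := truncn_itv (mulr_ge0 (ltW m0) t0).
rewrite natr1; rewrite /minn; case: ifP => _; first exact: h.
apply: (@le_lt_trans _ _ (n.+1 * n.+1)%:R); last by rewrite ltr_nat.
by rewrite natrM ler_pM2l.
Qed.

Lemma grid_ge_frac n (j : nat) t : 0 <= t -> (j <= n.+1 * n.+1)%N -> j%:R / n.+1%:R <= t ->
  j%:R / n.+1%:R <= grid n t.
Proof.
move=> t0 jn jt; rewrite /grid ler_pM2r ?invr_gt0// ler_nat leq_min jn andbT.
rewrite ler_pdivrMr// in jt; rewrite -ltnS -(ltr_nat R).
have /andP[_ h] := truncn_itv (mulr_ge0 (ltW (n1 n)) t0).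
by apply: le_lt_trans h; rewrite mulrC.
Qed.

Lemma grid_lt_frac n (j : nat) t : 0 <= t -> t < j.+1%:R / n.+1%:R -> grid n t <= j%:R / n.+1%:R.
Proof.
move=> t0 tj; rewrite /grid ler_pM2r ?invr_gt0// ler_nat.
rewrite ltr_pdivlMr// mulrC in tj; rewrite geq_min -ltnS -(ltr_nat R).
have /andP[h _] := truncn_itv (mulr_ge0 (ltW (n1 n)) t0).
by rewrite (le_lt_trans h).
Qed.

Lemma grid_eq n (j : nat) t : 0 <= t -> j%:R <= n.+1%:R * t < j.+1%:R ->
  grid n t = (minn j (n.+1 * n.+1))%:R / n.+1%:R.
Proof. by move=> t0 h; rewrite /grid (truncn_def h). Qed.

Lemma ceil_frac n t : 0 < t -> exists j : nat, j%:R < n.+1%:R * t <= j.+1%:R.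
Proof.
move=> t0; have mt : 0 < n.+1%:R * t by rewrite mulr_gt0.
have /andP[h1 h2] := truncn_itv (ltW mt); set j := Num.trunc _ in h1 h2.
move: h1; rewrite le_eqVlt => /predU1P[e|h1]; last by exists j; rewrite h1 ltW.
case: j e h2 => [|j] e h2; first by rewrite -e ltxx in mt.
by exists j; rewrite -e lexx andbT ltr_nat.
Qed.

Context {E : pseudoMetricType R}.

Lemma grid_cadlag n (f : R -> E) : cadlag (fun t => f (grid n t)).
Proof.
move=> t t0; have m0 := n1 n; split.
  apply: cvg_near_cst.
  have /andP[h1 h2] := truncn_itv (mulr_ge0 (ltW m0) t0); set j := Num.trunc _ in h1 h2.
  have e0 : 0 < j.+1%:R / n.+1%:R - t by rewrite subr_gt0 ltr_pdivlMr// mulrC.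
  exists (j.+1%:R / n.+1%:R - t) => //= u; rewrite /ball_ /= ltr_distl => /andP[ue _] tu.
  rewrite (@grid_eq n j t)// ?h1// (@grid_eq n j u) ?(le_trans t0 (ltW tu))//.
  apply/andP; split; first by apply: le_trans h1 _; rewrite ler_pM2l// ltW.
  have gen (z : R) : u - (z - t) < t -> u < z by lra.
  by rewrite mulrC -ltr_pdivlMr//; exact: gen ue.
move=> tp; have [j /andP[j1 j2]] := ceil_frac n tp.
exists (f ((minn j (n.+1 * n.+1))%:R / n.+1%:R)); apply: cvg_near_cst.
have e0 : 0 < t - j%:R / n.+1%:R by rewrite subr_gt0 ltr_pdivrMr// mulrC.
exists (t - j%:R / n.+1%:R) => //= u; rewrite /ball_ /= ltr_distl => /andP[ue ue'] ut.
have gen (z : R) : t < u + (t - z) -> z < u by lra.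
have ju : j%:R / n.+1%:R < u by exact: gen ue'.
have u0 : 0 <= u by rewrite (le_trans _ (ltW ju))// divr_ge0.
rewrite (@grid_eq n j u)//; apply/andP; split.
  by rewrite mulrC -ler_pdivrMr// ltW.
by apply: lt_le_trans j2; rewrite ltr_pM2l.
Qed.

Definition sampled n (f : skorokhod R E) : skorokhod R E := Skorokhod (@grid_cadlag n f).

End Grid.

(** * Piecewise linear time changes *)

Section Bump.
Context {R : realType}.
Variables (a s v c : R).

(* piecewise linear, the identity outside [a, c], maps s to v *)
Definition bump (s v t : R) : R :=
  if t <= a then t else
  if t <= s then a + (t - a) * ((v - a) / (s - a)) else
  if t <= c then c - (c - t) * ((c - v) / (c - s)) else t.

Lemma bump_le t : t <= a -> bump s v t = t.
Proof. by rewrite /bump => ->. Qed.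

Lemma bump_ge t : a < s -> s < c -> c <= t -> bump s v t = t.
Proof.
move=> as_ sc ct; have sa : s < t by apply: lt_le_trans ct.
have ta : a < t by apply: lt_trans sa.
rewrite /bump leNgt ta/= leNgt sa/=; case: leP => // tc.
have -> : c = t by apply/eqP; rewrite eq_le ct.
by rewrite subrr mul0r subr0.
Qed.

(** Names the two slopes together with their defining equations, so that the later estimates involve
    no division. *)
Lemma bump_spec : a < s -> a < v -> s < c -> v < c -> exists p q : R, [/\ 0 < p, 0 < q, p * (s - a) = v - a, q * (c - s) = c - v &
  forall t, bump s v t = if t <= a then t else if t <= s then a + (t - a) * p else
    if t <= c then c - (c - t) * q else t].
Proof.
move=> as_ av sc vc; exists ((v - a) / (s - a)), ((c - v) / (c - s)); split => //.
- by rewrite divr_gt0 ?subr_gt0.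
- by rewrite divr_gt0 ?subr_gt0.
- by rewrite divfK// gt_eqF// subr_gt0.
- by rewrite divfK// gt_eqF// subr_gt0.
Qed.

Lemma bump_at : a < s -> bump s v s = v.
Proof.
by move=> as_; rewrite /bump leNgt as_/= lexx mulrC divfK ?gt_eqF ?subr_gt0// addrC subrK.
Qed.

Lemma bump_inc t u : a < s -> a < v -> s < c -> v < c -> t < u -> bump s v t < bump s v u.
Proof.
move=> as_ av sc vc tu; have [p [q [p0 q0 e1 e2 E]]] := bump_spec as_ av sc vc; rewrite !E.
have [ta|ta] := leP t a; have [ua|ua] := leP u a; rewrite ?ta ?ua//=.
- have [us|us] := leP u s.
    have : 0 < (u - a) * p by rewrite mulr_gt0// subr_gt0.
    by lra.
  have [uc|uc] := leP u c; last by lra.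
  have : (c - u) * q < q * (c - s) by rewrite [ltRHS]mulrC ltr_pM2r//; lra.
  by rewrite e2; lra.
- by lra.
- have [ts|ts] := leP t s; have [us|us] := leP u s.
  + by rewrite ltrD2l ltr_pM2r//; lra.
  + have e3 : (t - a) * p <= v - a by rewrite -e1 [leRHS]mulrC ler_pM2r//; lra.
    have [uc|uc] := leP u c; last by lra.
    have : (c - u) * q < q * (c - s) by rewrite [ltRHS]mulrC ltr_pM2r//; lra.
    by rewrite e2; lra.
  + by lra.
  + have [tc|tc] := leP t c; have [uc|uc] := leP u c; try lra.
    * have : (c - u) * q < (c - t) * q by rewrite ltr_pM2r//; lra.
      by lra.
    * have : 0 <= (c - t) * q by rewrite mulr_ge0 ?(ltW q0)//; lra.
      by lra.
Qed.

Lemma bump_dist t : a < s -> a < v -> s < c -> v < c -> s <= v -> `|bump s v t - t| <= v - s.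
Proof.
move=> as_ av sc vc sv; have [p [q [p0 q0 e1 e2 ->]]] := bump_spec as_ av sc vc.
have [ta|ta] := leP t a; first by rewrite subrr normr0; lra.
have p1 : 1 <= p by rewrite -(@ler_pM2r _ (s - a)) ?subr_gt0// e1; lra.
have q1 : q <= 1 by rewrite -(@ler_pM2r _ (c - s)) ?subr_gt0// e2; lra.
have [ts|ts] := leP t s.
  have h1 : 0 <= (t - a) * (p - 1) by rewrite mulr_ge0//; lra.
  have h2 : (t - a) * (p - 1) <= (s - a) * (p - 1) by rewrite ler_wpM2r//; lra.
  by rewrite ger0_norm; lra.
have [tc|tc] := leP t c; last by rewrite subrr normr0; lra.
have h1 : 0 <= (c - t) * (1 - q) by rewrite mulr_ge0//; lra.
have h2 : (c - t) * (1 - q) <= (c - s) * (1 - q) by rewrite ler_wpM2r//; lra.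
by rewrite ger0_norm; lra.
Qed.

End Bump.

(** The inverse is the bump with [s] and [v] exchanged; it provides the surjectivity of a time
    change. *)
Lemma bumpK {R : realType} (a s v c : R) : a < s -> a < v -> s < c -> v < c ->
  forall u, bump a c s v (bump a c v s u) = u.
Proof.
move=> as_ av sc vc u.
have [p [q [p0 q0 e1 e2 E]]] := bump_spec as_ av sc vc.
have [ua|ua] := leP u a; first by rewrite !bump_le.
have [uc|cu] := leP c u; first by rewrite (bump_ge _ av vc uc) (bump_ge _ as_ sc uc).
have [uv|uv] := leP u v.
  have -> : bump a c v s u = a + (u - a) / p.
    rewrite /bump leNgt ua/= uv; congr (_ + _ * _).
    have : s - a = (v - a) / p by rewrite -e1; field; rewrite gt_eqF.
    by move=> ->; field; rewrite !gt_eqF// subr_gt0.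
  rewrite E; have h : 0 < (u - a) / p by rewrite divr_gt0 ?subr_gt0.
  have h2 : (u - a) / p <= s - a by rewrite ler_pdivrMr// mulrC e1; lra.
  rewrite ifN -?ltNge; last by lra.
  rewrite ifT; last by lra.
  by rewrite addrAC subrr add0r divfK ?gt_eqF//; lra.
have -> : bump a c v s u = c - (c - u) / q.
  rewrite /bump leNgt ua/= leNgt uv/= (ltW cu); congr (_ - _ * _).
  have : c - s = (c - v) / q by rewrite -e2; field; rewrite gt_eqF.
  by move=> ->; field; rewrite !gt_eqF// subr_gt0.
rewrite E; have h : 0 < (c - u) / q by rewrite divr_gt0 ?subr_gt0.
have h2 : (c - u) / q < c - s by rewrite ltr_pdivrMr// mulrC e2; lra.
rewrite ifN -?ltNge; last by lra.
rewrite ifN -?ltNge; last by lra.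
rewrite ifT; last by lra.
by rewrite opprB addrCA subrr addr0 divfK ?gt_eqF//; lra.
Qed.

Lemma bump_time_change {R : realType} (a s v c : R) : 0 <= a -> a < s -> a < v -> s < c -> v < c ->
  time_change (bump a c s v).
Proof.
move=> a0 as_ av sc vc; split.
- by rewrite bump_le.
- by move=> t u _; exact: bump_inc.
- move=> u u0; exists (bump a c v s u); last exact: bumpK.
  have [ua|au] := leP u a; first by rewrite bump_le.
  by have := bump_inc av as_ vc sc au; rewrite [bump _ _ _ _ a]bump_le//; lra.
Qed.

(** * Cadlag paths in a discrete space as step functions *)

Section StepFunctions.
Context {R : realType} {E : pseudoMetricType R}.
Hypothesis discE : forall x : E, nbhs x [set x].
Implicit Types (f : R -> E).

(** [f] is constant on each of finitely many consecutive intervals covering [[0, T[]. The inductive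
    form lets a time change be built jump by jump. *)
Inductive step_upto f : R -> Prop :=
| Step0 T of 0 < T & (forall t, 0 <= t < T -> f t = f 0) : step_upto f T
| StepS s T of step_upto f s & s < T & (forall t, s <= t < T -> f t = f s) : step_upto f T.

Lemma step_upto_le f T T' : step_upto f T -> 0 < T' -> T' <= T -> step_upto f T'.
Proof.
move=> h; elim: h T' => [{}T T0 h|s {}T hs IH sT h] T' T'0 T'T.
  by apply: Step0 => // t /andP[t0 tT]; apply: h; rewrite t0 (lt_le_trans tT).
have [T's|sT'] := leP T' s; first exact: IH.
by apply: (StepS hs sT') => t /andP[st tT]; apply: h; rewrite st (lt_le_trans tT).
Qed.

(** At the supremum [s] of the reachable times, the left limit makes [f] constant just before [s],
    so [s] is reached, and right continuity then goes beyond it. *)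
Lemma cadlag_step_upto f T : cadlag f -> 0 < T -> step_upto f T.
Proof.
move=> cf T0; apply: contrapT => nT.
pose B := [set u | 0 < u /\ step_upto f u].
have BT u : B u -> u <= T.
  move=> [u0 hu]; rewrite leNgt; apply/negP => Tu.
  by apply: nT; apply: (step_upto_le hu) => //; exact: ltW.
have B0 : exists u, B u.
  have [e e0 he] := cadlag_right discE cf (lexx 0).
  by exists e; split => //; apply: Step0 => // t /andP[t0 te]; apply: he; rewrite t0 add0r.
have hB : has_sup B by split => //; exists T.
have [b Bb] := B0; pose s := sup B.
have bs : b <= s by apply: sup_upper_bound.
have s0 : 0 < s by apply: lt_le_trans bs; case: Bb.
have [e e0 [l hl]] := cadlag_left discE cf s0.
have [t [t0 ht] st] := sup_adherent e0 hB.
have ts : t <= s by apply: sup_upper_bound => //; split.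
(* [t] may be equal to [s]. The midpoint [t'] lies strictly below [s] and still where [f] takes its
   left limit. *)
pose m := Num.max (s - e) 0; pose t' := (m + t) / 2.
have mt : m < t by rewrite gt_max st t0.
have m0 : 0 <= m by rewrite le_max lexx orbT.
have ms : s - e <= m by rewrite le_max lexx.
have t't : t' < t by rewrite /t'; lra.
have mt' : m < t' by rewrite /t'; lra.
have ht' : step_upto f t' by apply: (step_upto_le ht); lra.
have hs : step_upto f s.
  apply: (StepS ht'); first by lra.
  by move=> u /andP[u1 u2]; rewrite !hl//; apply/andP; split; lra.
have [e' e'0 he'] := cadlag_right discE cf (ltW s0).
have : B (s + e').
  split; first by rewrite addr_gt0.
  by apply: (StepS hs); [rewrite ltrDl|].
by move/(sup_upper_bound hB); rewrite -/s; lra.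
Qed.

(* The sampled path jumps at the first grid point after a jump time s of f; the time
   change bump moves s to that point. *)
Lemma sampled_match f T : step_upto f T -> exists tau, [/\ 0 <= tau, tau < T,
  (forall t, tau <= t < T -> f t = f tau) &
  forall e, 0 < e -> exists n0 : nat, forall n, (n0 <= n)%N -> exists l, [/\ time_change l,
    (forall t, 0 <= t -> `|l t - t| < e), (forall t, tau <= t -> l t = t) &
    forall t, 0 <= t < T -> f t = f (grid n (l t))]].
Proof.
elim => [{}T T0 h|s {}T hs [ta [ta0 tas hta IH]] sT h].
  exists 0; split => // e e0; exists 0%N => n _; exists id; split => //.
  - exact: time_change_id.
  - by move=> t _; rewrite subrr normr0.
  - move=> t /andP[t0 tT]; rewrite !h ?t0//.
    by rewrite grid_ge0 (le_lt_trans (grid_le n t0)).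
have s0 : 0 < s by exact: lt_le_trans (le_lt_trans ta0 tas) _.
(* From [ta] on the earlier time change is the identity, so a bump supported in [[a, c]] does not
   interfere with it. After [c] the composite is the identity again, which makes [c] the new
   [tau]. *)
pose a := (ta + s) / 2; pose c := (s + T) / 2.
have [taa as_ sc cT] : [/\ ta < a, a < s, s < c & c < T] by rewrite /a /c; split; lra.
exists c; split => //.
- by lra.
- by move=> t /andP[t1 t2]; rewrite !h//; apply/andP; split; lra.
move=> e e0; have e20 : 0 < e / 2 by lra.
have [n1 hn1] := IH _ e20.
(* A mesh below [mn] moves time by less than [e / 2], puts the next grid point [v] before [c], and
   keeps the grid point preceding any time after [a] later than [ta]. *)
pose mn := Num.min (e / 2) (Num.min (c - s) (a - ta)).
have mn0 : 0 < mn by rewrite !lt_min e20 !subr_gt0 sc.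
have [n2 hn2] : exists n2 : nat, forall n, (n2 <= n)%N -> n.+1%:R^-1 < mn.
  by have /cvgr_lt/(_ _ mn0)[n2 _ hn2] := @cvg_harmonic R; exists n2 => n /hn2.
(* Puts [T] before the time [n + 1] at which the grid is frozen. *)
pose n3 := (Num.trunc T).+1.
have Tn3 : T < n3%:R.
  have T0 : 0 <= T by apply: ltW; apply: lt_trans sT.
  by have /andP[] := truncn_itv T0.
exists (maxn n1 (maxn n2 n3)) => n; rewrite !geq_max => /andP[nn1 /andP[nn2 nn3]].
have [l' [tl' dl' il' fl']] := hn1 n nn1.
have [j /andP[j1 j2]] := ceil_frac n s0.
have m0 : 0 < n.+1%:R :> R by rewrite ltr0n.
have Tn : T < n.+1%:R by apply: lt_trans Tn3 _; rewrite ltr_nat ltnS.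
have [im imE] : exists im : R, im = n.+1%:R^-1 by exists n.+1%:R^-1.
have := hn2 n nn2; rewrite !lt_min -imE => /andP[me /andP[mc ma]].
have [v vE] : exists v : R, v = j.+1%:R / n.+1%:R by exists (j.+1%:R / n.+1%:R).
have sv : s <= v by rewrite vE ler_pdivlMr// mulrC.
have js : j%:R / n.+1%:R < s by rewrite ltr_pdivrMr// mulrC.
have vs : v < s + im.
  by rewrite vE imE -natr1 mulrDl mul1r ltrD2r.
have av : a < v by exact: lt_le_trans sv.
have vc : v < c by lra.
have a0 : 0 <= a by lra.
have b_inc := bump_inc as_ av sc vc.
have b_time := bump_time_change a0 as_ av sc vc.
exists (bump a c s v \o l'); split.
- exact: time_change_comp.
- move=> t t0 /=; rewrite -(subrKA (l' t)); apply: (le_lt_trans (ler_normD _ _)).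
  have h1 := bump_dist (l' t) as_ av sc vc sv; have h2 := dl' t t0.
  by lra.
- by move=> t ct /=; rewrite il' ?bump_ge//; lra.
move=> t /andP[t0 tT] /=.
have [ts|st] := ltP t s.
  have [l'a|al'] := leP (l' t) a; first by rewrite bump_le// fl'// t0.
  have at_ : a < t.
    rewrite ltNge; apply/negP; rewrite le_eqVlt => /predU1P[ta'|ta'].
      by move: al'; rewrite ta' il' ?ltxx// ltW.
    have [_ inc _] := tl'; have := inc t a t0 ta'.
    by rewrite [l' a]il' ?(ltW taa)//; lra.
  have l't : l' t = t by apply: il'; lra.
  rewrite l't; have b1 : bump a c s v t < v by rewrite -[ltRHS](bump_at v c as_) b_inc.
  have b2 : a < bump a c s v t by rewrite -[ltLHS](@bump_le _ a s v c a)// b_inc.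
  have b0 : 0 <= bump a c s v t by lra.
  have g1 : grid n (bump a c s v t) < s by apply: le_lt_trans js; apply: grid_lt_frac => //; rewrite -vE.
  have g2 : bump a c s v t - im < grid n (bump a c s v t).
    by rewrite imE; apply: grid_gt => //; lra.
  rewrite (hta t); last by apply/andP; split; lra.
  by rewrite (hta (grid _ _))//; apply/andP; split; lra.
have l't : l' t = t by apply: il'; lra.
rewrite l't; have bv : v <= bump a c s v t.
  move: st; rewrite le_eqVlt => /predU1P[<-|st]; first by rewrite bump_at.
  by rewrite -[leLHS](bump_at v c as_) ltW// b_inc.
have bT : bump a c s v t < T.
  have [ct|tc] := leP c t; first by rewrite bump_ge.
  by rewrite (lt_trans _ cT)// -[ltRHS](@bump_ge _ a s v c c)// b_inc.
have b0 : 0 <= bump a c s v t by lra.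
have g1 : v <= grid n (bump a c s v t).
  have jn : (j.+1 <= n.+1 * n.+1)%N.
    by rewrite -(ler_nat R) natrM -ler_pdivrMr// -vE; lra.
  by rewrite vE; apply: grid_ge_frac => //; rewrite -vE.
have g2 := grid_le n b0.
by rewrite !h//; apply/andP; split; lra.
Qed.

Lemma sampled_cvg (f : skorokhod R E) : sampled n f @[n --> \oo] --> f.
Proof.
move=> A [m [e e0 mA]].
pose T := Num.max m 0 + 1.
have T0 : 0 < T by rewrite ltr_wpDl// le_max lexx orbT.
have mT : m < T by rewrite /T ltr_pwDr// le_max lexx.
have [tau [_ _ _ /(_ e e0)[n0 hn0]]] := sampled_match (cadlag_step_upto (path_cadlag f) T0).
exists n0 => // n /= /hn0 [l [tl dl _ fl]]; apply: mA; exists l => //; split => // t /andP[t0 tm].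
by rewrite /= fl; [exact: ballxx|rewrite t0 (le_lt_trans tm)].
Qed.

End StepFunctions.

(** * Uniqueness in law *)

Section LawOnNat.
Context {R : realType}.

Lemma ex_nat_cvg {d} {T : measurableType d} (P : probability T R) (c : T -> nat)
    (Psi : nat -> R) (M : R) : measurable_fun setT c -> (forall k, `|Psi k| <= M) ->
  \sum_(0 <= k < K) Psi k * pr P (c @^-1` [set k]) @[K --> \oo] --> ex P (Psi \o c).
Proof.
move=> mc hM; have mk k : measurable (c @^-1` [set k]) by rewrite -[_ @^-1` _]setTI; exact: mc.
pose f K : T -> R := fun w => \sum_(0 <= k < K) Psi k * \1_(c @^-1` [set k]) w.
have fE K w : f K w = if (c w < K)%N then Psi (c w) else 0.
  rewrite /f big_mkord; case: ltnP => cK.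
    rewrite (bigD1 (Ordinal cK))//= indic_in// mulr1 big1 ?addr0// => k kc.
    rewrite indic_out ?mulr0//= => e; case/eqP: kc; exact/val_inj.
  rewrite big1// => k _; rewrite indic_out ?mulr0//= => e.
  by move: (ltn_ord k); rewrite -e ltnNge cK.
have bt k : bmeas (fun w => Psi k * \1_(c @^-1` [set k]) w : R).
  by apply: bmeasZ; exact: bmeas_indic.
have -> : (fun K => \sum_(0 <= k < K) Psi k * pr P (c @^-1` [set k])) = (fun K => ex P (f K)).
  apply/funext => K; rewrite /f ex_sum//; apply: eq_bigr => k _.
  by rewrite exZ ?ex_indic//; exact: bmeas_indic.
apply: (@ex_cvg _ _ _ P f _ M setT) => //.
- by move=> K; apply: (bmeas_sum _ bt).1.
- by apply: measurableT_comp => //.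
- by move=> K w; rewrite fE; case: ifP => _ //; rewrite normr0 (le_trans _ (hM 0%N)).
- by move=> w; exact: hM.
- exact: prT.
move=> w _; apply: cvg_near_cst; exists (c w).+1 => // K /= cK.
by rewrite fE ifT.
Qed.

Lemma ex_nat_eq {d d'} {T : measurableType d} {T' : measurableType d'}
    (P : probability T R) (P' : probability T' R) (c : T -> nat) (c' : T' -> nat)
    (Psi : nat -> R) (M : R) : measurable_fun setT c -> measurable_fun setT c' ->
  (forall k, `|Psi k| <= M) ->
  (forall k, pr P (c @^-1` [set k]) = pr P' (c' @^-1` [set k])) ->
  ex P (Psi \o c) = ex P' (Psi \o c').
Proof.
move=> mc mc' hM e; have h := ex_nat_cvg (P := P) mc hM; have h' := ex_nat_cvg (P := P') mc' hM.
apply: (cvg_unique _ h) => //.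
rewrite (_ : (fun K => _) = (fun K => \sum_(0 <= k < K) Psi k * pr P' (c' @^-1` [set k])))//.
by apply/funext => K; apply: eq_bigr => k _; rewrite e.
Qed.

End LawOnNat.

Section WeylChains.
Context {R : realType} {N : nat}.
Implicit Types (r : 'rV[int]_N -> 'I_N -> R).

(** What is required of the rates for uniqueness and for the construction with a clock of rate [N].
    These properties pass to pointwise limits, so the two limit chains inherit them from the myopic
    walks. *)
Definition weyl_rates r : Prop :=
  [/\ forall x i, in_weyl x -> 0 <= r x i,
      forall x i, in_weyl x -> ~~ in_weyl (x + evec i) -> r x i = 0 &
      forall x, in_weyl x -> \sum_i r x i <= N%:R].

(** A jump out of the chamber is replaced by no move; under [weyl_rates] its rate is 0. *)
Definition wnext (x : weylZ N) (i : 'I_N) : weylZ N := insubd x (val x + evec i).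

Definition wrate r (x : weylZ N) (i : 'I_N) : R := r (val x) i.

Lemma mW (A : set (weylZ N)) : measurable A. Proof. by []. Qed.

Lemma nbhsW (x : weylZ N) : nbhs x [set x].
Proof. by rewrite nbhs_principalE; exact/principal_filterP. Qed.

Lemma jump_generatorE r : weyl_rates r -> jump_generator r = jgen wnext (wrate r).
Proof.
move=> [_ r0 _]; apply/funext => F; apply/funext => x; apply: eq_bigr => i _.
rewrite /extend /wnext /insubd /wrate.
case: insubP => [z zW zE|xW] //=.
by rewrite r0 ?mulr0//; exact: (valP x).
Qed.

Lemma wnext_neq r x i : weyl_rates r -> wrate r x i != 0 -> wnext x i <> x.
Proof.
move=> [_ r0 _] ri; rewrite /wnext /insubd; case: insubP => [z zW zE|xW]; last first.
  by rewrite /wrate r0 ?eqxx// in ri; exact: (valP x).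
move=> /= zx; move: zE; rewrite zx => /rowP/(_ i)/eqP; rewrite !mxE/= eqxx => /eqP.
by move=> /=; lia.
Qed.

Lemma wnext_inj r x i j : weyl_rates r -> wrate r x i != 0 -> wnext x i = wnext x j -> i = j.
Proof.
move=> hr ri; have := wnext_neq hr ri; rewrite /wnext /insubd.
case: insubP => [z zW zE|] //= zx; case: insubP => [z' z'W z'E|_ zx'] //= zz'.
have : evec i = evec j.
  by move: zE; rewrite zz' z'E => /addrI.
move=> /rowP/(_ i); rewrite !mxE !eqxx/=.
by have [//|ij] := eqVneq i j.
Qed.

Section Fdd.
Context {d} {T : measurableType d} (P : probability T R) (X : T -> skorokhod R (weylZ N)).
Variables (r : 'rV[int]_N -> 'I_N -> R) (Hr : weyl_rates r) (y : weylZ N).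

Lemma fdd_markov (p : R -> weylZ N -> probability (weylZ N) R) (dt : R) (x : nat -> weylZ N) m :
  0 < dt ->
  (forall t : R, 0 <= t -> measurable_fun setT (fun w => X w t)) ->
  P ((fun w => X w 0) @^-1` [set y]) = 1%E ->
  (forall (s t : R) A B, 0 <= s <= t -> history (fun t w => X w t) [set u | 0 <= u <= s] A ->
     measurable B ->
     (P (A `&` (fun w => X w t) @^-1` B) = \int[P]_(w in A) p (t - s)%R (X w s) B)%E) ->
  pr P [set w | forall j, (j <= m)%N -> X w (j%:R * dt) = x j] =
  (y == x 0%N)%:R * \prod_(j < m) pr (p dt (x j)) [set x j.+1].
Proof.
move=> dt0 mX X0 HX.
pose E m : set T := [set w | forall j, (j <= m)%N -> X w (j%:R * dt) = x j].
have jt j : 0 <= j%:R * dt by rewrite mulr_ge0// ltW.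
have mpre t B : 0 <= t -> measurable ((fun w => X w t) @^-1` B).
  by move=> t0; rewrite -[_ @^-1` _]setTI; apply: mX.
have ES n : E n.+1 = E n `&` (fun w => X w (n.+1%:R * dt)) @^-1` [set x n.+1].
  apply/seteqP; split => w /=.
    by move=> h; split; [move=> j jn; apply: h; exact: leqW|exact: h].
  by move=> [h h'] j; rewrite leq_eqVlt => /predU1P[->//|]; exact: h.
have E0 : E 0%N = (fun w => X w 0) @^-1` [set x 0%N].
  apply/seteqP; split => w /=; first by move=> /(_ 0%N isT); rewrite mul0r.
  by move=> h j; rewrite leqn0 => /eqP ->; rewrite mul0r.
have hE n : history (fun t w => X w t) [set u | 0 <= u <= n%:R * dt] (E n).
  elim: n => [|n IH].
    by rewrite E0; apply: history_pre => //=; rewrite mul0r lexx.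
  rewrite ES; apply: history_setI; last by apply: history_pre => //=; rewrite jt/=.
  apply: history_sub IH => u /= /andP[-> h]; apply: (le_trans h).
  by rewrite ler_pM2r// ler_nat.
have mE n : measurable (E n) by apply: history_measurable (hE n) => u /andP[u0 _]; exact: mX.
rewrite -/(E m); elim: m => [|m IH].
  rewrite big_ord0 mulr1 E0; case: eqP => [<-|yx]; first by rewrite /pr X0.
  apply: (@pr_null_sub _ _ _ P _ (~` ((fun w => X w 0) @^-1` [set y]))).
  - exact: mpre.
  - by apply: measurableC; exact: mpre.
  - by move=> w /= -> /esym.
  - by rewrite prC; [rewrite /pr X0 subrr|exact: mpre].
rewrite big_ord_recr/= mulrA -IH ES.
have st : 0 <= m%:R * dt <= m.+1%:R * dt by rewrite jt ler_pM2r// ler_nat leqnSn.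
rewrite {1}/pr (HX _ _ _ _ st (hE m) (mW [set x m.+1])).
have -> : m.+1%:R * dt - m%:R * dt = dt by rewrite -natr1; ring.
rewrite (eq_integral (fun=> p dt (x m) [set x m.+1])); last first.
  by move=> w /set_mem h; rewrite h.
rewrite integral_cst// fineM ?fin_num_measure//.
by rewrite mulrC.
Qed.

End Fdd.

Section Sampling.
Context {d} {T : measurableType d} (P : probability T R) (X : T -> skorokhod R (weylZ N)).
Hypothesis mX : forall t : R, 0 <= t -> measurable_fun setT (fun w => X w t).

Let ncell n := (n.+1 * n.+1)%N.

(** Every function on [nat] is measurable, so any functional of the sampled path becomes a random
    variable. The indices [0, .., (n+1)^2] cover all values of [grid n]. *)
Definition sample_code n (w : T) : nat :=
  pickle [seq X w (j%:R / n.+1%:R) | j <- iota 0 (ncell n).+1].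

Lemma sample_code_pre n k : sample_code n @^-1` [set k] =
  if pickle_inv k is Some s then
    if size s == (ncell n).+1 then
      [set w | forall j, (j <= ncell n)%N ->
         X w (j%:R / n.+1%:R) = nth (point : weylZ N) (s : seq (weylZ N)) j]
    else set0
  else set0.
Proof.
have mapE w (s : seq (weylZ N)) : [seq X w (j%:R / n.+1%:R) | j <- iota 0 (ncell n).+1] = s <->
   size s = (ncell n).+1 /\ forall j, (j <= ncell n)%N ->
     X w (j%:R / n.+1%:R) = nth (point : weylZ N) s j.
  split=> [<-|[ss h]].
    split; first by rewrite size_map size_iota.
    move=> j jn; rewrite (nth_map 0%N) ?size_iota// nth_iota//.
  apply: (@eq_from_nth _ (point : weylZ N)); first by rewrite size_map size_iota.
  move=> j; rewrite size_map size_iota => jn.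
  by rewrite (nth_map 0%N) ?size_iota// nth_iota// add0n h.
have pk := @pickle_invK (seq (weylZ N)).
case e : (pickle_inv k) => [s|]; last first.
  apply/seteqP; split => // w /= h.
  by have := pickleK_inv [seq X w (j%:R / n.+1%:R) | j <- iota 0 (ncell n).+1]; rewrite -/(sample_code n w) h e.
have ks : pickle s = k by have := pk k; rewrite /oapp e.
apply/seteqP; split => w /=.
  rewrite -ks => /(pcan_inj pickleK)/mapE[-> h].
  by rewrite eqxx.
case: eqP => // ss h; rewrite -ks; congr pickle; exact/mapE.
Qed.

Lemma measurable_sample_code n : measurable_fun setT (sample_code n).
Proof.
move=> _ B _; rewrite setTI.
have -> : sample_code n @^-1` B = \bigcup_k (if k \in B then sample_code n @^-1` [set k] else set0).
  apply/seteqP; split => w /=; first by move=> Bw; exists (sample_code n w); rewrite ?mem_set.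
  by move=> [k _]; case: ifP => // /set_mem Bk /= ->.
apply: bigcupT_measurable => k; case: ifP => // _.
rewrite sample_code_pre; case: pickle_inv => // s; case: ifP => // _.
have -> : [set w | forall j, (j <= ncell n)%N ->
    X w (j%:R / n.+1%:R) = nth (point : weylZ N) (s : seq (weylZ N)) j] =
  \bigcap_j [set w | (j <= ncell n)%N -> X w (j%:R / n.+1%:R) = nth (point : weylZ N) s j].
  by apply/seteqP; split => w h j; [move=> _; exact: h|exact: (h j Logic.I)].
apply: bigcapT_measurable => j.
case: (leqP j (ncell n)) => jn; last first.
  by rewrite (_ : [set w | _] = setT)//; apply/seteqP; split.
have := @mX (j%:R / n.+1%:R) (divr_ge0 (ler0n _ _) (ler0n _ _)) measurableT
   [set nth (point : weylZ N) s j] (mW _).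
by rewrite setTI; congr measurable; apply/seteqP; split => w /=; [move=> -> |exact].
Qed.

Definition path_of_code n (k : nat) : skorokhod R (weylZ N) :=
  let s : seq (weylZ N) := odflt [::] (pickle_inv k) in
  Skorokhod (@grid_cadlag R (weylZ N) n
    (fun u => nth point s (Num.trunc (n.+1%:R * u)))).

Lemma skorokhod_eq (f g : skorokhod R (weylZ N)) : (f : R -> weylZ N) = g -> f = g.
Proof.
case: f g => [f cf] [g cg] /= e; subst g; congr Skorokhod.
exact: Prop_irrelevance.
Qed.

Lemma sampled_code n w : sampled n (X w) = path_of_code n (sample_code n w).
Proof.
apply: skorokhod_eq; apply/funext => t.
have -> : path_of_code n (sample_code n w) t =
    nth point [seq X w (j%:R / n.+1%:R) | j <- iota 0 (ncell n).+1]
      (Num.trunc (n.+1%:R * grid n t)).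
  by rewrite /path_of_code /sample_code pickleK_inv.
have -> : sampled n (X w) t = X w (grid n t) by [].
rewrite /grid; set j := minn _ _; have -> : n.+1%:R * (j%:R / n.+1%:R) = j%:R :> R.
  by rewrite mulrC divfK// pnatr_eq0.
have jn : (j < (ncell n).+1)%N by rewrite ltnS geq_minr.
by rewrite natrK (nth_map 0%N) ?size_iota// nth_iota.
Qed.

Lemma Phi_sampled_cvg (Phi : skorokhod R (weylZ N) -> R) w : continuous Phi ->
  Phi (sampled n (X w)) @[n --> \oo] --> Phi (X w).
Proof.
move=> cPhi A /(cPhi (X w)) hA.
have h := @sampled_cvg _ _ nbhsW (X w); exact: (h _ hA).
Qed.

Lemma measurable_Phi_sampled (Phi : skorokhod R (weylZ N) -> R) n :
  measurable_fun setT (fun w => Phi (sampled n (X w))).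
Proof.
have -> : (fun w => Phi (sampled n (X w))) = (Phi \o path_of_code n) \o sample_code n.
  by apply/funext => w /=; rewrite sampled_code.
by apply: measurableT_comp => //; exact: measurable_sample_code.
Qed.

(** A pointwise limit of functions of the sample codes. *)
Lemma measurable_Phi (Phi : skorokhod R (weylZ N) -> R) : continuous Phi ->
  measurable_fun setT (Phi \o X).
Proof.
move=> cPhi; apply: (measurable_fun_cvg (measurable_Phi_sampled Phi)) => w _ /=.
exact: Phi_sampled_cvg.
Qed.

Lemma ex_Phi_cvg (Phi : skorokhod R (weylZ N) -> R) (M : R) : continuous Phi ->
  (forall f, `|Phi f| <= M) ->
  ex P ((Phi \o path_of_code n) \o sample_code n) @[n --> \oo] --> ex P (Phi \o X).
Proof.
move=> cPhi hM; apply: (@ex_cvg _ _ _ P _ _ M setT) => //.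
- by move=> n; apply: measurableT_comp => //; exact: measurable_sample_code.
- exact: measurable_Phi.
- by move=> n x; exact: hM.
- by move=> x; exact: hM.
- exact: prT.
- move=> w _; have := @Phi_sampled_cvg Phi w cPhi.
  by under eq_fun do rewrite sampled_code.
Qed.

End Sampling.

(** The two semigroups, each hidden in an existential, agree; hence so do the laws of the sample
    codes, and the grid is then refined. *)
Lemma markov_law_unique {d d'} {T : measurableType d} {T' : measurableType d'}
    (P : probability T R) (P' : probability T' R) (X : T -> skorokhod R (weylZ N))
    (X' : T' -> skorokhod R (weylZ N)) r (y : weylZ N) (Phi : skorokhod R (weylZ N) -> R) (M : R) :
  weyl_rates r ->
  markov_process P (jump_generator r) y (fun t w => X w t) ->
  markov_process P' (jump_generator r) y (fun t w => X' w t) ->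
  continuous Phi -> (forall f, `|Phi f| <= M) ->
  ex P (Phi \o X) = ex P' (Phi \o X').
Proof.
move=> hr [mX X0 [p sp HX]] [mX' X0' [p' sp' HX']] cPhi hM.
have pp : forall t x A, 0 <= t -> pr (p t x) A = pr (p' t x) A.
  rewrite (jump_generatorE hr) in sp sp'; case: (hr) => r1 r2 r3.
  apply: (@semigroup_unique R _ (weylZ N) mW N wnext (wrate r) N%:R _ _ _ _ p p' sp sp').
  - by move=> x i; apply: r1; exact: (valP x).
  - by move=> x; apply: r3; exact: (valP x).
  - by move=> x i; exact: wnext_neq.
  - by move=> x i j; exact: wnext_inj.
have h := ex_Phi_cvg (P:=P) mX cPhi hM; have h' := ex_Phi_cvg (P:=P') mX' cPhi hM.
have e n : ex P ((Phi \o path_of_code n) \o sample_code X n) =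
           ex P' ((Phi \o path_of_code n) \o sample_code X' n).
  apply: (@ex_nat_eq _ _ _ _ _ P P' _ _ _ M).
  - exact: measurable_sample_code.
  - exact: measurable_sample_code.
  - by move=> k; exact: hM.
  move=> k; rewrite !sample_code_pre; case: pickle_inv => [s|]; last by rewrite !pr0.
  case: ifP => _; last by rewrite !pr0.
  have dt0 : 0 < n.+1%:R^-1 :> R by rewrite invr_gt0.
  rewrite (fdd_markov (fun j => nth point s j) _ dt0 mX X0 HX).
  rewrite (fdd_markov (fun j => nth point s j) _ dt0 mX' X0' HX').
  by congr (_ * _); apply: eq_bigr => j _; rewrite pp// ltW.
rewrite -(funext e) in h'.
by apply: (cvg_unique _ h h').
Qed.

End WeylChains.

(** * Construction and coupling of the chains *)

Section NestedCells.
Context {R : realType} {S : Type} {m : nat}.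
Variables (nx : S -> 'I_m.+1 -> S) (k : S -> 'I_m.+1 -> R) (x : S).
Hypothesis k_ge0 : forall z i, 0 <= k z i.
Hypothesis k_sum1 : forall z, \sum_i k z i = 1.

(* The move chosen at each step subdivides the current interval, so that one uniform
   variable u drives the whole chain: its first moves are c when u is in cell c.
   A sequence of moves is listed with the latest one first. *)
Fixpoint cell_state (c : seq 'I_m.+1) : S :=
  if c is i :: c' then nx (cell_state c') i else x.

Fixpoint cell_len (c : seq 'I_m.+1) : R :=
  if c is i :: c' then cell_len c' * k (cell_state c') i else 1.

Definition k_below z n : R := \sum_(j < m.+1 | (j < n)%N) k z j.

Fixpoint cell_lo (c : seq 'I_m.+1) : R :=
  if c is i :: c' then cell_lo c' + cell_len c' * k_below (cell_state c') i else 0.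

Definition in_cell c u := cell_lo c <= u < cell_lo c + cell_len c.

Lemma cell_len_ge0 c : 0 <= cell_len c.
Proof. by elim: c => //= i c IH; exact: mulr_ge0. Qed.

Lemma k_belowS z (i : 'I_m.+1) : k_below z i.+1 = k_below z i + k z i.
Proof.
rewrite /k_below (bigD1 i)//= addrC; congr (_ + _); apply: eq_bigl => j.
by rewrite ltnS ltn_neqAle andbC.
Qed.

Lemma k_below_le z n n' : (n <= n')%N -> k_below z n <= k_below z n'.
Proof.
move=> nn'; rewrite /k_below big_mkcond [leRHS]big_mkcond/=; apply: ler_sum => j _.
by case: (ltnP j n) => [/leq_trans/(_ nn') ->//|_]; case: ifP.
Qed.

Lemma k_below0 z : k_below z 0 = 0.
Proof. by rewrite /k_below big_pred0. Qed.

Lemma k_below_max z : k_below z m.+1 = 1.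
Proof. by rewrite /k_below -[RHS](k_sum1 z); apply: eq_bigl => j; rewrite ltn_ord. Qed.

Lemma in_cell_consE i c u : in_cell (i :: c) u =
  (cell_lo c + cell_len c * k_below (cell_state c) i <= u <
   cell_lo c + cell_len c * k_below (cell_state c) i.+1).
Proof. by rewrite /in_cell /= k_belowS mulrDr addrA. Qed.

Lemma in_cell_cons_sub i c u : in_cell (i :: c) u -> in_cell c u.
Proof.
rewrite in_cell_consE /in_cell => /andP[h1 h2]; apply/andP; split.
  apply: le_trans h1; rewrite lerDl mulr_ge0 ?cell_len_ge0// -(k_below0 (cell_state c)).
  exact: k_below_le.
apply: (lt_le_trans h2); rewrite lerD2l -[leRHS]mulr1 -(k_below_max (cell_state c)).
by apply: ler_wpM2l; [exact: cell_len_ge0|exact: k_below_le].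
Qed.

Lemma in_cell_cons_inj i j c u : in_cell (i :: c) u -> in_cell (j :: c) u -> i = j.
Proof.
rewrite !in_cell_consE => /andP[i1 i2] /andP[j1 j2]; apply/val_inj => /=.
have H (a b : nat) : (a < b)%N -> u < cell_lo c + cell_len c * k_below (cell_state c) a.+1 ->
  cell_lo c + cell_len c * k_below (cell_state c) b <= u -> False.
  move=> ab h1 h2; have := le_lt_trans h2 h1; rewrite ltNge => /negP; apply.
  by rewrite lerD2l; apply: ler_wpM2l; [exact: cell_len_ge0|exact: k_below_le].
by case: (ltngtP i j) => // ij; exfalso; [exact: H ij i2 j1|exact: H ij j2 i1].
Qed.

Lemma in_cell_cons_ex c u : in_cell c u -> exists i, in_cell (i :: c) u.
Proof.
move=> /andP[h1 h2].
have ex : exists n, u < cell_lo c + cell_len c * k_below (cell_state c) n.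
  by exists m.+1; rewrite k_below_max mulr1.
case: (ex_minnP ex) => -[|n]; first by rewrite k_below0 mulr0 addr0 ltNge h1.
move=> un nmin; have nm : (n < m.+1)%N.
  by apply: (nmin m.+1); rewrite k_below_max mulr1.
exists (Ordinal nm); rewrite in_cell_consE /= un andbT leNgt; apply/negP => /nmin.
by rewrite ltnn.
Qed.

(** For [u] in [[0, 1[] some subinterval always contains [u], so the default [ord0] is never
    taken. *)
Fixpoint cell_code (u : R) (n : nat) : seq 'I_m.+1 :=
  if n is n'.+1 then
    let c := cell_code u n' in odflt ord0 [pick i | in_cell (i :: c) u] :: c
  else [::].

Lemma size_cell_code u n : size (cell_code u n) = n.
Proof. by elim: n => //= n ->. Qed.

Lemma cell_code_drop u n j : (j <= n)%N -> drop (n - j) (cell_code u n) = cell_code u j.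
Proof.
elim: n j => [|n IH] j; first by rewrite leqn0 => /eqP ->.
rewrite leq_eqVlt => /predU1P[->|jn]; first by rewrite subnn drop0.
by rewrite subSn//= IH.
Qed.

Lemma in_cell_code u n : 0 <= u < 1 -> in_cell (cell_code u n) u.
Proof.
move=> u01; elim: n => [|n IH] /=; first by rewrite /in_cell /= add0r.
case: pickP => //= h; have [i] := in_cell_cons_ex IH; by rewrite h.
Qed.

Lemma cell_code_eq u c : in_cell c u -> cell_code u (size c) = c.
Proof.
elim: c => //= i c IH ic; rewrite IH; last exact: in_cell_cons_sub ic.
case: pickP => /= [j jc|/(_ i)]; last by rewrite ic.
by rewrite (in_cell_cons_inj jc ic).
Qed.

(** Redirects the null set outside [[0, 1[], so that every sample point has a code and the chain is
    defined everywhere. *)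
Definition unit_clip (u : R) : R := if 0 <= u < 1 then u else 0.

Lemma unit_clip_in u : 0 <= unit_clip u < 1.
Proof. by rewrite /unit_clip; case: ifP => // _; rewrite lexx ltr01. Qed.

Definition cell (c : seq 'I_m.+1) : set R := [set u | cell_code (unit_clip u) (size c) = c].

Lemma cellE c u : cell c u <-> in_cell c (unit_clip u).
Proof.
split; last exact: cell_code_eq.
by rewrite /cell /= => <-; exact: in_cell_code (unit_clip_in u).
Qed.

Lemma in_cell_01 c u : in_cell c u -> 0 <= u < 1.
Proof.
elim: c => [|i c IH]; first by rewrite /in_cell /= add0r.
by move=> /in_cell_cons_sub.
Qed.

Lemma cell_sub01 c : 0 <= cell_lo c /\ cell_lo c + cell_len c <= 1.
Proof.
elim: c => [|i c [h1 h2]] /=; first by rewrite add0r lexx.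
have l0 := cell_len_ge0 c; split.
  by rewrite addr_ge0// mulr_ge0// -(k_below0 (cell_state c)); exact: k_below_le.
rewrite -addrA -mulrDr -k_belowS (le_trans _ h2)// lerD2l -[leRHS]mulr1.
by apply: ler_wpM2l => //; rewrite -(k_below_max (cell_state c)); exact: k_below_le.
Qed.

Definition unif : probability (measurableTypeR R) R := uniform_prob (@ltr01 R).

Lemma unif_itv (a l : R) : 0 <= a -> 0 <= l -> a + l <= 1 ->
  pr unif [set u | a <= u < a + l] = l.
Proof.
move=> a0 l0 al1.
have -> : [set u | a <= u < a + l] = [set` `[a, a + l[%R].
  by apply/seteqP; split => u /=; rewrite in_itv.
suff E : (\int[lebesgue_measure]_(u in [set` `[a, (a + l)%R[%R]) (uniform_pdf 0 1 u)%:E = l%:E)%E.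
  by rewrite /pr (_ : unif _ = l%:E).
rewrite (eq_integral (fun=> 1%E)); last first.
  move=> u /set_mem /=; rewrite in_itv/= => /andP[u1 u2].
  by rewrite /uniform_pdf subr0 invr1 (le_trans a0 u1) (ltW (lt_le_trans u2 al1)).
rewrite integral_cst//= lebesgue_measure_itv/= lte_fin mul1e.
case: ltP => [_|]; first by rewrite -EFinB addrAC subrr add0r.
by rewrite gerDl => l0'; congr EFin; apply/eqP; rewrite eq_le l0 l0'.
Qed.

Lemma cell_clip c : cell c `&` [set u | 0 <= u < 1] =
  [set u | cell_lo c <= u < cell_lo c + cell_len c].
Proof.
apply/seteqP; split => u /=.
  by move=> [/cellE + u01]; rewrite /unit_clip u01.
move=> uc; have u01 := in_cell_01 uc; split => //.
by apply/cellE; rewrite /unit_clip u01.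
Qed.

Lemma measurable_co (a b : R) : measurable [set u : measurableTypeR R | a <= u < b].
Proof.
by rewrite (_ : [set u | _] = [set` `[a, b[%R]).
Qed.

Lemma cell_measurable c : measurable (cell c : set (measurableTypeR R)).
Proof.
have m01 := measurable_co 0 1.
rewrite -(setUIDK (cell c) [set u | 0 <= u < 1]) cell_clip; apply: measurableU.
  exact: measurable_co.
(* Points outside [[0, 1[] are clipped to 0, so either all of them belong to the cell or none
   does. *)
have [c0|c0] := boolP (in_cell c 0).
  rewrite (_ : _ `\` _ = ~` [set u | 0 <= u < 1]); first exact: measurableC.
  apply/seteqP; split => u /=; first by case.
  move=> u01; split => //; apply/cellE; rewrite /unit_clip.
  by move/negP/negbTE: u01 => ->.
rewrite (_ : _ `\` _ = set0)//; apply/seteqP; split => // u /= [/cellE + u01].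
by move/negP/negbTE: u01; rewrite /unit_clip => ->; rewrite (negbTE c0).
Qed.

Lemma pr_cell c : pr unif (cell c) = cell_len c.
Proof.
have m01 := measurable_co 0 1; have mc := cell_measurable c.
have [l0 l1] := cell_sub01 c; have ll := cell_len_ge0 c.
have h0 : pr unif (~` [set u | 0 <= u < 1]) = 0.
  by rewrite prC//; have := @unif_itv 0 1 (lexx 0) ler01; rewrite !add0r => -> //; rewrite subrr.
have h1 : pr unif (cell c `\` [set u | 0 <= u < 1]) = 0; last first.
  by rewrite (prID _ mc m01) h1 addr0 cell_clip unif_itv.
apply: (pr_null_sub _ _ _ h0).
- exact: measurableD.
- exact: measurableC.
- by move=> u [].
Qed.

Definition embedded (n : nat) (u : R) : S := cell_state (cell_code (unit_clip u) n).

Lemma embedded_cell c u j : cell c u -> (j <= size c)%N ->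
  embedded j u = cell_state (drop (size c - j) c).
Proof. by move=> cu jc; rewrite /embedded -(cell_code_drop _ jc) cu. Qed.

Lemma embedded_measurable n (B : set S) :
  measurable (embedded n @^-1` B : set (measurableTypeR R)).
Proof.
have -> : embedded n @^-1` B = \bigcup_j
    (if pickle_inv j is Some c then
      if (size c == n) && (cell_state c \in B) then cell c else set0 else set0).
  apply/seteqP; split => u /=.
    move=> Bu; exists (pickle (cell_code (unit_clip u) n)) => //.
    by rewrite pickleK_inv size_cell_code eqxx mem_set//= /cell /= size_cell_code.
  move=> [j _]; case: pickle_inv => // c; case: ifP => // /andP[/eqP cn /set_mem Bc] uc.
  by rewrite /embedded -cn uc.
apply: bigcupT_measurable => j; case: pickle_inv => // c; case: ifP => // _.
exact: cell_measurable.
Qed.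

Fixpoint step_prob (z : S) (n : nat) (B : set S) : R :=
  if n is n'.+1 then \sum_i k z i * step_prob (nx z i) n' B else (z \in B)%:R.

(** Markov property of the embedded chain: within cell [c] the chain starts afresh from
    [cell_state c]. The induction splits a cell into its subcells. *)
Lemma pr_embedded c n (B : set S) :
  pr unif (cell c `&` embedded (size c + n) @^-1` B) =
  cell_len c * step_prob (cell_state c) n B.
Proof.
elim: n c => [|n IH] c.
  rewrite addn0 /=; case: (boolP (cell_state c \in B)) => [cB|cB].
    rewrite mulr1 setIidl ?pr_cell// => u uc; rewrite /= (embedded_cell uc)// subnn drop0.
    exact: set_mem.
  rewrite mulr0 (_ : _ `&` _ = set0) ?pr0//; apply/seteqP; split => // u /= [uc].
  by rewrite (embedded_cell uc)// subnn drop0 => /mem_set; rewrite (negbTE cB).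
have e := @pr_sum _ _ _ unif _ (cell c `&` embedded (size c + n.+1) @^-1` B)
  (fun i => cell (i :: c)).
rewrite {}e.
- rewrite /= mulr_sumr; apply: eq_bigr => i _.
  rewrite mulrA -(IH (i :: c)); congr (pr _ _).
  apply/seteqP; split => u /=; rewrite addSnnS; first by move=> [[_ h] h'].
  move=> [ic h]; split=> //; split=> //; apply/cellE; move/cellE : ic.
  exact: in_cell_cons_sub.
- by apply: measurableI; [exact: cell_measurable|exact: embedded_measurable].
- by move=> i; exact: cell_measurable.
- by move=> i j u /cellE iu /cellE /(in_cell_cons_inj iu).
- by move=> u [/cellE /in_cell_cons_ex [i iu] _]; exists i; apply/cellE.
Qed.

Lemma pr_embedded0 n (B : set S) : pr unif (embedded n @^-1` B) = step_prob x n B.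
Proof.
have := pr_embedded [::] n B; rewrite mul1r add0n /= => <-.
congr (pr _ _); apply/seteqP; split => u /=; first by move=> h; split.
by case.
Qed.

End NestedCells.

(** * Almost sure monotonicity of the clock *)

Section MonotonePaths.
Context {R : realType} {d} {T : measurableType d} (P : probability T R).
Variables (X : R -> T -> nat) (HX : poisson_process P X).

(** The definition of a Poisson process makes paths monotone only almost surely. Countably many time
    pairs give one event of probability 1; right continuity extends it to real times. *)
Definition mono_paths : set T :=
  [set w | forall a b : rat, 0 <= a -> a < b -> (X (ratr a) w <= X (ratr b) w)%N].

Let bad n : set T :=
  if (unpickle n : option (rat * rat)) is Some (a, b) then
    if (0 <= a) && (a < b) then [set w | (X (ratr b) w < X (ratr a) w)%N] else set0
  else set0.

Let mono_pathsE : mono_paths = ~` \bigcup_n bad n.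
Proof.
apply/seteqP; split => w /=.
  move=> h [n _]; rewrite /bad; case: unpickle => // -[a b]; case: ifP => // /andP[a0 ab] /=.
  by rewrite ltnNge h.
move=> h a b a0 ab; rewrite leqNgt; apply/negP => hab; apply: h.
by exists (pickle (a, b)); [exact: Logic.I|rewrite /bad pickleK a0 ab; exact: hab].
Qed.

Let mbad n : measurable (bad n).
Proof.
rewrite /bad; case: unpickle => // -[a b]; case: ifP => // /andP[a0 ab].
have -> : [set w | (X (ratr b) w < X (ratr a) w)%N] =
    \bigcup_k (X (ratr b) @^-1` [set k] `&` X (ratr a) @^-1` [set j | (k < j)%N]).
  by apply/seteqP; split => w /=; [move=> h; exists (X (ratr b) w)|move=> [k _ [/= ->]]].
have b0 := le_trans a0 (ltW ab).
apply: bigcupT_measurable => k; apply: measurableI; apply: (poisson_measurable_pre HX);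
  by rewrite ler0q.
Qed.

Lemma mono_paths_measurable : measurable mono_paths.
Proof. by rewrite mono_pathsE; apply: measurableC; exact: bigcupT_measurable. Qed.

Lemma pr_mono_paths : pr P mono_paths = 1.
Proof.
rewrite mono_pathsE prC; last exact: bigcupT_measurable.
suff -> : pr P (\bigcup_n bad n) = 0 by rewrite subr0.
rewrite /pr measure_negligible//; first exact: bigcupT_measurable.
apply: negligible_bigcup => n; apply/negligibleP; first exact: mbad.
have := mbad n; rewrite /bad; case: unpickle => [[a b]|]; last by rewrite measure0.
case: ifP => [/andP[a0 ab] mb|_ _]; last by rewrite measure0.
apply: etrans (prE P mb) _.
by rewrite (poisson_nondecreasing HX)// ?ler0q// ltr_rat.
Qed.

Lemma mono_pathsP w s t : mono_paths w -> 0 <= s -> s <= t -> (X s w <= X t w)%N.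
Proof.
move=> hw s0; rewrite le_eqVlt => /predU1P[->//|st].
case: HX => _ /(_ w) cX _ _; have t0 : 0 <= t by lra.
have [e e0 he] := cadlag_right nbhs_nat1 cX s0; have [f f0 hf] := cadlag_right nbhs_nat1 cX t0.
have h1 : s < Num.min (s + e) t by rewrite lt_min st andbT; lra.
have h2 : t < t + f by lra.
have [a /andP[/= a1 a2]] := rat_in_itvoo h1; have [b /andP[/= b1 b2]] := rat_in_itvoo h2.
move: a1 a2 b1 b2; rewrite !bnd_simp lt_min => a1 /andP[a2 a3] b1 b2.
rewrite -(he (ratr a)); last by rewrite a2 ltW.
rewrite -(hf (ratr b)); last by rewrite b2 ltW.
apply: hw; first by rewrite -(ler0q R); lra.
by rewrite -(ltr_rat R); lra.
Qed.

Lemma poisson_incr_le s t A k : 0 <= s -> s <= t -> history X [set u | 0 <= u <= s] A ->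
  pr P (A `&` [set w | X t w = (X s w + k)%N]) = pr P A * pweight (t - s) k.
Proof.
move=> s0; rewrite le_eqVlt => /predU1P[<-|st]; last exact: poisson_incr.
move=> _; rewrite subrr; case: k => [|k].
  rewrite (_ : [set w | _] = setT); last by apply/seteqP; split => w //= _; rewrite addn0.
  by rewrite setIT /pweight expr0 fact0 oppr0 expR0; field.
rewrite (_ : [set w | _] = set0).
  by rewrite setI0 pr0 /pweight expr0n /= !mul0r mulr0.
by apply/seteqP; split => w //= /eqP; rewrite -[X in X == _]addn0 eqn_add2l.
Qed.

Lemma pr_poisson t k : 0 <= t -> pr P (X t @^-1` [set k]) = pweight t k.
Proof.
move=> t0; case: (HX) => _ _ X0 _.
have h : history X [set u | 0 <= u <= 0] setT by exact: history_setT.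
have := poisson_incr_le k (lexx 0) t0 h; rewrite prT mul1r subr0 setTI => <-; congr (pr _ _).
by apply/seteqP; split => w /=; rewrite X0 add0n.
Qed.

End MonotonePaths.

(** * The uniformized chain *)

Section JumpChain.
Context {R : realType} {d} {T : measurableType d} (P : probability T R).
Variables (X : R -> T -> nat) (HX : poisson_process P X).
Context {d'} {S : measurableType d'} (mS : forall A : set S, measurable A) {m : nat}.
Variables (nx : S -> 'I_m.+1 -> S) (k : S -> 'I_m.+1 -> R) (lam : R).
Hypothesis lam0 : 0 <= lam.
Hypothesis k_ge0 : forall z i, 0 <= k z i.
Hypothesis k_sum1 : forall z, \sum_i k z i = 1.

Definition PU : probability (T * measurableTypeR R)%type R := (P \x unif)%E.

Lemma pr_setX (A : set T) (B : set (measurableTypeR R)) : measurable A -> measurable B ->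
  pr PU (A `*` B) = pr P A * pr unif B.
Proof.
by move=> mA mB; rewrite /pr /PU /= product_measure1E// fineM// fin_num_measure.
Qed.

(** Negative times are cut off at 0, so that the clock is only read where it is known to be
    measurable. *)
Definition jump_chain (x : S) (t : R) (w : T * measurableTypeR R) : S :=
  embedded nx k x (X (lam * Num.max t 0) w.1) w.2.

Lemma jump_chainE x t w : 0 <= t -> jump_chain x t w = embedded nx k x (X (lam * t) w.1) w.2.
Proof. by move=> t0; rewrite /jump_chain; congr embedded; congr X; congr (_ * _); apply/max_idPl. Qed.

Lemma jump_chain_pre x t B : measurable (jump_chain x t @^-1` B).
Proof.
have t0 : 0 <= lam * Num.max t 0 by rewrite mulr_ge0// le_max lexx orbT.
have -> : jump_chain x t @^-1` B = \bigcup_n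
    ((X (lam * Num.max t 0) @^-1` [set n]) `*` (embedded nx k x n @^-1` B)).
  apply/seteqP; split => w /=; first by move=> h; exists (X (lam * Num.max t 0) w.1).
  by move=> [n _ [/= <-]].
apply: bigcupT_measurable => n; apply: measurableX.
  exact: (poisson_measurable_pre HX).
exact: embedded_measurable.
Qed.

Lemma jump_chain_measurable x t : measurable_fun setT (jump_chain x t).
Proof. by move=> _ B _; rewrite setTI; exact: jump_chain_pre. Qed.

Definition jump_mfun x t : {mfun (T * measurableTypeR R)%type >-> S} :=
  HB.pack (jump_chain x t) (isMeasurableFun.Build _ _ _ _ _ (jump_chain_measurable x t)).

Definition jump_law t x : probability S R := distribution PU (jump_mfun x t).

(** The event that the moves up to time [s] are exactly [c]. Over all [c] these events form a
    countable partition. *)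
Definition chain_cell x s (c : seq 'I_m.+1) : set (T * measurableTypeR R) :=
  (X (lam * s) @^-1` [set size c]) `*` cell nx k x c.

Lemma chain_cell_measurable x s c : 0 <= s -> measurable (chain_cell x s c).
Proof.
move=> s0; apply: measurableX; last exact: cell_measurable.
by apply: (poisson_measurable_pre HX); rewrite mulr_ge0.
Qed.

Lemma jump_chain_cell x s c w : 0 <= s -> chain_cell x s c w ->
  jump_chain x s w = cell_state nx x c.
Proof.
move=> s0 [/= h1 h2]; rewrite jump_chainE// h1 (embedded_cell h2)//.
by rewrite subnn drop0.
Qed.

(* On each cell the history of the chain is, up to a null set, the trace of an
   event of the Poisson clock alone. *)
Lemma jump_chain_history x s A c : 0 <= s ->
  history (jump_chain x) [set u | 0 <= u <= s] A ->
  exists2 A', history X [set u | 0 <= u <= lam * s] A' &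
    forall w, mono_paths X w.1 -> chain_cell x s c w -> A w <-> A' w.1.
Proof.
move=> s0 hA.
pose C := [set A | exists2 A', history X [set u | 0 <= u <= lam * s] A' &
  forall w, mono_paths X w.1 -> chain_cell x s c w -> A w <-> A' w.1].
suff : C A by [].
apply: (smallest_sub _ _ hA); rewrite -/C.
  split.
  - by exists set0 => //; rewrite -setCT; apply: history_setC; exact: history_setT.
  - move=> B [B' hB' BB']; exists (~` B'); first exact: history_setC.
    move=> w hw cw; rewrite /= -(BB' w hw cw); split; first by move=> [].
    by move=> h; split.
  - move=> F hF; have /choice[F' hF'] : forall n, exists A',
        history X [set u | 0 <= u <= lam * s] A' /\
        forall w, mono_paths X w.1 -> chain_cell x s c w -> F n w <-> A' w.1.
      by move=> n; have [A' h1 h2] := hF n; exists A'.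
    exists (\bigcup_n F' n); first by apply: history_bigcup => n; exact: (hF' n).1.
    move=> w hw cw; split => -[n _ Fn]; exists n => //; by apply/((hF' n).2 w hw cw).
move=> B [v /= /andP[v0 vs] [B1 _ ->]].
exists (X (lam * v) @^-1` [set j | B1 (cell_state nx x (drop (size c - j) c))]).
  by apply: history_pre => //=; rewrite mulr_ge0//= ler_wpM2l.
move=> w hw [/= h1 h2]; rewrite jump_chainE// (embedded_cell h2)// -h1.
by apply: (mono_pathsP HX hw); [rewrite mulr_ge0|rewrite ler_wpM2l].
Qed.

Lemma mono_chain_measurable : measurable (mono_paths X `*` (setT : set (measurableTypeR R))).
Proof. by apply: measurableX => //; exact: (mono_paths_measurable HX). Qed.

Lemma pr_mono_chain A : measurable A -> pr PU A = pr PU (A `&` (mono_paths X `*` setT)).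
Proof.
move=> mA; have mG := mono_chain_measurable.
rewrite (prID _ mA mG); suff -> : pr PU (A `\` mono_paths X `*` setT) = 0 by rewrite addr0.
apply: (@pr_null_sub _ _ _ _ _ (~` (mono_paths X `*` setT))).
- exact: measurableD.
- exact: measurableC.
- by move=> w [].
rewrite prC// pr_setX//; last exact: (mono_paths_measurable HX).
by rewrite (pr_mono_paths HX) prT mulr1 subrr.
Qed.

Lemma pr_mono_eq A B : measurable A -> measurable B ->
  (forall w, mono_paths X w.1 -> A w <-> B w) -> pr PU A = pr PU B.
Proof.
move=> mA mB AB; rewrite (pr_mono_chain mA) (pr_mono_chain mB).
suff -> : A `&` (mono_paths X `*` setT) = B `&` (mono_paths X `*` setT) by [].
by apply/seteqP; split => w [h] [hw _]; split => //; apply/(AB w hw).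
Qed.

Lemma jump_chain_clock t n x B : 0 <= t ->
  pr PU (jump_chain x t @^-1` B `&` (X (lam * t) @^-1` [set n] `*` setT)) =
  pweight (lam * t) n * step_prob nx k x n B.
Proof.
move=> t0; have lt0 : 0 <= lam * t by rewrite mulr_ge0.
rewrite -(pr_poisson HX)// -pr_embedded0// -pr_setX.
- congr (pr _ _); apply/seteqP; split => w /=; rewrite jump_chainE//.
    by move=> [h [<- _]].
  by move=> [<- h].
- exact: (poisson_measurable_pre HX).
- exact: embedded_measurable.
Qed.

Lemma jump_law_series t x B : 0 <= t ->
  \sum_(0 <= j < n) pweight (lam * t) j * step_prob nx k x j B @[n --> \oo] -->
  pr PU (jump_chain x t @^-1` B).
Proof.
move=> t0; have lt0 : 0 <= lam * t by rewrite mulr_ge0.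
have := @pr_series _ _ _ PU (jump_chain x t @^-1` B)
  (fun n => X (lam * t) @^-1` [set n] `*` setT) (jump_chain_pre x t B).
rewrite setIidl; last by move=> w _; exists (X (lam * t) w.1).
under eq_fun do under eq_bigr do rewrite jump_chain_clock//.
apply.
  by move=> n; apply: measurableX => //; exact: (poisson_measurable_pre HX).
by move=> i j w [/= <- _] [/= <- _].
Qed.

(** On the cell, the past is an event of the clock times the cell in [u], up to a null set. Given
    [j] further ticks, independence of increments handles the first factor and [pr_embedded] the
    second; then one sums over [j]. *)
Lemma jump_chain_markov_cell x s t A B c : 0 <= s -> s <= t ->
  measurable A -> history (jump_chain x) [set u | 0 <= u <= s] A ->
  pr PU (A `&` chain_cell x s c `&` jump_chain x t @^-1` B) =
  pr PU (A `&` chain_cell x s c) *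
  pr PU (jump_chain (cell_state nx x c) (t - s) @^-1` B).
Proof.
move=> s0 st mA hA; have t0 := le_trans s0 st.
have [ls0 lt0] : 0 <= lam * s /\ 0 <= lam * t by rewrite !mulr_ge0.
have lst : lam * s <= lam * t by rewrite ler_wpM2l.
have [A' hA' AA'] := jump_chain_history c s0 hA.
have mA' : measurable A'.
  by apply: (poisson_history_measurable HX) hA' => u /= /andP[].
have mc := chain_cell_measurable x c s0.
have mX j : measurable [set w | X (lam * t) w = (X (lam * s) w + j)%N].
  apply: (@poisson_history_measurable _ _ _ _ _ HX [set u | 0 <= u]) => //.
  exact: history_incr.
pose E := A `&` chain_cell x s c `&` jump_chain x t @^-1` B.
have mE : measurable E.
  by apply: measurableI; [exact: measurableI|exact: jump_chain_pre].
pose F j : set (T * measurableTypeR R) :=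
  [set w | X (lam * t) w = (X (lam * s) w + j)%N] `*` setT.
have mF j : measurable (F j) by exact: measurableX.
have dF i j w : F i w -> F j w -> i = j by move=> [/= h _] [/=]; rewrite h => /addnI.
have hE := pr_series (P := PU) mE mF dF.
have {hE} hE : \sum_(0 <= j < n) pr PU (E `&` F j) @[n --> \oo] --> pr PU E.
  rewrite [X in _ --> X](@pr_mono_eq _ (E `&` \bigcup_n F n))//.
    by apply: measurableI => //; exact: bigcupT_measurable.
  move=> w hw; split; last by case.
  move=> Ew; split => //; exists (X (lam * t) w.1 - X (lam * s) w.1)%N => //; split => //=.
  by rewrite subnKC//; exact: (mono_pathsP HX).
pose A1 := A' `&` X (lam * s) @^-1` [set size c].
have hA1 : history X [set u | 0 <= u <= lam * s] A1.
  by apply: history_setI => //; apply: history_pre => //=; rewrite ls0 lexx.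
have mA1 : measurable A1.
  by apply: measurableI => //; exact: (poisson_measurable_pre HX).
have mcell := cell_measurable nx x k_ge0 k_sum1 c.
have EF j : pr PU (E `&` F j) = pr PU (A `&` chain_cell x s c) *
    (pweight (lam * (t - s)) j * step_prob nx k (cell_state nx x c) j B).
  have -> : pr PU (A `&` chain_cell x s c) = pr P A1 * cell_len nx k x c.
    rewrite -(pr_cell nx x k_ge0 k_sum1 c) -(pr_setX mA1 mcell).
    apply: (pr_mono_eq (measurableI _ _ mA mc) (measurableX mA1 mcell)).
    move=> w hw; split.
      by move=> [Aw cw]; have [h1 h2] := cw; split => //; split => //; apply/AA'.
    move=> [[Aw h1] h2]; have cw : chain_cell x s c w by split.
    by split => //; apply/AA'.
  have -> : pr PU (E `&` F j) =
      pr PU ((A1 `&` [set w | X (lam * t) w = (X (lam * s) w + j)%N]) `*`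
             (cell nx k x c `&` embedded nx k x (size c + j) @^-1` B)).
    have memb := embedded_measurable nx x k_ge0 k_sum1 (size c + j) B.
    have mXY := measurableX (measurableI _ _ mA1 (mX j)) (measurableI _ _ mcell memb).
    apply: (pr_mono_eq (measurableI _ _ mE (mF j)) mXY) => w hw; split.
      move=> [[[Aw cw] /= Bw] [/= hj _]]; have [/= h1 h2] := cw.
      have Aw' : A' w.1 by apply/AA'.
      split; split => //=; move: Bw; by rewrite jump_chainE// hj h1.
    move=> [[[Aw /= h1] /= hj] [/= h2 Bw]]; have cw : chain_cell x s c w by split.
    split; last by split.
    split; first by split => //; apply/AA'.
    by rewrite /= jump_chainE// hj h1.
  have memb := embedded_measurable nx x k_ge0 k_sum1 (size c + j) B.
  rewrite (pr_setX (measurableI _ _ mA1 (mX j)) (measurableI _ _ mcell memb)).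
  rewrite (poisson_incr_le HX)// pr_embedded// mulrBr.
  by move: (pr P A1) (pweight _ _) (cell_len _ _ _ _) (step_prob _ _ _ _ _) => a b e f; ring.
rewrite -/E; apply: (cvg_unique _ hE) => //.
have -> : (fun n => \sum_(0 <= j < n) pr PU (E `&` F j)) = (fun n =>
    pr PU (A `&` chain_cell x s c) *
    \sum_(0 <= j < n) pweight (lam * (t - s)) j * step_prob nx k (cell_state nx x c) j B).
  by apply/funext => n; rewrite mulr_sumr; apply: eq_bigr => j _; exact: EF.
by apply: cvgM; [exact: cvg_cst|apply: jump_law_series; rewrite subr_ge0].
Qed.

Let pcell x s j : set (T * measurableTypeR R) :=
  if pickle_inv j is Some c then chain_cell x s c else set0.

Let pcell_measurable x s j : 0 <= s -> measurable (pcell x s j).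
Proof. by move=> s0; rewrite /pcell; case: pickle_inv => // c; exact: chain_cell_measurable. Qed.

Let pcell_inj x s i j w : pcell x s i w -> pcell x s j w -> i = j.
Proof.
rewrite /pcell.
case ei : pickle_inv => [c|//] [/= h1 h2]; case ej : pickle_inv => [c'|//] [/= h1' h2'].
have := @pickle_invK (seq 'I_m.+1) i; have := @pickle_invK (seq 'I_m.+1) j.
rewrite ei ej /= => <- <-; congr pickle; rewrite -h2 -h2'.
by rewrite -h1 -h1'.
Qed.

Let pcell_cover x s w : exists j, pcell x s j w.
Proof.
pose c := cell_code nx k x (unit_clip w.2) (X (lam * s) w.1).
have sc : size c = X (lam * s) w.1 by rewrite size_cell_code.
exists (pickle c); rewrite /pcell pickleK_inv; split; first by rewrite /= sc.
by rewrite /= /cell /= sc.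
Qed.

Lemma jump_chain_markov x s t A B : 0 <= s <= t ->
  history (jump_chain x) [set u | 0 <= u <= s] A ->
  (PU (A `&` jump_chain x t @^-1` B) = \int[PU]_(w in A) jump_law (t - s)%R (jump_chain x s w) B)%E.
Proof.
move=> /andP[s0 st] hA; have t0 := le_trans s0 st.
have mA : measurable A.
  apply: history_measurable hA => u _; exact: jump_chain_measurable.
have mp j := pcell_measurable x j s0.
have AE : A = \bigcup_j (A `&` pcell x s j).
  rewrite -setI_bigcupr setIidl// => w _.
  by have [j hj] := pcell_cover x s w; exists j.
have tA : trivIset setT (fun j => A `&` pcell x s j).
  by apply/trivIsetP => i j _ _ /eqP ij; apply/seteqP; split => // w [[_ h] [_ h']];
    apply: ij; exact: pcell_inj h h'.
have mjB := jump_chain_pre x t B.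
have -> : A `&` jump_chain x t @^-1` B =
    \bigcup_j (A `&` pcell x s j `&` jump_chain x t @^-1` B).
  by rewrite -setI_bigcupl -AE.
have mI j : measurable (A `&` pcell x s j) by exact: measurableI.
rewrite [RHS](_ : _ = \int[PU]_(w in \bigcup_j (A `&` pcell x s j))
    jump_law (t - s)%R (jump_chain x s w) B)%E; last by rewrite -AE.
rewrite ge0_integral_bigcup//; last first.
  have mg : measurable_fun setT (fun z => jump_law (t - s)%R z B) by move=> _ Y _; exact: mS.
  have := measurableT_comp mg (jump_chain_measurable x s); exact: measurable_funS.
rewrite measure_semi_bigcup; first last.
- by apply: bigcupT_measurable => j; exact: measurableI.
- apply/trivIsetP => i j _ _ /eqP ij; apply/seteqP; split => // w [[[_ h] _] [[_ h'] _]].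
  by apply: ij; exact: pcell_inj h h'.
- by move=> j; exact: measurableI.
apply: eq_eseriesr => j _.
have := mI j; rewrite /pcell; case: pickle_inv => [c|] mc; last first.
  by rewrite !setI0 set0I measure0 integral_set0.
rewrite (eq_integral (fun=> jump_law (t - s)%R (cell_state nx x c) B)); last first.
  by move=> w /set_mem[_ cw]; rewrite (jump_chain_cell s0 cw).
rewrite integral_cst//.
have e := jump_chain_markov_cell B c s0 st mA hA.
have mz := jump_chain_pre (cell_state nx x c) (t - s) B.
apply: etrans (prE PU (measurableI _ _ mc mjB)) _.
rewrite e EFinM muleC; congr (_ * _)%E; apply: esym.
  exact: (prE PU mz).
exact: (prE PU mc).
Qed.

Lemma jump_chain0 x w : jump_chain x 0 w = x.
Proof. by case: HX => _ _ X0 _; rewrite jump_chainE// mulr0 X0. Qed.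

Lemma ex_jump_law t x (F : S -> R) (M : R) : (forall z, `|F z| <= M) ->
  ex (jump_law t x) F = ex PU (F \o jump_chain x t).
Proof.
move=> hM; rewrite /ex /Rintegral.
have mF : measurable_fun setT F by move=> _ Y _; exact: mS.
rewrite (@integral_pushforward _ _ _ _ R (jump_chain x t) (jump_chain_measurable x t))//.
rewrite preimage_setT; apply: bmeas_integrable; split.
  by apply: measurableT_comp => //; exact: jump_chain_measurable.
by exists M => w; exact: hM.
Qed.

Let cell1E x i u : cell nx k x [:: i] u <-> cell_code nx k x (unit_clip u) 1 = [:: i].
Proof. by []. Qed.

(** Splits according to no tick, one tick or more. The remainder [g] vanishes in the first two cases
    and is at most [M] in the last. *)
Lemma jump_law_short h x (F : S -> R) (M : R) : (forall z, `|F z| <= M) -> 0 <= h ->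
  `|ex (jump_law h x) F - F x - lam * h * \sum_i k x i * (F (nx x i) - F x)|
    <= 3 * M * (lam * h) ^+ 2.
Proof.
move=> hM h0; have M0 : 0 <= M := le_trans (normr_ge0 _) (hM x).
have mF : measurable_fun setT F by move=> _ Y _; exact: mS.
rewrite (@ex_jump_law h x F M hM); set mu := lam * h; have mu0 : 0 <= mu by rewrite mulr_ge0.
pose E n := (X mu @^-1` [set n]) `*` (setT : set (measurableTypeR R)).
have mX n : measurable (X mu @^-1` [set n]) by exact: (poisson_measurable_pre HX).
have mE n : measurable (E n) by exact: measurableX.
have pE n : pr PU (E n) = pweight mu n.
  by rewrite pr_setX// prT mulr1 (pr_poisson HX).
pose E1 i : set (T * measurableTypeR R) := (X mu @^-1` [set 1%N]) `*` cell nx k x [:: i].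
have mcell i := cell_measurable nx x k_ge0 k_sum1 [:: i].
have mE1 i : measurable (E1 i) by exact: (measurableX (mX 1%N) (mcell i)).
have pE1 i : pr PU (E1 i) = pweight mu 1 * k x i.
  by rewrite (pr_setX (mX 1%N) (mcell i)) (pr_poisson HX)// (pr_cell nx x k_ge0 k_sum1)/= mul1r.
have bm A : measurable A -> bmeas (\1_A : (T * measurableTypeR R)%type -> R) by exact: bmeas_indic.
have bF : bmeas (F \o jump_chain x h).
  split; last by exists M => w; exact: hM.
  by apply: measurableT_comp => //; exact: jump_chain_measurable.
have b1 : bmeas (fun w => F x * \1_(E 0%N) w) by apply: bmeasZ; exact: bm.
have b2i i : bmeas (fun w => F (nx x i) * \1_(E1 i) w) by apply: bmeasZ; exact: bm.
have b2 : bmeas (fun w => \sum_i F (nx x i) * \1_(E1 i) w) by exact: bmeas_sum.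
pose g w := (F \o jump_chain x h) w - F x * \1_(E 0%N) w - \sum_i F (nx x i) * \1_(E1 i) w.
have bg : bmeas g by apply: bmeasB => //; exact: bmeasB.
have mB : measurable (~` (E 0%N `|` E 1%N)) by apply: measurableC; exact: measurableU.
pose b w : R := M * \1_(~` (E 0%N `|` E 1%N)) w.
have bb : bmeas b by apply: bmeasZ; exact: bm.
have gb w : `|g w| <= b w.
  rewrite /g /b.
  case e : (X mu w.1) => [|[|n]].
  - have w0 : E 0%N w by split.
    have wN : ~ (~` (E 0%N `|` E 1%N)) w by apply; left.
    have w1 i : ~ E1 i w by move=> [/=]; rewrite e.
    rewrite (indic_in w0) (indic_out wN) big1; last by move=> i _; rewrite (indic_out (w1 i)) mulr0.
    by rewrite mulr0 mulr1 subr0 /= jump_chainE// -/mu e /embedded /= subrr normr0.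
  - have w0 : ~ E 0%N w by move=> [/=]; rewrite e.
    have wN : ~ (~` (E 0%N `|` E 1%N)) w by apply; right; split.
    have := size_cell_code nx k x (unit_clip w.2) 1.
    case ec : (cell_code nx k x (unit_clip w.2) 1) => [//|i [|//]] _.
    have w1 : E1 i w by split.
    rewrite (indic_out w0) (indic_out wN) (bigD1 i)//= (indic_in w1) big1 ?addr0.
      by rewrite !mulr0 subr0 mulr1 jump_chainE// -/mu e /embedded ec /= subrr normr0.
    move=> j ji; have w1j : ~ E1 j w.
      by move=> [/= _ /cell1E]; rewrite ec => -[ij]; rewrite ij eqxx in ji.
    by rewrite (indic_out w1j) mulr0.
  - have w0 : ~ E 0%N w by move=> [/=]; rewrite e.
    have wN : (~` (E 0%N `|` E 1%N)) w by move=> [] [/=]; rewrite e.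
    have w1 i : ~ E1 i w by move=> [/=]; rewrite e.
    rewrite (indic_out w0) (indic_in wN) big1; last by move=> i _; rewrite (indic_out (w1 i)) mulr0.
    by rewrite mulr0 !subr0 mulr1; exact: hM.
set S0 := \sum_i k x i * F (nx x i).
have eg : ex PU g = ex PU (F \o jump_chain x h) - F x * pweight mu 0 - pweight mu 1 * S0.
  rewrite /g exB//; last exact: bmeasB.
  rewrite exB// (exZ PU _ (bm _ (mE 0%N))) (ex_indic PU (mE 0%N)) pE.
  congr (_ - _); rewrite ex_sum// mulr_sumr; apply: eq_bigr => i _.
  by rewrite (exZ PU _ (bm _ (mE1 i))) (ex_indic PU (mE1 i)) pE1 mulrC -mulrA.
have eb : ex PU b = M * (1 - (pweight mu 0 + pweight mu 1)).
  rewrite (exZ PU _ (bm _ mB)) (ex_indic PU mB) prC; last exact: measurableU.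
  rewrite prU// ?pE//; apply/seteqP; split => // w [[/= w0 _] [/=]].
  by rewrite w0.
have g1 : ex PU g <= ex PU b.
  by apply: ex_le => // w; have := gb w; rewrite ler_norml => /andP[].
have g2 : - ex PU b <= ex PU g.
  have bN : bmeas (fun w => -1 * b w) by exact: bmeasZ.
  rewrite -mulN1r -exZ//; apply: ex_le => // w.
  by have := gb w; rewrite ler_norml mulN1r => /andP[].
have S0M : `|S0| <= M.
  rewrite (le_trans (ler_norm_sum _ _ _))// -[leRHS]mulr1 -(k_sum1 x) mulr_sumr.
  apply: ler_sum => i _; rewrite normrM ger0_norm// mulrC.
  by apply: ler_wpM2r.
have -> : \sum_i k x i * (F (nx x i) - F x) = S0 - F x.
  under eq_bigr do rewrite mulrBr.
  by rewrite sumrB -mulr_suml k_sum1 mul1r.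
have p0E : pweight mu 0 = expR (- mu) by rewrite /pweight expr0 fact0 divr1 mul1r.
have p1E : pweight mu 1 = mu * expR (- mu) by rewrite /pweight expr1 (_ : 1`! = 1%N)// divr1.
have a1 : 1 - mu <= expR (- mu) := expR_ge1Dx (- mu).
have a4 : (1 + mu) * expR (- mu) <= 1.
  rewrite -[leRHS](_ : expR mu * expR (- mu) = 1); last by rewrite -expRD subrr expR0.
  by rewrite ler_wpM2r ?expR_ge0// expR_ge1Dx.
have a2 : expR (- mu) <= 1 - mu + mu ^+ 2.
  by move: a1 a4; rewrite mulrDl mul1r; move: (expR (- mu)) => v; nra.
have a3 : expR (- mu) <= 1 by rewrite -expR0 ler_expR oppr_le0.
move: eg eb g1 g2; rewrite p0E p1E; move: (expR (- mu)) a1 a2 a3 a4 => a a1 a2 a3 a4.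
move: (ex PU g) (ex PU b) (ex PU _) => eg eb EE -> -> g1 g2.
have := hM x; move: S0M; rewrite !ler_norml => /andP[s1 s2] /andP[f1 f2].
clear -mu0 M0 s1 s2 f1 f2 a1 a2 a3 a4 g1 g2.
move: S0 s1 s2 (F x) mu mu0 f1 f2 a1 a2 a4 g1 g2.
move=> S0' s1 s2 f u u0 f1 f2 a1 a2 a4 g1 g2.
(* With [a = expR (- u)], the three errors [a - 1 + u], [u * (1 - a)] and [1 - (a + u * a)] are each
   at most [u^2]; they are multiplied by numbers of size at most [M], whence [3 * M]. *)
have bd (z v : R) : - M <= z -> z <= M -> 0 <= v -> v <= u ^+ 2 ->
    - (M * u ^+ 2) <= z * v <= M * u ^+ 2.
  move=> z1 z2 v0 v1.
  have h1 : M * v <= M * u ^+ 2 by apply: ler_wpM2l.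
  have h2 : z * v <= M * v by apply: ler_wpM2r.
  have h3 : - M * v <= z * v by apply: ler_wpM2r.
  by apply/andP; split; lra.
have b1 : 0 <= u * (1 - a) <= u ^+ 2.
  by rewrite expr2 mulr_ge0 ?subr_ge0//=; apply: ler_wpM2l => //; lra.
have /andP[b2 b3] : 0 <= 1 - (a + u * a) <= u ^+ 2.
  by move: b1 a4; rewrite mulrBr mulr1 mulrDl mul1r => /andP[b1 b2] a4; apply/andP; split; lra.
have /andP[b4 b5] := b1; have /andP[c1 c2] := bd f (a - 1 + u) f1 f2 ltac:(lra) ltac:(lra).
have /andP[c3 c4] := bd S0' (u * (1 - a)) s1 s2 b4 b5.
have /andP[c5 c6] := bd M (1 - (a + u * a)) ltac:(lra) (lexx M) b2 b3.
by apply/andP; split; lra.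
Qed.

Definition chain_gen (F : S -> R) (x : S) : R := lam * \sum_i k x i * (F (nx x i) - F x).

Lemma jump_law_generator (F : S -> R) (M : R) x : (forall z, `|F z| <= M) ->
  (ex (jump_law h x) F - F x) / h @[h --> 0^'+] --> chain_gen F x.
Proof.
move=> hM; have M0 : 0 <= M := le_trans (normr_ge0 _) (hM x).
set c := 3 * M * lam ^+ 2; have c0 : 0 <= c.
  by rewrite mulr_ge0 ?sqr_ge0// mulr_ge0.
have hid : (fun h : R => h) @ 0^'+ --> (0 : R) by apply: cvg_at_right_filter; exact: cvg_id.
have hc (b : R) : chain_gen F x + b * h @[h --> 0^'+] --> chain_gen F x.
  rewrite -[X in _ --> X](_ : chain_gen F x + b * 0 = _); last by rewrite mulr0 addr0.
  by apply: cvgD; [exact: cvg_cst|apply: cvgM => //; exact: cvg_cst].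
apply: (squeeze_cvgr _ (hc (- c)) (hc c)); near=> h.
have h0 : 0 < h by near: h; exact: nbhs_right_gt.
have := jump_law_short x hM (ltW h0); rewrite ler_norml /c /chain_gen.
move: (ex _ _) (F x) (\sum_i _) => E f Sg /andP[h1 h2]; apply/andP; split.
  by rewrite ler_pdivlMr//; move: h1; rewrite exprMn expr2; nra.
by rewrite ler_pdivrMr//; move: h2; rewrite exprMn expr2; nra.
Unshelve. all: by end_near.
Qed.

Lemma jump_semigroup : semigroup_of chain_gen jump_law.
Proof.
split.
- move=> x A _; suff : PU (jump_chain x 0 @^-1` A) = \d_x A by [].
  rewrite diracE; have [Ax|Ax] := boolP (x \in A).
    rewrite (_ : _ @^-1` _ = setT) ?probability_setT//.
    by apply/seteqP; split => // w _ /=; rewrite jump_chain0; exact: set_mem.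
  rewrite (_ : _ @^-1` _ = set0) ?measure0//.
  apply/seteqP; split => // w /=; rewrite jump_chain0 => /mem_set.
  by rewrite (negbTE Ax).
- move=> s t x A s0 t0 mA.
  have st : 0 <= s <= s + t by rewrite s0 lerDl.
  have h : history (jump_chain x) [set u | 0 <= u <= s] setT by exact: history_setT.
  have := jump_chain_markov A st h; rewrite setTI addrAC subrr add0r => e.
  apply: etrans e _; apply: esym.
  have mg : measurable_fun setT (fun z => jump_law t z A) by move=> _ Y _; exact: mS.
  apply: etrans (ge0_integral_pushforward (jump_chain_measurable x s) _ _ mg _) _ => //.
- move=> F [M hM] x; have h := @jump_law_generator F M x hM; rewrite /ex in h; exact: h.
Qed.

Lemma jump_chain_markov_process x : markov_process PU chain_gen x (jump_chain x).
Proof.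
split.
- by move=> t _; exact: jump_chain_measurable.
- rewrite (_ : _ @^-1` _ = setT) ?probability_setT//.
  by apply/seteqP; split => // w _ /=; exact: jump_chain0.
- exists jump_law; first exact: jump_semigroup.
  by move=> s t A B st hA _; exact: jump_chain_markov.
Qed.

End JumpChain.

(** * Stability of the cells under convergence of the rates *)

Section CellConvergence.
Context {R : realType} {S : Type} {m : nat}.
Variables (nx : S -> 'I_m.+1 -> S) (kn : nat -> S -> 'I_m.+1 -> R) (k : S -> 'I_m.+1 -> R) (x : S).
Hypothesis kn_ge0 : forall n z i, 0 <= kn n z i.
Hypothesis kn_sum1 : forall n z, \sum_i kn n z i = 1.
Hypothesis kn_cvg : forall z i, kn n z i @[n --> \oo] --> k z i.

Lemma cell_len_cvg c : cell_len nx (kn n) x c @[n --> \oo] --> cell_len nx k x c.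
Proof. by elim: c => [|i c IH] /=; [exact: cvg_cst|apply: cvgM]. Qed.

Lemma cell_lo_cvg c : cell_lo nx (kn n) x c @[n --> \oo] --> cell_lo nx k x c.
Proof.
elim: c => [|i c IH] /=; first exact: cvg_cst.
apply: cvgD => //; apply: cvgM; first exact: cell_len_cvg.
by rewrite /k_below; apply: cvg_big; [exact: add_continuous|move=> j _; exact: kn_cvg].
Qed.

(** Strict inequalities at both ends persist when the endpoints converge, so the first [size c]
    moves are eventually the same. *)
Lemma cell_code_near u c : cell_lo nx k x c < u < cell_lo nx k x c + cell_len nx k x c ->
  \forall n \near \oo, cell_code nx (kn n) x u (size c) = c.
Proof.
move=> /andP[u1 u2].
have hi : cell_lo nx (kn n) x c + cell_len nx (kn n) x c @[n --> \oo] -->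
    cell_lo nx k x c + cell_len nx k x c.
  by apply: cvgD; [exact: cell_lo_cvg|exact: cell_len_cvg].
have lo := @cell_lo_cvg c.
apply: filterS2 (cvgr_lt _ lo _ u1) (cvgr_gt _ hi _ u2) => n h1 h2.
by apply: cell_code_eq => //; apply/andP; split => //; exact: ltW.
Qed.

End CellConvergence.

Section Skeleton.
Context {R : realType} {S : Type} {m : nat}.
Variables (nx : S -> 'I_m.+1 -> S) (k : S -> 'I_m.+1 -> R) (x : S).

(** Cells contain their left end but not their right one, so avoiding the countably many left ends
    places [u] strictly inside all its cells. *)
Definition interior_points : set (measurableTypeR R) :=
  [set u | 0 <= u < 1 /\ forall c, u <> cell_lo nx k x c].

Let hit j : set (measurableTypeR R) :=
  if pickle_inv j is Some c then [set cell_lo nx k x c] else set0.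

Let interior_pointsE : interior_points = [set u | 0 <= u < 1] `\` \bigcup_j hit j.
Proof.
apply/seteqP; split => u /= [u01 h]; split => //.
  by move=> [j _]; rewrite /hit; case: pickle_inv => // c /= /h.
move=> c uc; apply: h; exists (pickle c) => //; by rewrite /hit pickleK_inv.
Qed.

Let mhit : measurable (\bigcup_j hit j).
Proof.
by apply: bigcupT_measurable => j; rewrite /hit; case: pickle_inv => // c.
Qed.

Lemma interior_points_measurable : measurable interior_points.
Proof. by rewrite interior_pointsE; apply: measurableD => //; exact: measurable_co. Qed.

Lemma pr_interior_points : pr unif interior_points = 1.
Proof.
have m01 := @measurable_co R 0 1.
have p01 : pr unif [set u : measurableTypeR R | 0 <= u < 1] = 1.
  by have := @unif_itv R 0 1 (lexx 0) ler01; rewrite !add0r => -> //.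
have p0 : pr unif (\bigcup_j hit j) = 0.
  rewrite /pr measure_negligible//; apply: negligible_bigcup => j.
  apply/negligibleP; first by rewrite /hit; case: pickle_inv.
  rewrite /hit; case: pickle_inv => [c|]; last exact: measure0.
  have /null_content_dominatesP h := dominates_uniform_prob (@ltr01 R).
  by apply: h => //; exact: lebesgue_measure_set1.
have := prID unif m01 mhit; rewrite -interior_pointsE p01 => e.
rewrite [LHS](_ : _ = 1 - pr unif ([set u | 0 <= u < 1] `&` \bigcup_j hit j)); last by lra.
rewrite (pr_null_sub _ _ _ p0) ?subr0//; exact: measurableI.
Qed.

End Skeleton.

Section ClockCadlag.
Context {R : realType} {E : pseudoMetricType R}.

Lemma cadlag_clock (f : R -> nat) (g : nat -> E) (lam : R) : 0 < lam -> cadlag f ->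
  cadlag (fun t => g (f (lam * Num.max t 0))).
Proof.
move=> l0 cf t t0; have lt0 : 0 <= lam * t by rewrite mulr_ge0// ltW.
have mx (u : R) : 0 <= u -> Num.max u 0 = u by move/max_idPl.
split.
  have [e e0 he] := cadlag_right nbhs_nat1 cf lt0.
  have el : t < t + e / lam by rewrite ltrDl divr_gt0.
  apply: cvg_near_cst; near=> u.
  have tu : t < u by near: u; exact: nbhs_right_gt.
  have ue : u < t + e / lam by near: u; exact: nbhs_right_lt.
  rewrite !mx ?(le_trans t0 (ltW tu))// he// ler_wpM2l ?ltW//=.
  by rewrite -ltr_pdivlMl// mulrDr mulKf ?gt_eqF// mulrC.
move=> tpos; have ltpos : 0 < lam * t by rewrite mulr_gt0.
have [e e0 [l hl]] := cadlag_left nbhs_nat1 cf ltpos.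
have el : t - e / lam < t by rewrite ltrBlDr ltrDl divr_gt0.
exists (g l); apply: cvg_near_cst; near=> u.
have ut : u < t by near: u; exact: nbhs_left_lt.
have eu : t - e / lam < u by near: u; exact: nbhs_left_gt.
have u0 : 0 < u by near: u; exact: nbhs_left_gt.
rewrite mx ?ltW// hl//; rewrite ltr_pM2l// ut andbT.
by rewrite -ltr_pdivrMl// mulrBr mulKf ?gt_eqF// mulrC.
Unshelve. all: by end_near.
Qed.

End ClockCadlag.

(** * All chains on one probability space *)

Section CoupledChains.
Context {R : realType} {n : nat}.
Local Notation W := (weylZ n.+1).
Local Notation rate := ('rV[int]_n.+1 -> 'I_n.+1 -> R).
Implicit Types (r : rate).
Context {d} {T : measurableType d} (P : probability T R).
Variables (X : R -> T -> nat) (HX : poisson_process P X) (y : W).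

(* Uniformization: the last choice means that the chain does not move. *)
Definition lazy_next (x : W) (i : 'I_n.+2) : W :=
  if insub (i : nat) is Some j then wnext x j else x.

Definition lazy_prob r (x : W) (i : 'I_n.+2) : R :=
  if insub (i : nat) is Some j then wrate r x j / n.+1%:R
  else 1 - (\sum_j wrate r x j) / n.+1%:R.

Let N0 : 0 < n.+1%:R :> R. Proof. by rewrite ltr0n. Qed.

Let insub_widen (i : 'I_n.+1) : insub (widen_ord (leqnSn n.+1) i : nat) = Some i.
Proof. by rewrite /= valK. Qed.

Let insub_max : insub (@ord_max n.+1 : nat) = None :> option 'I_n.+1.
Proof. by rewrite insubF//= ltnn. Qed.

Lemma lazy_prob_ge0 r : weyl_rates r -> forall x i, 0 <= lazy_prob r x i.
Proof.
move=> [r0 _ rN] x i; rewrite /lazy_prob; case: insub => [j|].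
  by apply: divr_ge0; [apply: r0; exact: (valP x)|exact: ltW].
by rewrite subr_ge0 ler_pdivrMr// mul1r; apply: rN; exact: (valP x).
Qed.

Lemma lazy_prob_sum1 r x : \sum_i lazy_prob r x i = 1.
Proof.
rewrite big_ord_recr/= {2}/lazy_prob insub_max mulr_suml.
under eq_bigr do rewrite /lazy_prob insub_widen.
by rewrite addrC subrK.
Qed.

Lemma lazy_gen r : weyl_rates r ->
  chain_gen lazy_next (lazy_prob r) n.+1%:R = jump_generator r :> ((W -> R) -> W -> R).
Proof.
move=> hr; rewrite jump_generatorE//; apply/funext => F; apply/funext => x.
rewrite /chain_gen /jgen big_ord_recr/= {2}/lazy_next insub_max subrr mulr0 addr0 mulr_sumr.
apply: eq_bigr => i _; rewrite /lazy_prob /lazy_next insub_widen.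
have := gt_eqF N0; move: (n.+1%:R : R) (F _) (F x) (wrate _ _ _) => l a b c l0.
by field; rewrite l0.
Qed.

Definition chain_path r (w : T * measurableTypeR R) : skorokhod R W :=
  let: And4 _ cX _ _ := HX in
  Skorokhod (cadlag_clock (fun j => embedded lazy_next (lazy_prob r) y j w.2) N0 (cX w.1)).

Lemma chain_pathE r : (fun t w => chain_path r w t) =
  jump_chain X lazy_next (lazy_prob r) n.+1%:R y.
Proof. by rewrite /chain_path; case: HX. Qed.

Lemma chain_path_markov r : weyl_rates r ->
  markov_process (PU P) (jump_generator r) y (fun t w => chain_path r w t).
Proof.
move=> hr; rewrite chain_pathE -lazy_gen//.
apply: (jump_chain_markov_process HX (@mW n.+1)) => //.
  exact: lazy_prob_ge0.
exact: lazy_prob_sum1.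
Qed.

Variables (rn : nat -> rate) (r : rate).
Hypothesis hrn : forall j, weyl_rates (rn j).
Hypothesis hr : weyl_rates r.
Hypothesis rn_cvg : forall x i, in_weyl x -> rn j x i @[j --> \oo] --> r x i.

Let lazy_cvg x i : lazy_prob (rn j) x i @[j --> \oo] --> lazy_prob r x i.
Proof.
rewrite /lazy_prob; case: insub => [k|].
  by apply: cvgM; [apply: rn_cvg; exact: (valP x)|exact: cvg_cst].
apply: cvgB; first exact: cvg_cst.
apply: cvgM; last exact: cvg_cst.
apply: cvg_big; first exact: add_continuous.
by move=> j _; apply: rn_cvg; exact: (valP x).
Qed.

Lemma chain_path_cvg w : mono_paths X w.1 ->
  interior_points lazy_next (lazy_prob r) y w.2 ->
  chain_path (rn j) w @[j --> \oo] --> chain_path r w.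
Proof.
move=> hw [u01 hu] A [m [e e0 Ae]].
have cu : unit_clip w.2 = w.2 by rewrite /unit_clip u01.
(* The number of ticks up to time [m]. Once the first [J] moves agree, the two paths coincide on
   [[0, m]] and the identity serves as time change. *)
pose J := X (n.+1%:R * Num.max m 0) w.1.
pose c := cell_code lazy_next (lazy_prob r) y w.2 J.
have cJ : size c = J by rewrite size_cell_code.
have uc : cell_lo lazy_next (lazy_prob r) y c < w.2 <
    cell_lo lazy_next (lazy_prob r) y c + cell_len lazy_next (lazy_prob r) y c.
  have /andP[c1 c2] := in_cell_code lazy_next y (lazy_prob_sum1 r) J u01.
  by rewrite c2 andbT lt_neqAle c1 andbT; apply/eqP => h; exact: (hu c (esym h)).
have H := cell_code_near (fun j => lazy_prob_ge0 (hrn j)) (fun j => lazy_prob_sum1 (rn j))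
  lazy_cvg uc.
apply: filterS H => j cj; apply: Ae; exists id; first exact: time_change_id.
split=> t => [_|/andP[t0 tm]]; first by rewrite subrr normr0.
suff -> : chain_path (rn j) w t = chain_path r w t by exact: ballxx.
have E r' : chain_path r' w t = jump_chain X lazy_next (lazy_prob r') n.+1%:R y t w.
  by rewrite -chain_pathE.
rewrite !E !jump_chainE//.
have Xt : (X (n.+1%:R * t) w.1 <= J)%N.
  apply: (mono_pathsP HX hw); first by rewrite mulr_ge0.
  by rewrite ler_pM2l// le_max tm.
have cj' : cell_code lazy_next (lazy_prob (rn j)) y w.2 J = c by rewrite -cJ; exact: cj.
by rewrite /embedded cu -!(cell_code_drop _ _ _ _ Xt) -/c cj'.
Qed.

Lemma ex_chain_path_cvg (Phi : skorokhod R W -> R) (M : R) : continuous Phi ->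
  (forall f, `|Phi f| <= M) ->
  ex (PU P) (Phi \o chain_path (rn j)) @[j --> \oo] --> ex (PU P) (Phi \o chain_path r).
Proof.
move=> cPhi hM.
have mP r' : weyl_rates r' -> measurable_fun setT (Phi \o chain_path r').
  move=> hr'; have [mX _ _] := chain_path_markov hr'.
  exact: measurable_Phi.
have mG := mono_paths_measurable HX.
have mI := interior_points_measurable lazy_next (lazy_prob r) y.
apply: (@ex_cvg _ _ _ (PU P) _ _ M
  (mono_paths X `*` interior_points lazy_next (lazy_prob r) y)) => //.
- by move=> j; exact: mP.
- exact: mP.
- by move=> j w; exact: hM.
- by move=> w; exact: hM.
- exact: measurableX.
- by rewrite pr_setX// (pr_mono_paths HX) pr_interior_points mulr1.
- by move=> w [w1 w2] A /(cPhi _)/(chain_path_cvg w1 w2).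
Qed.

End CoupledChains.

(** * Limits of the myopic walks *)

Section Rates.
Context {R : realType} {N : nat} {d} {T : measurableType d} (P : probability T R).
Variables (Y : 'I_N -> R -> T -> nat) (HY : poisson_system P Y).
Local Notation h := (stay_prob P Y).

Lemma mRW_weyl_rates L : 0 < L -> weyl_rates (mRW_rate (h L)).
Proof.
move=> L0; split=> x; rewrite /mRW_rate.
- by move=> i _; apply: divr_ge0; exact: stay_prob_ge0.
- by move=> i _ xW; rewrite stay_prob_out ?mul0r// ltW.
- move=> xW; have h0 := stay_prob_gt0 HY L0 xW.
  by rewrite -mulr_suml ler_pdivrMr//; exact: stay_prob_sum_le.
Qed.

(** A jump is blocked in TASEP exactly when it leaves the chamber, and then the myopic rate is
    already 0 for every [L > 0]. *)
Lemma mRW_rate_cvg0 (x : 'rV[int]_N) i : in_weyl x ->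
  mRW_rate (h L) x i @[L --> 0^'+] --> (TASEP_rate x i : R).
Proof.
move=> xW; rewrite /TASEP_rate /mRW_rate; have [xW'|xW'] := boolP (in_weyl (x + evec i)).
  rewrite ifF; first exact: stay_ratio_cvg0.
  apply/negbTE/existsPn => j; apply/eqP => xj.
  have ij : i != j by apply/eqP => ij; move: xj; rewrite ij; lia.
  have e : (x + evec i) 0 i = (x + evec i) 0 j.
    by rewrite !mxE !eqxx /= xj eq_sym (negbTE ij) addr0.
  move/forallP : xW' => W; case: (ltngtP i j) => [ij'|ji|/val_inj ij'].
  - by have /forallP/(_ j)/implyP/(_ ij') := W i; rewrite e ltxx.
  - by have /forallP/(_ i)/implyP/(_ ji) := W j; rewrite e ltxx.
  - by rewrite ij' eqxx in ij.
have [j ij xj] := weyl_wall xW xW'.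
rewrite ifT; last by apply/existsP; exists j; rewrite xj.
apply: cvg_near_cst; apply: filterS (nbhs_right_ge (0 : R)) => L L0.
by rewrite stay_prob_out ?mul0r.
Qed.

(** Passing to the limit gives, among others, [\sum_i Delta(x + e_i) <= N * Delta(x)] in the chamber
    without any computation with [Delta]. *)
Lemma weyl_rates_lim (rn : nat -> 'rV[int]_N -> 'I_N -> R) r : (forall j, weyl_rates (rn j)) ->
  (forall x i, in_weyl x -> rn j x i @[j --> \oo] --> (r x i : R)) -> weyl_rates r.
Proof.
move=> hrn hcvg; split=> x.
- move=> i xW; apply: (cvgr_to_ge (hcvg x i xW)); apply: nearW => j.
  by have [h0 _ _] := hrn j; exact: h0.
- move=> i xW xW'; apply: (cvg_unique _ (hcvg x i xW)) => //.
  rewrite (_ : (fun j => _) = (fun=> 0)); first exact: cvg_cst.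
  by apply/funext => j; have [_ h0 _] := hrn j; exact: h0.
- move=> xW; have hs : \sum_i rn j x i @[j --> \oo] --> (\sum_i r x i : R).
    by apply: cvg_big; [exact: add_continuous|move=> i _; exact: hcvg].
  apply: (cvgr_to_le hs); apply: nearW => j.
  by have [_ _ hN] := hrn j; exact: hN.
Qed.

End Rates.

Section LawConvergence.
Context {R : realType} {n : nat}.
Context {d0} {T0 : measurableType d0} (P0 : probability T0 R).
Variables (Y : R -> T0 -> nat) (HY : poisson_process P0 Y) (y : weylZ n.+1).
Variables (d : R -> measure_display) (T : forall L : R, measurableType (d L))
  (P : forall L : R, probability (T L) R)
  (X : forall L : R, T L -> skorokhod R (weylZ n.+1))
  (r : R -> 'rV[int]_n.+1 -> 'I_n.+1 -> R) (r' : 'rV[int]_n.+1 -> 'I_n.+1 -> R).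
Hypothesis Hr : forall L, 0 < L -> weyl_rates (r L).
Hypothesis HX : forall L, 0 < L ->
  markov_process (P L) (jump_generator (r L)) y (fun t w => X w t).

(** Dominated convergence works along sequences. [seqs] stands for a family of positive sequences
    that detects convergence along [F], so both limits are treated at once. *)
Lemma law_cvg_of_rates (F : set_system R) (seqs : (nat -> R) -> Prop) :
  Filter F -> (\forall L \near F, 0 < L) -> (exists u, seqs u) ->
  (forall u, seqs u -> forall j, 0 < u j) ->
  (forall v (l : R), v L @[L --> F] --> l <->
     forall u, seqs u -> v (u j) @[j --> \oo] --> l) ->
  (forall x i, in_weyl x -> r L x i @[L --> F] --> r' x i) ->
  weyl_rates r' /\ cvg_in_law F P X (PU P0) (chain_path HY y r').
Proof.
move=> FF F0 [u0 hu0] s0 sP rr'.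
have rcvg u : seqs u -> forall x i, in_weyl x -> r (u j) x i @[j --> \oo] --> r' x i.
  by move=> su x i xW; exact: ((sP (fun L => r L x i) _).1 (rr' x i xW) _ su).
have hr' : weyl_rates r'.
  by apply: weyl_rates_lim (rcvg _ hu0) => j; apply: Hr; exact: s0.
split => // Phi cPhi [M hM].
have bm r0 : weyl_rates r0 -> bmeas (Phi \o chain_path HY y r0).
  move=> h0; have [mX _ _] := chain_path_markov HY y h0.
  by split; [exact: measurable_Phi|exists M => w; exact: hM].
rewrite (expectationE (PU P0) (bm _ hr')).
have h : ex (PU P0) (Phi \o chain_path HY y (r L)) @[L --> F] -->
    ex (PU P0) (Phi \o chain_path HY y r').
  apply/(sP (fun L => ex (PU P0) (Phi \o chain_path HY y (r L)))) => u su.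
  have hru j : weyl_rates (r (u j)) by apply: Hr; exact: s0.
  by have c := @ex_chain_path_cvg _ _ _ _ P0 Y HY y _ _ hru hr' (rcvg u su) Phi M cPhi hM; exact: c.
have h' : (ex (PU P0) (Phi \o chain_path HY y (r L)))%:E @[L --> F] -->
    (ex (PU P0) (Phi \o chain_path HY y r'))%:E by apply: cvg_EFin => //; exact: nearW.
(* For [L > 0] the given walk has the same law as the coupled chain with the same rates, so its
   expectation may be replaced. *)
apply: cvg_trans h'; apply: near_eq_cvg.
apply: filterS F0 => L L0.
have [mX _ _] := HX L0.
rewrite (expectationE (P L)); last first.
  by split; [exact: measurable_Phi|exists M => w; exact: hM].
congr EFin; apply: esym.
by apply: (markov_law_unique (Hr L0) (HX L0) (chain_path_markov HY y (Hr L0)) cPhi hM).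
Qed.

End LawConvergence.

(** * The case of no particle, where a clock of rate [N] would stand still *)

Section NoParticle.
Context {R : realType} (y : weylZ 0).

Lemma weylZ0_eq (x z : weylZ 0) : x = z.
Proof. by apply: val_inj; apply/rowP => -[]. Qed.

Lemma skorokhod_weylZ0_eq (f g : skorokhod R (weylZ 0)) : f = g.
Proof. by apply: skorokhod_eq; apply/funext => t; exact: weylZ0_eq. Qed.

Lemma cadlag_cst : cadlag (fun _ : R => y).
Proof. by move=> t _; split=> [|_]; [|exists y]; exact: cvg_cst. Qed.

Definition cst_path {T : Type} (_ : T) : skorokhod R (weylZ 0) := Skorokhod cadlag_cst.

Lemma cst_path_markov {d} {T : measurableType d} (P : probability T R) r :
  markov_process P (jump_generator r) y (fun t w => cst_path w t).
Proof.
split.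
- by move=> t _; exact: measurable_cst.
- rewrite (_ : _ @^-1` _ = setT) ?probability_setT//.
  by apply/seteqP; split.
exists (fun _ x => \d_x : probability (weylZ 0) R); first split => //.
- move=> s t x A _ _ _; by rewrite integral_dirac// diracT mul1e.
- move=> F _ x; rewrite /jump_generator big_ord0.
  rewrite (_ : (fun h => _) = (fun=> 0)); first exact: cvg_cst.
  apply/funext => h; rewrite (_ : Rintegral _ _ _ = F x) ?subrr ?mul0r//.
  by rewrite /Rintegral integral_dirac// diracT mul1e.
move=> s t A B _ hA _; have mA : measurable A.
  apply: history_measurable hA => u _; exact: measurable_cst.
rewrite (eq_integral (fun=> ((y \in B)%:R : R)%:E)); last by move=> w _; exact: diracE.
rewrite integral_cst//; have [yB|yB] := boolP (y \in B).
  rewrite mul1e (_ : _ @^-1` _ = setT) ?setIT//.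
  by apply/seteqP; split => // w _ /=; exact: set_mem.
rewrite mul0e (_ : _ @^-1` _ = set0) ?setI0 ?measure0//.
by apply/seteqP; split => // w /= /mem_set; rewrite (negbTE yB).
Qed.

Lemma cst_path_cvg (F : set_system R) (d : R -> measure_display)
    (T : forall L : R, measurableType (d L)) (P : forall L : R, probability (T L) R)
    (X : forall L : R, T L -> skorokhod R (weylZ 0)) {d'} {T' : measurableType d'}
    (Q : probability T' R) :
  Filter F -> cvg_in_law F P X Q cst_path.
Proof.
move=> FF Phi _ _.
have e d1 (T1 : measurableType d1) (P1 : probability T1 R) (Z : T1 -> skorokhod R (weylZ 0)) :
    'E_P1[Phi \o Z]%E = (Phi (Skorokhod cadlag_cst))%:E.
  rewrite (_ : Phi \o Z = cst (Phi (Skorokhod cadlag_cst))) ?expectation_cst//.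
  by apply/funext => w /=; congr Phi; exact: skorokhod_weylZ0_eq.
rewrite e (_ : (fun L => _) = (fun=> (Phi (Skorokhod cadlag_cst))%:E)); last first.
  by apply/funext => L; exact: e.
exact: cvg_cst.
Qed.

End NoParticle.

Lemma cvg_pinfty_seqs {R : realType} (v : R -> R) (l : R) : v L @[L --> +oo] --> l <->
  forall u : nat -> R, (forall j, 0 < u j) /\ u j @[j --> \oo] --> +oo ->
    v (u j) @[j --> \oo] --> l.
Proof.
split=> [/cvg_pinftyP H u [_ /H]//|H]; apply/cvg_pinftyP => u uoo.
have upos : \forall j \near \oo, 0 < u j by exact: (uoo _ (nbhs_pinfty_gt (num_real 0))).
(* Only finitely many terms are changed, and the sequence becomes positive throughout. *)
pose u' j := if 0 < u j then u j else 1.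
have uu' : \forall j \near \oo, u' j = u j by apply: filterS upos => j; rewrite /u' => ->.
have h : v (u' j) @[j --> \oo] --> l.
  apply: H; split; first by move=> j; rewrite /u'; case: ifP.
  apply: cvg_trans uoo; apply: near_eq_cvg.
  by apply: filterS uu' => j ->.
apply: cvg_trans h; apply: near_eq_cvg.
by apply: filterS uu' => j ->.
Qed.

Theorem theorem1p1 (R : realType) (N : nat) (y : weylZ N)
    (d0 : measure_display) (T0 : measurableType d0) (P0 : probability T0 R)
    (Y : 'I_N -> R -> T0 -> nat) (HY : poisson_system P0 Y)
    (d : R -> measure_display) (T : forall L : R, measurableType (d L))
    (P : forall L : R, probability (T L) R)
    (X : forall L : R, T L -> skorokhod R (weylZ N))
    (HX : forall L : R, 0 < L -> is_mRW (P L) y (X L) (stay_prob P0 Y L)) :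
  (exists (d' : measure_display) (T' : measurableType d')
          (Q : probability T' R)
          (Z : T' -> skorokhod R (weylZ N)),
      cvg_in_law (0 : R)^'+ P X Q Z /\ is_TASEP Q y Z) /\
  (exists (d' : measure_display) (T' : measurableType d')
          (Q : probability T' R)
          (Z : T' -> skorokhod R (weylZ N)),
      cvg_in_law (pinfty_nbhs R) P X Q Z /\ is_nonintersecting Q y Z).
Proof.
case: N y Y HY X HX => [|n] y Y HY X HX.
  by split; exists d0, T0, P0, (cst_path y); split;
    [exact: cst_path_cvg|exact: cst_path_markov|exact: cst_path_cvg|exact: cst_path_markov].
(* A coordinate of the given Poisson system serves as the clock of the coupling. *)
have HY0 := HY.1 ord0.
have hr L : 0 < L -> weyl_rates (mRW_rate (stay_prob P0 Y L)) by exact: mRW_weyl_rates.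
split; exists _, _, (PU P0).
  have ex0 : exists u : nat -> R, (forall j, 0 < u j) /\ u j @[j --> \oo] --> (0 : R).
    exists (fun j => j.+1%:R^-1); split; first by move=> j; rewrite invr_gt0.
    exact: cvg_harmonic.
  have F0 : \forall L \near (0 : R)^'+, 0 < L by exact: nbhs_right_gt.
  have rc (x : 'rV[int]_n.+1) i : in_weyl x ->
      mRW_rate (stay_prob P0 Y L) x i @[L --> 0^'+] --> (TASEP_rate x i : R).
    exact: mRW_rate_cvg0.
  have FF : Filter (0 : R)^'+ by exact: _.
  have [hT cT] := law_cvg_of_rates HY0 hr HX FF F0 ex0 (fun u => @proj1 _ _)
    (fun v l => @cvg_at_rightP R v 0 l) rc.
  by exists (chain_path HY0 y TASEP_rate); split => //; exact: chain_path_markov.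
have exoo : exists u : nat -> R, (forall j, 0 < u j) /\ u j @[j --> \oo] --> +oo.
  exists (fun j => j.+1%:R); split; first by move=> j; rewrite ltr0n.
  by apply/cvgryPge => M; near=> j; rewrite -natr1 ler_wpDr//; near: j; exact: nbhs_infty_ger.
have Foo : \forall L \near (pinfty_nbhs R), 0 < L by exact: nbhs_pinfty_gt.
have rc (x : 'rV[int]_n.+1) i : in_weyl x ->
    mRW_rate (stay_prob P0 Y L) x i @[L --> +oo] --> (nonint_rate x i : R).
  by move=> xW; exact: stay_ratio_cvg_pinfty.
have FF : Filter (pinfty_nbhs R) by exact: _.
have [hT cT] := law_cvg_of_rates HY0 hr HX FF Foo exoo (fun u => @proj1 _ _) cvg_pinfty_seqs rc.
by exists (chain_path HY0 y nonint_rate); split => //; exact: chain_path_markov.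
Unshelve. all: by end_near.
Qed.
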